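(* Let $\kappa$ be a regular cardinal and $\tau$ an uncountable cardinal with $\kappa^{<\tau}=\kappa$. There exists a unique (up to isometry) Banach space $\mathfrak X=\mathfrak X(\kappa,\tau)$ with the following properties: (1) $\mathrm{dens}(\mathfrak X)=\kappa$; (2) $\mathfrak X$ is tightly $\tau$-filtered; (3) for all isometric embeddings of Banach spaces $u:X\to\mathfrak X$ and $v:X\to Y$, if $\mathrm{dens}(X)<\kappa$ and $v$ is $\tau$-posex, then there exists an isometric embedding $w:Y\to\mathfrak X$ such that $wv=u$.
   Context: Subspaces are closed linear subspaces, isometric embeddings are linear, and $\mathrm{dens}$ denotes the density character. Push-out: let $S,X$ be subspaces of a Banach space $Y$. $Y$ is the internal push-out of $S$ and $X$, written $Y=\mathbf{PO}[S,X]$, if (i) $Y=\overline{S+X}$, and (ii) $\|x+s\|=\inf\{\|x+r\|+\|s-r\|: r\in S\cap X\}$ for all $x\in X$, $s\in S$. For an uncountable cardinal $\tau$: if $X$ is a subspace of $Y$, $Y$ is a $\tau$-posex of $X$ if $Y=\mathbf{PO}[S,X]$ for some subspace $S\subset Y$ with $\mathrm{dens}(S)<\tau$. An isometric embedding $v:X\to Y$ is $\tau$-posex if $Y$ is a $\tau$-posex of $v(X)$. $\mathfrak X$ is tightly $\tau$-filtered if it is the union of a continuous tower of subspaces starting at $0$ with $\tau$-posex steps, i.e. there exist an ordinal $\lambda$ and subspaces $\{X_\alpha:\alpha\le\lambda\}$ such that $X_\alpha\subset X_\beta$ for $\alpha<\beta\le\lambda$; $X_0=0$, $X_\lambda=\mathfrak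 X$; $X_{\alpha+1}$ is a $\tau$-posex of $X_\alpha$ for every $\alpha<\lambda$; and $X_\beta=\overline{\bigcup_{\alpha<\beta}X_\alpha}$ for every limit ordinal $\beta\le\lambda$. *)

(* Defs.v *)
From HB Require Import structures.
From mathcomp Require Import all_boot all_order all_algebra.
From mathcomp Require Import all_classical all_reals all_analysis.
From mathcomp Require wochoice.
Set Implicit Arguments.
Unset Strict Implicit.
Unset Printing Implicit Defensive.
Import Order.TTheory GRing.Theory Num.Theory.
Import numFieldNormedType.Exports.
Local Open Scope classical_set_scope.
Local Open Scope card_scope.
Local Open Scope ring_scope.

(** A cardinal is represented by an arbitrary type, of which only the
    cardinality is used. Throughout, [le : rel I] with [well_order le] is the
    reflexive order of an ordinal. *)

Definition card_lt T U (A : set T) (B : set U) := (A #<= B) && ~~ (B #<= A).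

Notation "A '#<' B" := (card_lt A B) (at level 79, format "A '#<'  B")
  : card_scope.

Definition strict I (le : rel I) (a b : I) : Prop := le a b /\ a <> b.

(** [le] has the order type of the initial ordinal of cardinality [#|K|]. *)
Definition initial_order (K : Type) (le : rel K) : Prop :=
  wochoice.well_order le /\
  forall x, [set y | strict le y x] #< [set: K].

Definition cofinal (K : Type) (le : rel K) (C : set K) : Prop :=
  forall x, exists2 y, C y & le x y.

(** An infinite cardinal equal to its own cofinality. *)
Definition regular_card (K : Type) : Prop :=
  infinite_set [set: K] /\
  exists2 le : rel K, initial_order le &
    forall C : set K, cofinal le C -> [set: K] #<= C.

(** [K] is the supremum of the cardinals satisfying [F]. *)
Definition card_sup (F : Type -> Prop) (K : Type) : Prop :=
  (forall A : Type, F A -> [set: A] #<= [set: K]) /\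
  forall L : Type, (forall A : Type, F A -> [set: A] #<= [set: L]) ->
    [set: K] #<= [set: L].

(** K ^ {< T} = P, where K ^ {< T} is the supremum of K ^ M over M < T. *)
Definition weak_power_eq (K T P : Type) : Prop :=
  card_sup (fun A => exists2 M : Type, [set: M] #< [set: T] & A = (M -> K)) P.

Definition dense_in (T : topologicalType) (S D : set T) : Prop :=
  D `<=` S /\ S `<=` closure D.

(** The least cardinality of a dense subset of [S] is that of [K]. *)
Definition has_dens (T : topologicalType) (S : set T) (K : Type) : Prop :=
  (exists2 D : set T, dense_in S D & D #= [set: K]) /\
  forall D : set T, dense_in S D -> [set: K] #<= D.

Definition dens_lt (T : topologicalType) (S : set T) (K : Type) : Prop :=
  exists2 M : Type, has_dens S M & [set: M] #< [set: K].

Section Banach.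
Context {R : realType}.

Definition isometric_embedding (X Y : completeNormedModType R)
    (f : {linear X -> Y}) : Prop :=
  forall x, `|f x| = `|x|.

Definition isometric (X Y : completeNormedModType R) : Prop :=
  exists2 f : {linear X -> Y}, isometric_embedding f & range f = [set: Y].

Definition is_subspace (V : completeNormedModType R) (S : set V) : Prop :=
  closed S /\ GRing.submod_closed (mem S).

(** [Y = PO[S, X]], all three being subspaces of an ambient space [V]; since
    [Y] is closed in [V], the closure of [S + X] is the same in both. *)
Definition is_pushout (V : completeNormedModType R) (S X Y : set V) : Prop :=
  [/\ [/\ is_subspace S, is_subspace X & is_subspace Y],
      S `<=` Y, X `<=` Y,
      Y = closure [set s + x | s in S & x in X] &
      forall x s, X x -> S s ->
        `|x + s| = inf [set `|x + r| + `|s - r| | r in S `&` X] ].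

(** [Y] is a [tau]-posex of [X], both being subspaces of [V]. *)
Definition posex (tau : Type) (V : completeNormedModType R) (X Y : set V) :
    Prop :=
  exists2 S : set V, is_pushout S X Y & dens_lt S tau.

Definition posex_embedding (tau : Type) (X Y : completeNormedModType R)
    (v : {linear X -> Y}) : Prop :=
  isometric_embedding v /\ posex tau (range v) [set: Y].

Section Ordinals.
Context {I : Type} (le : rel I).

Definition is_zero (a : I) : Prop := forall b, le a b.

Definition is_succ (a b : I) : Prop :=
  strict le a b /\ forall c, strict le a c -> le b c.

Definition is_limit (b : I) : Prop :=
  ~ is_zero b /\ forall a, ~ is_succ a b.

End Ordinals.

(** The index type [I] stands for the set of ordinals [alpha <= lambda], that
    is, for [lambda + 1]; its greatest element [lambda] is part of the data. *)
Definition tightly_filtered (tau : Type) (X : completeNormedModType R) : Prop :=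
  exists (I : Type) (le : rel I) (lambda : I) (E : I -> set X),
    [/\ wochoice.well_order le, (forall a, le a lambda) &
        forall a, is_subspace (E a)] /\
    [/\ (forall a b, strict le a b -> E a `<=` E b),
        (forall a, is_zero le a -> E a = [set 0]),
        E lambda = [set: X],
        (forall a b, is_succ le a b -> posex tau (E a) (E b)) &
        forall b, is_limit le b ->
          E b = closure (\bigcup_(a in [set a | strict le a b]) E a) ].

Definition posex_extension_property (kappa tau : Type)
    (U : completeNormedModType R) : Prop :=
  forall (X Y : completeNormedModType R)
      (u : {linear X -> U}) (v : {linear X -> Y}),
    isometric_embedding u -> posex_embedding tau v ->
    dens_lt [set: X] kappa ->
    exists2 w : {linear Y -> U}, isometric_embedding w & w \o v = u.

Definition is_X_kappa_tau (kappa tau : Type) (U : completeNormedModType R) :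
    Prop :=
  [/\ has_dens [set: U] kappa,
      tightly_filtered tau U &
      posex_extension_property kappa tau U].

End Banach.

(* Main.v *)
(** A set [M] of pairs [(p, d)] with [|p - q| <= d + e] for [(p, d)], [(q, e)] in [M] prescribes
    a one-vector extension of a space [X]: a vector [z] whose distance to [x] is the infimum of
    [d + |p - x|] over the convex hull of [M]. Push-outs with a small space are iterations of
    such extensions, so property (3) says exactly that each small [M] is realized in the space
    over each subspace of density less than [kappa]. When [tau] is singular, the sets [M] of
    cardinality [tau] are then realized too, by successive approximations.

    Uniqueness: choose small dense sets generating the steps of the tower. The spans of saturated
    sets of generators form a family, closed under unions, any two members of which are
    independent in the sense of push-outs. A back-and-forth of length [kappa] between two such
    families, in which independence lets the partial isometry be extended by realizations, gives
    the isometry.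

    Existence: let [x_a], for [a < kappa], be formal vectors, to each of which a set of
    constraints [|x_a - l| <= d] is attached, with [l] a combination of the earlier [x_b] and
    bookkeeping ensuring that each consistent small set occurs cofinally often. Norm the
    combinations of the [x_a] by the functions on [kappa] satisfying all the constraints. *)
From HB Require Import structures.
Require Import Defs.
From mathcomp Require Import all_boot all_order all_algebra.
From mathcomp Require Import all_classical all_reals all_analysis.
From mathcomp Require wochoice.
From mathcomp Require Import lra.
Set Implicit Arguments.
Unset Strict Implicit.
Unset Printing Implicit Defensive.
Import Order.TTheory GRing.Theory Num.Theory.
Import numFieldNormedType.Exports.
Local Open Scope classical_set_scope.
Local Open Scope card_scope.
Local Open Scope ring_scope.

(** * Cardinals *)

Section Cardinals.

(** Why data are sets of balls: adjoining a vector z to X amounts to choosing the function x |-> |z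
    - x|. Such functions are convex, and the largest one allowed by M is the infimal convolution
    over the convex hull of M. A realization concerns a single vector, so partial isometries grow
    vector by vector; only one extension, X + R e, is ever built as a space, to read realizations
    off property (3).

    The obstacle is a singular tau. Closing an index set to a saturated one inside a class of small
    sets requires small unions of small sets to be small. If this fails for the sets smaller than
    tau, then tau < kappa because kappa is regular, and the class of sets of size at most tau, which
    has this closure property, still lies below kappa. The price is that (3) speaks of data smaller
    than tau, so larger data must be approximated.

    The equation kappa^{<tau} = kappa enters three times: it gives tau <= kappa by a diagonal
    argument, it bounds the number of small sets of constraints, and, tau being uncountable, it
    bounds the number of real coefficients by kappa. *)

Lemma card_le_inj T U (A : set T) (B : set U) (f : T -> U) :
  (forall x, A x -> B (f x)) ->
  (forall x y, A x -> A y -> f x = f y -> x = y) -> A #<= B.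
Proof.
move=> fAB finj.
have finj' : {in A &, injective f} by move=> x y /set_mem Ax /set_mem Ay; exact: finj.
rewrite -(card_le_eql (inj_card_eq finj')).
by apply: subset_card_le => _ [x Ax <-]; exact: fAB.
Qed.

Lemma card_le_surj T U (A : set T) (B : set U) (f : U -> T) :
  A `<=` f @` B -> A #<= B.
Proof. by move=> AfB; apply: card_le_trans (subset_card_le AfB) (card_image_le _ _). Qed.

Lemma card_le_fun T U (A : set T) (B : set U) : A #<= B -> A !=set0 ->
  exists f : T -> U, (forall x, A x -> B (f x)) /\
    (forall x y, A x -> A y -> f x = f y -> x = y).
Proof.
move=> /card_leP/unsquash f [x0 Ax0].
have u0 : U := set_val (f (exist _ x0 (mem_set Ax0))).
pose g x : U := if pselect (A x) is left Ax then set_val (f (exist _ x (mem_set Ax))) else u0.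
exists g; split=> [x Ax|x y Ax Ay]; rewrite /g.
  by case: pselect => // Ax'; apply: set_valP.
case: pselect => // Ax'; case: pselect => // Ay' /val_inj.
have : injective f by apply: injT.
by move=> /[apply] -[].
Qed.

Lemma card_le_onto T U (A : set T) (B : set U) : A #<= B -> A !=set0 ->
  exists f : U -> T, A `<=` f @` B /\ forall y, A (f y).
Proof.
move=> AB A0; have [f [fAB finj]] := card_le_fun AB A0.
have [x0 Ax0] := A0.
have /choice[g gP] : forall y, exists x, A x /\ forall x', A x' -> f x' = y -> x' = x.
  move=> y; have [[x [Ax fx]]|nx] := pselect (exists x, A x /\ f x = y).
    by exists x; split=> // x' Ax' fx'; apply: finj => //; rewrite fx.
  by exists x0; split=> // x' Ax' fx'; exfalso; apply: nx; exists x'.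
exists g; split=> [x Ax|y]; last by have [] := gP y.
by exists (f x); [exact: fAB|rewrite -((gP (f x)).2 x)].
Qed.

(** Take a maximal set [F] of choice functions, any two of which differ at every index. If every
    [A i] had an element missed by [F], these elements would form a further function. So some [A i]
    is exhausted by [F], and [F] injects into every [A j]. *)
Lemma card_min (I : Type) (T : I -> Type) (A : forall i, set (T i)) (i0 : I) :
  exists i, forall j, A i #<= A j.
Proof.
pose P (F : set (forall i, T i)) :=
  (forall f, F f -> forall i, A i (f i)) /\
  (forall f g i, F f -> F g -> f i = g i -> f = g).
have [F FP tF|F [[FA Finj] Fmax]] := @Zorn_bigcup _ P.
  split=> [f [X FX Xf]|f g i [X FX Xf] [Y FY Yg]]; first exact: (FP _ FX).1.
  by have [XY|YX] := tF _ _ FX FY; [apply: (FP _ FY).2|apply: (FP _ FX).2] => //;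
    [exact: XY|exact: YX].
have [[i Ai]|nsurj] := pselect (exists i, forall x, A i x -> exists2 f, F f & f i = x).
  exists i => j; apply: (@card_le_trans _ _ _ F).
    by apply: (@card_le_surj _ _ _ _ (fun f => f i)) => x /Ai[f Ff <-]; exists f.
  by apply: (@card_le_inj _ _ _ _ (fun f => f j)) => [f|f g]; [move=> Ff; exact: FA|exact: Finj].
have xP i : exists x, A i x /\ forall f, F f -> f i <> x.
  apply: contrapT => nx; apply: nsurj; exists i => x Ax.
  by apply: contrapT => nf; apply: nx; exists x; split=> // f Ff fx; apply: nf; exists f.
pose g i := sval (cid (xP i)).
have gP i : A i (g i) /\ forall f, F f -> f i <> g i := svalP (cid (xP i)).
exfalso; apply: (Fmax (F `|` [set g])).
  split; first exact: subsetUl.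
  by move=> /(_ g (or_intror erefl)) Fg; exact: ((gP i0).2 g).
split=> [f [Ff|->] i|f h i]; [exact: FA|exact: (gP i).1|].
case=> [Ff|->] [Fh|->] //; first exact: Finj.
  by move=> fh; case: ((gP i).2 f).
by move=> fh; case: ((gP i).2 h).
Qed.

Lemma card_le_total T U (A : set T) (B : set U) : A #<= B \/ B #<= A.
Proof.
pose X (b : bool) : Type := if b then T else U.
pose Y : forall b, set (X b) := fun b => if b return set (X b) then A else B.
have [[] ib] := @card_min bool X Y true.
- by left; exact: (ib false).
- by right; exact: (ib true).
Qed.

Lemma card_ltNle T U (A : set T) (B : set U) : A #< B <-> ~ (B #<= A).
Proof.
rewrite /card_lt; split=> [/andP[_ /negP]//|nBA].
by have [AB|//] := card_le_total A B; rewrite AB; apply/negP.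
Qed.

Lemma card_lt_le T U (A : set T) (B : set U) : A #< B -> A #<= B.
Proof. by case/andP. Qed.

Lemma card_le_lt_trans T U V (A : set T) (B : set U) (C : set V) :
  A #<= B -> B #< C -> A #< C.
Proof.
move=> AB /card_ltNle nCB; apply/card_ltNle => CA; apply: nCB.
exact: card_le_trans CA AB.
Qed.

Lemma card_lt_le_trans T U V (A : set T) (B : set U) (C : set V) :
  A #< B -> B #<= C -> A #< C.
Proof.
move=> /card_ltNle nBA BC; apply/card_ltNle => CA; apply: nBA.
exact: card_le_trans BC CA.
Qed.

Lemma card_leX T T' U U' (A : set T) (A' : set T') (B : set U) (B' : set U') :
  A #<= B -> A' #<= B' -> (A `*` A') #<= (B `*` B').
Proof.
move=> AB AB'.
have [[[x x'] [/= Ax Ax']]|n0] := pselect ((A `*` A') !=set0); last first.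
  suff -> : A `*` A' = set0 by exact: card_ge0.
  by apply/seteqP; split=> // p Ap; apply: n0; exists p.
have [f [fAB finj]] := card_le_fun AB (ex_intro _ x Ax).
have [f' [fAB' finj']] := card_le_fun AB' (ex_intro _ x' Ax').
apply: (@card_le_inj _ _ _ _ (fun p => (f p.1, f' p.2))) => [p [? ?]|].
  by split; [exact: fAB|exact: fAB'].
move=> [a a'] [b b'] [/= Aa Aa'] [/= Ab Ab'] [fab fab'].
by rewrite (finj _ _ Aa Ab fab) (finj' _ _ Aa' Ab' fab').
Qed.

Lemma card_leU T U V (A B : set T) (C : set U) (D : set V) c d :
  A #<= C -> B #<= D -> C c -> D d -> (A `|` B) #<= ((C `*` D) `*` [set: bool]).
Proof.
move=> AC BD Cc Dd.
have [->|/set0P A0] := eqVneq A set0; rewrite ?set0U.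
  apply: card_le_trans BD _.
  by apply: (@card_le_inj _ _ _ _ (fun x => ((c, x), true))) => // x y _ _ [].
have [->|/set0P B0] := eqVneq B set0; rewrite ?setU0.
  apply: card_le_trans AC _.
  by apply: (@card_le_inj _ _ _ _ (fun x => ((x, d), true))) => // x y _ _ [].
have [f [fA finj]] := card_le_fun AC A0; have [g [gB ginj]] := card_le_fun BD B0.
apply: (@card_le_inj _ _ _ _
  (fun x => if pselect (A x) then ((f x, d), true) else ((c, g x), false))).
  move=> x [Ax|Bx]; case: pselect => // Ax'.
  - by split=> //; split=> //; exact: fA.
  - by split=> //; split=> //; exact: fA.
  - by split=> //; split=> //; exact: gB.
move=> x y Ux Uy; case: pselect => [Ax|nAx]; case: pselect => [Ay|nAy] //.
  by case=> /finj; exact.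
by case=> /ginj; apply; [case: Ux|case: Uy].
Qed.

(** * Squares of infinite cardinals *)

Section Square.
Variables (T : Type) (A : set T).
Hypothesis Ainf : infinite_set A.

(** An injection of [B * B] into [B], coded by its graph so that the union of a chain of injections
    is a plain union. *)
Let ok (B : set T) (G : set ((T * T) * T)) :=
  [/\ forall p z, G (p, z) -> B p.1 /\ B p.2 /\ B z,
      forall x y, B x -> B y -> exists z, G ((x, y), z),
      (forall p z z', G (p, z) -> G (p, z') -> z = z') &
      forall p q z, G (p, z) -> G (q, z) -> p = q].

Let okle B G : ok B G -> (B `*` B) #<= B.
Proof.
move=> [GB Gt Gf Gi].
have [->|/set0P [b Bb]] := eqVneq B set0; first by rewrite setX0; exact: card_ge0.
have /choice[f fP] : forall p : T * T, exists z, B p.1 -> B p.2 -> G (p, z).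
  move=> [x y] /=; have [Bx|] := pselect (B x); last by exists b.
  have [By|] := pselect (B y); last by exists b.
  by have [z Gz] := Gt x y Bx By; exists z.
apply: (@card_le_inj _ _ _ _ f) => [p [Bx By]|p q [? ?] [? ?] fpq].
  by have [_ []] := GB _ _ (fP p Bx By).
apply: (Gi p q (f p)); first exact: fP.
by rewrite fpq; exact: fP.
Qed.

Let leok (B C : set T) : C `<=` B -> ((B `*` B) `\` (C `*` C)) #<= (B `\` C) ->
  forall G, ok C G -> exists2 G', ok B G' & G `<=` G'.
Proof.
move=> CB le G [GB Gt Gf Gi].
have [e|/set0P ne] := eqVneq ((B `*` B) `\` (C `*` C)) set0.
  exists G => //; split=> //.
    by move=> p z /GB[? [? ?]]; split; [exact: CB|split; exact: CB].
  move=> x y Bx By; apply: Gt; apply: contrapT => nC.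
    suff : ((B `*` B) `\` (C `*` C)) (x, y) by rewrite e.
    by split=> // -[].
  suff : ((B `*` B) `\` (C `*` C)) (x, y) by rewrite e.
  by split=> // -[].
have [f [fB finj]] := card_le_fun le ne.
pose D := (B `*` B) `\` (C `*` C).
exists (G `|` [set pz | D pz.1 /\ pz.2 = f pz.1]); last exact: subsetUl.
split.
- move=> p z [/GB[? [? ?]]|[/= Dp ->]]; first by split; [exact: CB|split; exact: CB].
  by have [[? ?] _] := Dp; have [? _] := fB _ Dp; split.
- move=> x y Bx By; have [[Cx Cy]|nC] := pselect ((C `*` C) (x, y)).
    by have [z Gz] := Gt x y Cx Cy; exists z; left.
  by exists (f (x, y)); right.
- move=> p z z' [Gz|[/= Dp ->]] [Gz'|[/= Dp' ->]] //; first exact: Gf Gz Gz'.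
    by have [? [? _]] := GB _ _ Gz; case: Dp' => _ [].
  by have [? [? _]] := GB _ _ Gz'; case: Dp => _ [].
- move=> p q z [Gz|[/= Dp ->]] [Gz'|[/= Dp' e]] //; first exact: Gi Gz Gz'.
  + by have [_ [_ Cz]] := GB _ _ Gz; case: (fB _ Dp'); rewrite -e.
  + by have [_ [_ Cz]] := GB _ _ Gz'; case: (fB _ Dp).
  + exact: finj.
Qed.

Lemma card_le_square : (A `*` A) #<= A.
Proof.
have /infiniteP/card_le_fun[|e [eA einj]] := Ainf; first by exists 0%N.
pose N := e @` [set: nat].
have NA : N `<=` A by move=> _ [n _ <-]; exact: eA.
have N1 : N #= [set: nat] by apply: inj_card_eq => x y _ _; exact: einj.
have N2 : (N `*` N) #<= N.
  apply: card_le_trans (card_leX _ _) _.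
    by rewrite (card_le_eql N1).
    by rewrite (card_le_eql N1).
  apply: card_le_trans (_ : [set: nat] #<= N); last by rewrite (card_le_eqr N1).
  by rewrite setXTT (card_le_eql card_nat2).
have [G0 ok0 _] : exists2 G', ok N G' & (set0 `<=` G').
  apply: (@leok N set0) => //; first by rewrite setX0 !setD0.
pose P G := G = set0 \/ (G0 `<=` G /\ exists2 B, B `<=` A & ok B G).
have [F FP tF|G [PG Gmax]] := @Zorn_bigcup _ P.
  have [[X [FX X0]]|nF] := pselect (exists X, F X /\ X <> set0); last first.
    left; apply/seteqP; split=> // p [X FX Xp]; exfalso; apply: nF.
    by exists X; split=> // X0; rewrite X0 in Xp.
  right; split.
    have [//|[sX _]] := FP _ FX.
    by apply: (subset_trans sX) => p Xp; exists X.
  have FB Y : F Y -> exists B, Y <> set0 -> B `<=` A /\ ok B Y.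
    by move=> /FP[->|[_ [B BA okB]]]; [exists set0|exists B].
  pose BY Y := if pselect (F Y) is left FY then sval (cid (FB Y FY)) else set0.
  have BYP Y : F Y -> Y <> set0 -> BY Y `<=` A /\ ok (BY Y) Y.
    move=> FY Y0; rewrite /BY; case: pselect => // FY'.
    by case: (cid _) => B /= /(_ Y0).
  have F1 Y Z : F Y -> F Z -> exists W, [/\ F W, Y `<=` W & Z `<=` W].
    move=> FY FZ; have [YZ|ZY] := tF _ _ FY FZ.
      by exists Z; split=> //; exact: subset_refl.
    by exists Y; split=> //; exact: subset_refl.
  have okne (Y : set (T * T * T)) p : Y p -> Y <> set0 by move=> Yp Y0; rewrite Y0 in Yp.
  have BYB Y W : F Y -> F W -> Y <> set0 -> Y `<=` W -> BY Y `<=` BY W.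
    move=> FY FW Y0 YW x Bx; have [_ [_ h _ _]] := BYP _ FY Y0.
    have [z Yz] := h _ _ Bx Bx; have Wz := YW _ Yz.
    by have [_ [k _ _ _]] := BYP _ FW (okne _ _ Wz); case: (k _ _ Wz).
  exists (\bigcup_(Y in [set Y | F Y /\ Y <> set0]) BY Y).
    by move=> x [Y [FY Y0]]; exact: (BYP _ FY Y0).1.
  split.
  - move=> p z [Y FY Yp]; have Y0 := okne _ _ Yp.
    have [_ [h _ _ _]] := BYP _ FY Y0; have [? [? ?]] := h _ _ Yp.
    by split; [exists Y|split; exists Y].
  - move=> x y [Y [FY Y0] Yx] [Z [FZ Z0] Zy].
    have [W [FW YW ZW]] := F1 _ _ FY FZ.
    have W0 : W <> set0 by move=> W0; apply: Y0; apply/seteqP; split=> // q /YW; rewrite W0.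
    have [_ [_ h _ _]] := BYP _ FW W0.
    by have [//||z Wz] := h x y; [exact: BYB Yx|exact: BYB Zy|exists z; exists W].
  - move=> p z z' [Y FY Yp] [Z FZ Zp]; have [W [FW YW ZW]] := F1 _ _ FY FZ.
    have [_ [_ _ h _]] := BYP _ FW (okne _ _ (YW _ Yp)).
    exact: h (YW _ Yp) (ZW _ Zp).
  - move=> p q z [Y FY Yp] [Z FZ Zp]; have [W [FW YW ZW]] := F1 _ _ FY FZ.
    have [_ [_ _ _ h]] := BYP _ FW (okne _ _ (YW _ Yp)).
    exact: h (YW _ Yp) (ZW _ Zp).
have [n0 Nn0] : N !=set0 by exists (e 0%N); exists 0%N.
have G0ne : G0 <> set0 by case: ok0 => _ /(_ _ _ Nn0 Nn0)[z Gz] _ _ GG; rewrite GG in Gz.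
have {PG} [G0G [B BA okB]] : G0 `<=` G /\ exists2 B, B `<=` A & ok B G.
  case: PG => // G0'; exfalso; apply: (Gmax G0); last first.
    by right; split; [exact: subset_refl|exists N].
  rewrite G0'; split=> [p []|s0]; apply: G0ne.
  by apply/seteqP; split=> // p [].
have NB : N `<=` B.
  move=> x Nx; have [_ /(_ _ _ Nx Nx)[z /G0G Gz] _ _] := ok0.
  by have [k _ _ _] := okB; case: (k _ _ Gz).
have BB := okle okB.
have Bn0 := NB _ Nn0.
have b2 : [set: bool] #<= B.
  apply: card_le_trans (subset_card_le NB); rewrite (card_le_eqr N1).
  by apply: (@card_le_inj _ _ _ _ (fun b : bool => (b : nat))) => // -[] [].
have UB (C D : set T) : C #<= B -> D #<= B -> (C `|` D) #<= B.
  move=> CB DB; apply: card_le_trans (card_leU CB DB Bn0 Bn0) _.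
  by apply: card_le_trans (card_leX BB b2) _.
have UB2 (C D : set (T * T)) : C #<= B -> D #<= B -> (C `|` D) #<= B.
  move=> CB DB; apply: card_le_trans (card_leU CB DB Bn0 Bn0) _.
  by apply: card_le_trans (card_leX BB b2) _.
(* If the rest of [A] is no larger than [B], then [A] has the size of [B] and inherits its
   injection. Otherwise the rest contains a copy [C] of [B], and the pairs of the union of [B] and
   [C] that are not pairs of [B] can be coded in [C], against maximality. *)
have [AB|BAB] := card_le_total (A `\` B) B.
  have AB' : A #<= B.
    by rewrite -(setDUK BA); apply: UB.
  apply: card_le_trans (card_leX AB' AB') _.
  by apply: card_le_trans BB (subset_card_le BA).
have [f [fA finj]] := card_le_fun BAB (ex_intro _ _ Bn0).
pose C := f @` B.
have CB : C #<= B := card_image_le _ _.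
have BC : B #<= C.
  apply: (@card_le_inj _ _ _ _ f) => // x Bx; first by exists x.
have CA : C `<=` A `\` B by move=> _ [x Bx <-]; exact: fA.
have e1 : (B `|` C) `\` B = C.
  apply/seteqP; split=> [x [[]]//|x Cx]; split; first by right.
  by have [] := CA _ Cx.
have [G' okG' GG'] : exists2 G', ok (B `|` C) G' & G `<=` G'.
  apply: leok okB; first exact: subsetUl.
  rewrite e1; apply: card_le_trans BC.
  apply: (@card_le_trans _ _ _ ((B `|` C) `*` (B `|` C))); first by apply: subset_card_le => p [].
  by apply: card_le_trans BB; apply: card_leX; apply: UB.
exfalso; apply: (Gmax G'); last first.
  right; split; first exact: subset_trans GG'.
  by exists (B `|` C) => // x [/BA|/CA[]].
split=> // G'G; have Cfn : C (f n0) by exists n0.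
have [_ h _ _] := okG'.
have [z /G'G Gz] := h _ _ (or_intror Cfn : (B `|` C) _) (or_intror Cfn : (B `|` C) _).
by have [k _ _ _] := okB; have [+ _] := k _ _ Gz; have [_] := CA _ Cfn.
Qed.

End Square.

End Cardinals.

(** * Well-orders and small sets *)

Section WellOrders.
Context (I : Type) (le : rel I).
Hypothesis wo : wochoice.well_order le.

Lemma wo_least (A : set I) : A !=set0 -> exists2 z, A z & forall x, A x -> le z x.
Proof.
move=> [x Ax]; have [|z [[/set_mem Az zA] _]] := wo (A := mem A); first by exists x; exact/mem_set.
by exists z => // y Ay; apply: zA; exact/mem_set.
Qed.

Lemma wo_total x y : le x y \/ le y x.
Proof.
have [|z [->|->] zA] := @wo_least [set x; y]; first by exists x; left.
- by left; apply: zA; right.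
- by right; apply: zA; left.
Qed.

Lemma wo_refl x : le x x.
Proof. by have [] := wo_total x x. Qed.

Lemma wo_anti x y : le x y -> le y x -> x = y.
Proof.
move=> xy yx; have [|z [_ zu]] := wo (A := mem [set x; y]).
  by exists x; apply/mem_set; left.
have <- : z = x.
  apply: zu; split; first by apply/mem_set; left.
  by move=> t /set_mem [->|->] //; exact: wo_refl.
apply: zu; split; first by apply/mem_set; right.
by move=> t /set_mem [->|->] //; exact: wo_refl.
Qed.

Lemma wo_trans y x z : le x y -> le y z -> le x z.
Proof.
move=> xy yz; have [|t [[->|->]|->] tA] := @wo_least [set x; y; z]; first by exists x; do 2 left.
- by apply: tA; right.
- by rewrite (wo_anti xy) //; apply: tA; do 2 left.
- have zy : le z y by apply: tA; left; right.
  by rewrite -(wo_anti yz zy).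
Qed.

Lemma strict_le x y : strict le x y -> le x y. Proof. by case. Qed.

Lemma not_le x y : ~ le x y <-> strict le y x.
Proof.
split=> [nxy|[yx ne] xy]; last by apply: ne; exact: wo_anti.
have [//|yx] := wo_total x y; split=> // e; apply: nxy; rewrite e; exact: wo_refl.
Qed.

Lemma wo_cases x y : le x y \/ strict le y x.
Proof. by have [|/not_le] := pselect (le x y); [left|right]. Qed.

Lemma le_strict_trans y x z : le x y -> strict le y z -> strict le x z.
Proof.
move=> xy [yz ne]; split; first exact: wo_trans yz.
by move=> e; apply: ne; apply: wo_anti => //; rewrite -e.
Qed.

Lemma strict_le_trans y x z : strict le x y -> le y z -> strict le x z.
Proof.
move=> [xy ne] yz; split; first exact: wo_trans yz.
by move=> e; apply: ne; apply: wo_anti => //; rewrite e.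
Qed.

Lemma wo_wf : well_founded (strict le).
Proof.
move=> x; apply: contrapT => nx.
have [|z nz zA] := @wo_least [set y | ~ Acc (strict le) y]; first by exists x.
apply: nz; constructor => y yz; apply: contrapT => /zA zy.
exact: ((not_le z y).2 yz zy).
Qed.

Lemma wo_ind (P : I -> Prop) : (forall x, (forall y, strict le y x -> P y) -> P x) -> forall x, P x.
Proof. exact: (well_founded_ind wo_wf). Qed.

(** The step function receives a total function, cut off to [x0] outside the segment below [i]; this
    avoids dependent types in every later recursion. *)
Lemma wo_rec (X : Type) (x0 : X) (F : I -> (I -> X) -> X) : exists s : I -> X,
  forall i, s i = F i (fun j => if pselect (strict le j i) then s j else x0).
Proof.
pose G i (rec : forall j, strict le j i -> X) :=
  F i (fun j => if pselect (strict le j i) is left h then rec j h else x0).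
have GE i f g : (forall j h, f j h = g j h) -> @G i f = G i g.
  by move=> fg; congr (F i _); apply/funext => j; case: pselect.
exists (Fix wo_wf (fun _ => X) G) => i; rewrite Fix_eq //.
by congr (F i _); apply/funext => j; case: pselect.
Qed.

Lemma wo_rec_bigcup (Z : Type) (F : I -> set Z -> set Z) : exists s : I -> set Z,
  forall i, s i = F i (\bigcup_(j in [set j | strict le j i]) s j).
Proof.
have [s sE] := wo_rec set0 (fun i (t : I -> set Z) => F i (\bigcup_(j in [set j | strict le j i]) t j)).
exists s => i; rewrite sE; congr (F i _); apply: eq_bigcupr => j /= ji.
by case: pselect.
Qed.

End WellOrders.

Lemma wo_exists (T : Type) : exists le : rel T, wochoice.well_order le.
Proof.
elim/Peq : T => T; have [le wo] := wochoice.well_ordering_principle T; by exists le.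
Qed.

(** * Classes of small sets *)

Section SmallClasses.

(* [sm A] reads "[A] is small". The two instances are [A #< tau] and, because uniqueness for
   singular [tau] needs a class closed under small unions, [A #<= tau]. *)
Definition card_class := forall T : Type, set T -> Prop.

Record small_class (sm : card_class) : Prop := SmallClass {
  small_le : forall T U (A : set T) (B : set U), A #<= B -> sm U B -> sm T A;
  small_nat : sm nat [set: nat];
  small_X : forall T U (A : set T) (B : set U), sm T A -> sm U B -> sm (T * U)%type (A `*` B) }.

Definition regular_class (sm : card_class) : Prop :=
  forall (J T : Type) (D : set J) (A : J -> set T), sm J D ->
    (forall j, D j -> sm T (A j)) -> sm T (\bigcup_(j in D) A j).

Section Closure.
Variable sm : card_class.
Hypothesis smP : small_class sm.
Arguments sm {T}.

Lemma small_sub T (A B : set T) : A `<=` B -> sm B -> sm A.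
Proof. by move=> /subset_card_le; exact: small_le. Qed.

Lemma small_image T U (f : T -> U) (A : set T) : sm A -> sm (f @` A).
Proof. by apply: (small_le smP); exact: card_image_le. Qed.

Lemma small_countable T (A : set T) : countable A -> sm A.
Proof. by move=> /(small_le smP); apply; exact: small_nat. Qed.

Lemma small0 T : sm (@set0 T).
Proof. exact: small_countable. Qed.

Lemma small1 T (x : T) : sm [set x].
Proof. exact: small_countable. Qed.

Lemma smallU T (A B : set T) : sm A -> sm B -> sm (A `|` B).
Proof.
move=> sA sB; have [->|/set0P[a Aa]] := eqVneq A set0; first by rewrite set0U.
have [->|/set0P[b Bb]] := eqVneq B set0; first by rewrite setU0.
apply: (small_le smP (card_leU (card_lexx _) (card_lexx _) Aa Bb)).
by apply: (small_X smP); [exact: (small_X smP)|exact: small_countable].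
Qed.

Fixpoint all_in T (A : set T) (s : seq T) : Prop :=
  if s is x :: s' then A x /\ all_in A s' else True.

(** [A] may be finite, so the natural numbers are thrown in to obtain a pairing function. Folding it
    along a sequence is injective only among sequences of equal length, hence the length is coded
    separately. *)
Lemma small_seq T (A : set T) : sm A -> sm [set s | all_in A s].
Proof.
move=> sA; pose B : set (nat + T) := range inl `|` inr @` A.
have sB : sm B.
  by apply: smallU; [apply: small_image; exact: small_nat|exact: small_image].
have Binf : infinite_set B.
  apply/infiniteP; apply: (@card_le_inj _ _ _ _ inl) => [n _|? ? _ _ []//].
  by left; exists n.
have B0 : (B `*` B) !=set0 by exists (inl 0%N, inl 0%N); split; left; exists 0%N.
have [g [gB ginj]] := card_le_fun (card_le_square Binf) B0.
pose code := foldr (fun (x : T) c => g (inr x, c)) (inl 0%N).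
have codeB s : all_in A s -> B (code s).
  elim: s => [_|x s IH /= [Ax /IH Bs]]; first by left; exists 0%N.
  by apply: gB; split=> //; right; exists x.
have codeI s t : size s = size t -> all_in A s -> all_in A t -> code s = code t -> s = t.
  elim: s t => [[]//|x s IH [//|y t] /= [st] [Ax As] [Ay At] e].
  have Bx : (B `*` B) (inr x, code s) by split; [right; exists x|exact: codeB].
  have By : (B `*` B) (inr y, code t) by split; [right; exists y|exact: codeB].
  have [xy st'] := ginj _ _ Bx By e.
  by rewrite xy (IH t).
apply: (small_le smP _ sB).
apply: (@card_le_inj _ _ _ _ (fun s => g (inl (size s), code s))) => [s As|s t As At e].
  by apply: gB; split=> /=; [left; exists (size s)|exact: codeB].
have Bs : (B `*` B) (inl (size s), code s) by split; [left; exists (size s)|exact: codeB].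
have Bt : (B `*` B) (inl (size t), code t) by split; [left; exists (size t)|exact: codeB].
have [st' e'] := ginj _ _ Bs Bt e.
exact: codeI.
Qed.

End Closure.

Lemma lt_class_small (K : Type) : ~ countable [set: K] ->
  small_class (fun T A => A #< [set: K]).
Proof.
move=> nK; have natK : [set: nat] #< [set: K] by apply/card_ltNle.
split=> // [T U A B|T U A B AK BK]; first exact: card_le_lt_trans.
have finle V (C : set V) : finite_set C -> C #< [set: K].
  by move=> /finite_set_countable h; apply: card_le_lt_trans natK.
wlog AB : T U A B AK BK / A #<= B => [hw|].
  have [|BA] := card_le_total A B; first exact: hw.
  apply: card_le_lt_trans (hw _ _ B A BK AK BA).
  by apply: (@card_le_inj _ _ _ _ (fun p => (p.2, p.1))) => [p []//|[? ?] [? ?] _ _ [-> ->]].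
have [Bfin|Binf] := pselect (finite_set B).
  by apply: finle; apply: finite_setX => //; exact: card_le_finite Bfin.
apply: card_le_lt_trans BK; apply: card_le_trans (card_le_square Binf).
exact: card_leX.
Qed.

Lemma le_class_small (K : Type) : infinite_set [set: K] ->
  small_class (fun T A => A #<= [set: K]).
Proof.
move=> Kinf; split=> [T U A B|//|T U A B AK BK]; [exact: card_le_trans|exact/infiniteP|].
by apply: card_le_trans (card_leX AK BK) (card_le_square Kinf).
Qed.

Lemma le_class_regular (K : Type) : infinite_set [set: K] ->
  regular_class (fun T A => A #<= [set: K]).
Proof.
move=> Kinf J T D A DK AK.
have [->|/set0P[t [j0 Dj0 At]]] := eqVneq (\bigcup_(j in D) A j) set0; first exact: card_ge0.
have fP j : exists f : K -> T, D j -> A j `<=` range f.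
  have [Dj|] := pselect (D j); last by exists (fun=> t).
  have [->|/set0P A0] := eqVneq (A j) set0; first by exists (fun=> t) => _ ? [].
  by have [f [Af _]] := card_le_onto (AK j Dj) A0; exists f.
have /choice[f {}fP] := fP.
have [g [Dg _]] := card_le_onto DK (ex_intro _ _ Dj0).
apply: card_le_trans (card_le_square Kinf).
apply: (@card_le_surj _ _ _ _ (fun p => f (g p.1) p.2)) => x [j Dj Ajx].
have [a _ aj] := Dg _ Dj; have [b _ bx] := fP j Dj _ Ajx.
by exists (a, b) => //=; rewrite aj.
Qed.

(** If the union were as large as [K], it would map onto [K]. The image of each [A j] is bounded by
    some [b j], and the small set of these bounds is bounded by some [z]; but [z] lies in the image
    of some [A j]. *)
Lemma lt_class_regular (K : Type) : regular_card K ->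
  regular_class (fun T A => A #< [set: K]).
Proof.
move=> [Kinf [le [wo _] Kcof]] J T D A DK AK; apply/card_ltNle => KA.
have [k0 _] : [set: K] !=set0 by apply: infinite_setN0.
have [f [Kf _]] := card_le_onto KA (ex_intro _ k0 I).
have bd (C : set K) : C #< [set: K] -> exists b, forall y, C y -> ~ le b y.
  move=> /card_ltNle nC; apply: contrapT => nb; apply: nC; apply: Kcof => x.
  apply: contrapT => nx; apply: nb; exists x => y Cy xy; apply: nx; by exists y.
have /choice[b bP] : forall j, exists b, D j -> forall y, (f @` A j) y -> ~ le b y.
  move=> j; have [Dj|] := pselect (D j); last by exists k0.
  have [b bP] := bd (f @` A j) (card_le_lt_trans (card_image_le _ _) (AK j Dj)).
  by exists b.
have [z zP] := bd (b @` D) (card_le_lt_trans (card_image_le _ _) DK).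
have [t [j Dj Ajt] tz] := Kf z I.
have [zb|bz] := wo_total wo z (b j).
  by apply: zP zb; exists j.
by apply: (bP j Dj z) bz; exists t.
Qed.

(** Well-order the indices of a family with a non-small union and take partial unions [N]. Cutting
    the index set at the first [k] where [N k] is no longer small keeps all parts small; the union
    below the cut is still large, since adding the single small set [A k] to it covers [N k]. *)
Lemma not_regular_decomposition (K : Type) : ~ countable [set: K] ->
  ~ regular_class (fun T A => A #< [set: K]) ->
  exists (J : Type) (le : rel J) (D : set J) (N : J -> set K),
    [/\ wochoice.well_order le, D #< [set: K],
        forall i j, D j -> le i j -> D i -> N i `<=` N j,
        forall j, D j -> N j #< [set: K] & [set: K] #<= \bigcup_(j in D) N j].
Proof.
move=> nK; have sc := lt_class_small nK.
move=> /existsNP[J] /existsNP[T] /existsNP[D] /existsNP[A].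
move=> /not_implyP[DK] /not_implyP[AK] /card_ltNle/contrapT KA.
have [k0 _] : [set: K] !=set0.
  by apply/set0P/eqP => K0; apply: nK; rewrite K0.
have [f [Kf _]] := card_le_onto KA (ex_intro _ k0 I).
have [le wo] := wo_exists J.
pose N k := f @` \bigcup_(i in [set i | D i /\ le i k]) A i.
pose W := [set k | D k /\ ~ (N k #< [set: K])].
pose E := [set i | D i /\ forall k, W k -> strict le i k].
have Nm i j : le i j -> N i `<=` N j.
  move=> ij _ [t [l [Dl li] At] <-]; exists t => //; exists l => //; split=> //.
  exact: (wo_trans wo) ij.
exists J, le, E, N; split=> //.
- by apply: card_le_lt_trans DK; apply: subset_card_le => i [].
- by move=> i j _ ij _; exact: Nm.
- move=> j [Dj jW]; apply: contrapT => nN.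
  by have [_] : strict le j j by apply: jW; split.
have [[k0' Wk0]|W0] := pselect (W !=set0); last first.
  apply: subset_card_le => k _; have [t [j Dj At] <-] := Kf k I.
  exists j; first by split=> // l Wl; exfalso; apply: W0; exists l.
  exists t => //; exists j => //; split=> //; exact: (wo_refl wo).
have [k [Dk nNk] kW] := wo_least wo (ex_intro _ _ Wk0).
apply: contrapT => /card_ltNle sE; apply: nNk.
apply: (small_sub sc (B := (\bigcup_(j in E) N j) `|` f @` A k)).
  move=> _ [t [l [Dl lk] At] <-].
  have [e|ne] := pselect (l = k); first by right; exists t => //; rewrite -e.
  left; exists l; last by exists t => //; exists l => //; split=> //; exact: (wo_refl wo).
  split=> // m Wm; apply: (strict_le_trans wo) (kW _ Wm); by split.
apply: (smallU sc) => //; apply: (small_image sc); exact: AK.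
Qed.

End SmallClasses.

(** * Spans, density and completeness *)

Section Span.
Context {R : realType} {L : lmodType R}.
Implicit Types (A B : set L).

Inductive lspan (A : set L) : L -> Prop :=
| lspan0 : lspan A 0
| lspanS a x y : A x -> lspan A y -> lspan A (a *: x + y).

Lemma lspan_sub A : A `<=` lspan A.
Proof. by move=> x Ax; rewrite -[x]addr0 -[x in x + 0]scale1r; apply: lspanS => //; exact: lspan0. Qed.

Lemma lspanD A x y : lspan A x -> lspan A y -> lspan A (x + y).
Proof.
by elim=> [|a u v Au _ IH] ly; rewrite ?add0r // -addrA; apply: lspanS => //; exact: IH.
Qed.

Lemma lspanZ A a x : lspan A x -> lspan A (a *: x).
Proof.
elim=> [|b u v Au _ IH]; first by rewrite scaler0; exact: lspan0.
by rewrite scalerDr scalerA; exact: lspanS.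
Qed.

Lemma lspanN A x : lspan A x -> lspan A (- x).
Proof. by rewrite -scaleN1r; exact: lspanZ. Qed.

Lemma lspanB A x y : lspan A x -> lspan A y -> lspan A (x - y).
Proof. by move=> Ax /lspanN; exact: lspanD. Qed.

Lemma lspan_min A (S : L -> Prop) : S 0 -> (forall a x y, S x -> S y -> S (a *: x + y)) ->
  A `<=` S -> lspan A `<=` S.
Proof. by move=> S0 SS AS x; elim=> // a u v /AS Su _ Sv; exact: SS. Qed.

Lemma lspan_mono A B : A `<=` lspan B -> lspan A `<=` lspan B.
Proof.
apply: lspan_min; first exact: lspan0.
by move=> a x y Bx By; apply: lspanD => //; exact: lspanZ.
Qed.

Lemma lspanS_sub A B : A `<=` B -> lspan A `<=` lspan B.
Proof. by move=> AB; apply: lspan_mono => x /AB; exact: lspan_sub. Qed.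

Lemma lspan_setU1 A s x : lspan (A `|` [set s]) x ->
  exists t y, lspan A y /\ x = t *: s + y.
Proof.
elim=> [|a u v [Au|->] _ [t [y [Ay ->]]]].
- by exists 0, 0; split; [exact: lspan0|rewrite scale0r addr0].
- by exists t, (a *: u + y); split; [exact: lspanS|rewrite addrCA].
- by exists (a + t), y; rewrite addrA scalerDl.
Qed.

Lemma lspan_setU A B x : lspan (A `|` B) x ->
  exists y z, [/\ lspan A y, lspan B z & x = y + z].
Proof.
elim=> [|a u v [Au|Bu] _ [y [z [Ay Bz ->]]]].
- by exists 0, 0; rewrite addr0; split=> //; exact: lspan0.
- by exists (a *: u + y), z; rewrite addrA; split=> //; exact: lspanS.
- by exists y, (a *: u + z); rewrite addrCA; split=> //; exact: lspanS.
Qed.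

Lemma lspan_bigcup (J : Type) (D : set J) (F : J -> set L) (j0 : J) x :
  (forall i j, D i -> D j -> exists k, [/\ D k, F i `<=` F k & F j `<=` F k]) ->
  D j0 -> lspan (\bigcup_(j in D) F j) x -> exists2 j, D j & lspan (F j) x.
Proof.
move=> dir Dj0; elim=> [|a u v [i Di Fu] _ [j Dj Fv]]; first by exists j0 => //; exact: lspan0.
have [k [Dk ik jk]] := dir i j Di Dj; exists k => //.
by apply: lspanS; [exact: ik|exact: lspanS_sub Fv].
Qed.

End Span.

Section Density.
Context {R : realType} {V : normedModType R}.
Implicit Types (A B S D : set V).

Lemma closureNP A x : closure A x <-> forall e : R, 0 < e -> exists2 y, A y & `|x - y| < e.
Proof.
split=> [cA e e0|h B /nbhs_ballP[e /= e0 eB]].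
  have [y [Ay yB]] := cA (ball x e) (nbhsx_ballx _ _ e0).
  by exists y => //; rewrite -ball_normE in yB.
by have [y Ay xy] := h e e0; exists y; split=> //; apply: eB; rewrite -ball_normE.
Qed.

Definition cspan A : set V := closure (lspan A).

Lemma lspan_cspan A : lspan A `<=` cspan A.
Proof. exact: subset_closure. Qed.

Lemma cspan_sub A : A `<=` cspan A.
Proof. by move=> x /lspan_sub; exact: lspan_cspan. Qed.

Lemma cspan_closed A : closed (cspan A).
Proof. exact: closed_closure. Qed.

Definition subsp (S : set V) := S 0 /\ forall a x y, S x -> S y -> S (a *: x + y).

Lemma subspD S x y : subsp S -> S x -> S y -> S (x + y).
Proof. by move=> [_ h] Sx Sy; rewrite -[x]scale1r; exact: h. Qed.

Lemma subspZ S a x : subsp S -> S x -> S (a *: x).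
Proof. by move=> [S0 h] Sx; rewrite -[_ *: _]addr0; exact: h. Qed.

Lemma subspN S x : subsp S -> S x -> S (- x).
Proof. by move=> hS Sx; rewrite -scaleN1r; exact: subspZ. Qed.

Lemma subspB S x y : subsp S -> S x -> S y -> S (x - y).
Proof. by move=> hS Sx Sy; apply: subspD => //; exact: subspN. Qed.

Lemma lspan_subsp A : subsp (lspan A).
Proof.
split; first exact: lspan0.
by move=> a x y Ax Ay; apply: lspanD => //; exact: lspanZ.
Qed.

Lemma subsp_closure S : subsp S -> subsp (closure S).
Proof.
move=> hS; split; first by apply: subset_closure; exact: hS.1.
move=> a x y /closureNP cx /closureNP cy; apply/closureNP => e e0.
have e2 : 0 < e / 2 by lra.
pose d := e / 2 / (`|a| + 1).
have a1 : 0 < `|a| + 1 by have := normr_ge0 a; lra.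
have d0 : 0 < d by apply: divr_gt0.
have [x' Sx' xx'] := cx _ d0; have [y' Sy' yy'] := cy _ e2.
exists (a *: x' + y'); first exact: hS.2.
have -> : a *: x + y - (a *: x' + y') = a *: (x - x') + (y - y').
  by rewrite scalerBr opprD addrACA.
apply: le_lt_trans (ler_normD _ _) _; rewrite normrZ.
have dE : (`|a| + 1) * d = e / 2 by rewrite mulrC divfK // gt_eqF.
have : `|a| * `|x - x'| <= `|a| * d by apply: ler_wpM2l => //; exact: ltW.
by move: dE yy'; rewrite mulrDl mul1r; lra.
Qed.

Lemma cspan_subsp A : subsp (cspan A).
Proof. exact/subsp_closure/lspan_subsp. Qed.

Lemma is_subspaceP S : (closed S /\ subsp S) <-> GRing.submod_closed (mem S) /\ closed S.
Proof.
split=> [[cS [S0 SS]]|[[S0 SS] cS]]; split=> //; split.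
- exact/mem_set.
- by move=> a x y /set_mem Sx /set_mem Sy; apply/mem_set; exact: SS.
- exact/set_mem.
- by move=> a x y /mem_set Sx /mem_set Sy; apply/set_mem; exact: SS.
Qed.

Lemma lspan_le S A : subsp S -> A `<=` S -> lspan A `<=` S.
Proof. by move=> [S0 SS] AS; exact: lspan_min. Qed.

Lemma cspan_le S A : closed S -> subsp S -> A `<=` S -> cspan A `<=` S.
Proof.
move=> cS hS AS; rewrite ((closure_id S).1 cS); apply: closure_subset; exact: lspan_le.
Qed.

Lemma cspan_mono A B : A `<=` cspan B -> cspan A `<=` cspan B.
Proof. by apply: cspan_le; [exact: cspan_closed|exact: cspan_subsp]. Qed.

Lemma cspanS A B : A `<=` B -> cspan A `<=` cspan B.
Proof. by move=> AB; apply: cspan_mono => x /AB; exact: cspan_sub. Qed.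

Lemma cspan_approx A x (e : R) : 0 < e -> cspan A x -> exists2 y, lspan A y & `|x - y| < e.
Proof. by move=> e0 /closureNP; exact. Qed.

(** Rational combinations are dense in the span, and there are few enough of them to stay in any
    small class containing [A]. *)
Definition qspan A : set V :=
  [set \sum_(p <- s) (ratr p.1 : R) *: p.2 | s in [set s : seq (rat * V) | all_in [set p | A p.2] s]].

Lemma qspan_lspan A : qspan A `<=` lspan A.
Proof.
move=> _ [s As <-]; elim: s As => [_|[q a] s IH /= [Aa As]].
  by rewrite big_nil; exact: lspan0.
by rewrite big_cons; apply: lspanS => //; exact: IH.
Qed.

Lemma lspan_qspan A x (e : R) : 0 < e -> lspan A x -> exists2 y, qspan A y & `|x - y| < e.
Proof.
move=> + lx; elim: lx e => [|a u v Au _ IH] e e0.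
  exists 0; last by rewrite subrr normr0.
  by exists [::] => //; rewrite big_nil.
have e2 : 0 < e / 2 by lra.
have [_ [s As <-] vs] := IH _ e2.
pose d := e / 2 / (`|u| + 1).
have u1 : 0 < `|u| + 1 by have := normr_ge0 u; lra.
have d0 : 0 < d by apply: divr_gt0.
have [q /andP[q1 q2]] : exists q : rat, a - d < ratr q < a + d.
  have [|q] := @rat_in_itvoo R (a - d) (a + d); first by lra.
  by rewrite in_itv /= => qq; exists q.
exists (\sum_(p <- (q, u) :: s) ratr p.1 *: p.2); first by exists ((q, u) :: s).
rewrite big_cons /= opprD addrACA -scalerBl.
apply: le_lt_trans (ler_normD _ _) _; rewrite normrZ.
have dE : d * (`|u| + 1) = e / 2 by rewrite divfK // gt_eqF.
have aq : `|a - ratr q| <= d by rewrite ler_norml; lra.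
have : `|a - ratr q| * `|u| <= d * `|u| by apply: ler_wpM2r.
by move: dE vs; rewrite mulrDr mulr1; lra.
Qed.

Lemma small_qspan sm A : small_class sm -> sm _ A -> sm _ (qspan A).
Proof.
move=> smP sA; apply: (small_image smP); apply: (small_seq smP).
apply: (small_sub smP (B := [set: rat] `*` A)); first by move=> [q a].
by apply: (small_X smP) => //; apply: (small_countable smP); exact: countableP.
Qed.

Lemma cspan_qspan A : closure (qspan A) = cspan A.
Proof.
apply/seteqP; split; first by apply: closure_subset; exact: qspan_lspan.
rewrite ((closure_id (closure (qspan A))).1 (@closed_closure _ _)).
apply: closure_subset => x lx; apply/closureNP => e e0.
exact: lspan_qspan.
Qed.

(** Density passes to subsets of a metric space: for each point of [D] and each radius 1/(n+1), keep
    one point of [S] in that ball, if there is one. *)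
Lemma small_dense_sub sm (S D : set V) : small_class sm -> sm _ D ->
  S `<=` closure D -> exists E, [/\ sm _ E, E `<=` S & S `<=` closure E].
Proof.
move=> smP sD SD; have [->|/set0P[s0 Ss0]] := eqVneq S set0.
  by exists set0; split=> //; exact: small0.
have /choice[f fP] : forall p : V * nat, exists s, S s /\
    ((exists2 s', S s' & `|s' - p.1| < p.2.+1%:R^-1) -> `|s - p.1| < p.2.+1%:R^-1 :> R).
  move=> p; have [[s Ss sp]|ns] := pselect (exists2 s', S s' & `|s' - p.1| < p.2.+1%:R^-1).
    by exists s.
  by exists s0.
exists (f @` (D `*` [set: nat])); split.
- by apply: (small_image smP); apply: (small_X smP) => //; exact: small_nat smP.
- by move=> _ [p _ <-]; exact: (fP p).1.
- move=> s Ss; apply/closureNP => e e0; pose n := Num.truncn (2 / e).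
  have ne : n.+1%:R^-1 < e / 2 :> R.
    have e2 : 0 < e / 2 by lra.
    by rewrite invf_plt ?posrE ?ltr0n // invf_div truncnS_gt.
  have n0 : 0 < n.+1%:R^-1 :> R by rewrite invr_gt0 ltr0n.
  have [d Dd sd] := (closureNP _ _).1 (SD _ Ss) _ n0.
  exists (f (d, n)); first by exists (d, n).
  have := (fP (d, n)).2 (ex_intro2 _ _ s Ss sd) => /= fd.
  apply: le_lt_trans (ler_distD d _ _) _; rewrite (distrC d).
  by move: ne sd fd; move: (n.+1%:R^-1) => w; lra.
Qed.

(** The least cardinality demanded by [has_dens] is supplied by [card_min], applied to the family of
    all dense subsets. *)
Lemma dens_ltP S (K : Type) : dens_lt S K <-> exists D, [/\ D `<=` S, S `<=` closure D & D #< [set: K]].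
Proof.
split=> [[M [[D [DS SD] DM] _] MK]|[D [DS SD DK]]].
  exists D; split=> //; apply: card_le_lt_trans MK.
  by rewrite -(card_le_eqr DM).
pose J := {D : set V | dense_in S D}.
have [[E [ES SE]] Emin] := card_min (fun j : J => sval j) (exist _ D (conj DS SD)).
exists E; last first.
  rewrite /card_lt !(card_le_eql (card_setT _)) (card_le_eqr (card_setT _)).
  exact: card_le_lt_trans (Emin (exist _ D (conj DS SD))) DK.
split; first by exists E => //; exact: card_setT_sym.
move=> F dF; rewrite (card_le_eql (card_setT _)); exact: Emin (exist _ F dF).
Qed.

End Density.

Section Complete.
Context {R : realType}.

Lemma half_pow_small (e : R) : 0 < e -> exists n : nat, 2^-1 ^+ n < e.
Proof.
move=> e0; exists (Num.truncn e^-1).+1.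
rewrite exprVn -[e]invrK ltf_pV2 ?posrE ?invr_gt0 ?exprn_gt0 //.
apply: lt_le_trans (truncnS_gt _) _.
by rewrite -natrX ler_nat invrK; apply/ltnW; exact: ltn_expl.
Qed.

Lemma fast_cauchy_lim (V : completeNormedModType R) (u : nat -> V) (r : nat -> R) :
  (forall n m, (n <= m)%N -> `|u n - u m| <= r n) ->
  (forall e, 0 < e -> exists n, r n < e) ->
  exists l, forall n, `|u n - l| <= r n.
Proof.
move=> ur r0.
have uc : cvg (u @ \oo).
  apply: cauchy_cvg; apply: cauchy_exP => e e0.
  have [n rn] := r0 e e0; exists (u n).
  suff : \forall m \near \oo, ball (u n) e (u m) by [].
  near=> m; rewrite -ball_normE /=; apply: le_lt_trans (_ : _ <= r n) rn; apply: ur.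
  by near: m; exact: nbhs_infty_ge.
exists (lim (u @ \oo)) => n; apply/ler_addgt0Pr => e e0.
have /cvgrPdist_lt/(_ e e0) ule : u @ \oo --> lim (u @ \oo) by [].
near \oo => m.
apply: le_trans (ler_distD (u m) _ _) _; apply: lerD.
  by apply: ur; near: m; exact: nbhs_infty_ge.
by rewrite distrC ltW //; near: m.
Unshelve. all: by end_near. Qed.

End Complete.

(* The norm [N] need only be a complete norm on [S]; its values elsewhere are irrelevant. *)
Record complete_norm (R : realType) (L : lmodType R) (S : set L) (N : L -> R) : Prop :=
  CompleteNorm {
  cn_sub : GRing.submod_closed (mem S);
  cn_add : forall x y, S x -> S y -> N (x + y) <= N x + N y;
  cn_scale : forall a x, S x -> N (a *: x) = `|a| * N x;
  cn_eq0 : forall x, S x -> N x = 0 -> x = 0;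
  cn_cvg : forall u : nat -> L, (forall n, S (u n)) ->
    (forall n m, (n <= m)%N -> N (u n - u m) <= 2^-1 ^+ n) ->
    exists2 l, S l & forall e, 0 < e -> exists n0, forall n, (n0 <= n)%N -> N (u n - l) < e }.

(** The proof of completeness is a parameter of the type, so that the instances below can refer to
    the norm [N] and to its properties. *)
Definition banach_sub (R : realType) (L : lmodType R) (S : set L) (N : L -> R)
  (_ : complete_norm S N) := {x : L | x \in S}.

Section BanachSub.
Context {R : realType} {L : lmodType R} {S : set L} {N : L -> R}.
Variable P : complete_norm S N.
Local Notation B := (banach_sub P).

Definition bval (x : B) : L := sval x.

HB.instance Definition _ := [isSub of B for bval].
HB.instance Definition _ := [Choice of B by <:].
HB.instance Definition _ := GRing.SubChoice_isSubLmodule.Build R L (mem S) B (cn_sub P).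

Definition bnorm (x : B) : R := N (\val x).

Lemma bvalP (x : B) : S (\val x).
Proof. exact: set_mem (svalP x). Qed.

Fact bnormD x y : bnorm (x + y) <= bnorm x + bnorm y.
Proof. by rewrite /bnorm raddfD; apply: (cn_add P); exact: bvalP. Qed.

Fact bnormZ a x : bnorm (a *: x) = `|a| * bnorm x.
Proof. by rewrite /bnorm linearZ; apply: (cn_scale P); exact: bvalP. Qed.

Fact bnorm_eq0 x : bnorm x = 0 -> x = 0.
Proof. by move=> /(cn_eq0 P (bvalP x)) x0; apply: val_inj; rewrite x0 raddf0. Qed.

HB.instance Definition _ := Lmodule_isNormed.Build R B bnormD bnormZ bnorm_eq0.

Lemma bnormE (x : B) : `|x| = N (\val x). Proof. by []. Qed.

Fact bcomplete (F : set_system B) : ProperFilter F -> cauchy F -> cvg F.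
Proof.
move=> FF /cauchyP Fc.
have p0 n : 0 < (2^-1 ^+ n) / 2 :> R by rewrite divr_gt0 // exprn_gt0 // invr_gt0.
have /choice[x xF] : forall n : nat, exists x, F (ball x (2^-1 ^+ n / 2 : R)) by move=> n; exact: Fc.
have xx n m : `|x n - x m| < (2^-1 ^+ n / 2 + 2^-1 ^+ m / 2 : R).
  have [y [yn ym]] := filter_ex (filterI (xF n) (xF m)).
  move: yn ym; rewrite -!ball_normE /= => yn ym.
  apply: le_lt_trans (ler_distD y _ _) _; rewrite (distrC y); lra.
have [n m nm|l Sl lP] := cn_cvg P (u := fun n => \val (x n)) (fun n => bvalP _).
  rewrite -raddfB -bnormE; apply: ltW; apply: lt_le_trans (xx n m) _.
  have : 2^-1 ^+ m <= 2^-1 ^+ n :> R by apply: ler_wiXn2l => //; lra.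
  lra.
pose l' : B := exist _ l (mem_set Sl).
apply/cvg_ex; exists l'; apply/cvgrPdist_lt => e e0.
have e2 : 0 < e / 2 by lra.
have [n0 n0P] := lP _ e2; have [n1 n1P] := half_pow_small e2.
pose n := maxn n0 n1.
have nl : `|x n - l'| < e / 2 by rewrite bnormE raddfB; apply: n0P; exact: leq_maxl.
have pn : 2^-1 ^+ n < e / 2.
  by apply: le_lt_trans n1P; apply: ler_wiXn2l; [lra|lra|exact: leq_maxr].
apply: filterS (xF n) => y; rewrite -ball_normE /= => yn.
apply: le_lt_trans (ler_distD (x n) _ _) _; rewrite (distrC l').
have := p0 n; lra.
Qed.

HB.instance Definition _ := Uniform_isComplete.Build B bcomplete.

Definition banach_of : completeNormedModType R := B.

End BanachSub.

(** * Realizations and extension of isometries *)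

Section Linear.
Context {R : realType} {V U : completeNormedModType R}.

Lemma linear_pack (f : V -> U) : (forall a x y, f (a *: x + y) = a *: f x + f y) ->
  exists g : {linear V -> U}, g = f :> (V -> U).
Proof.
move=> fl; pose m := GRing.isLinear.Build R V U *:%R f fl.
pose g : {linear V -> U} := HB.pack f m.
by exists g.
Qed.

End Linear.

(** * Partial isometries given by graphs *)

Section Graphs.
Context {R : realType} {V U : completeNormedModType R}.
Implicit Types (G P : set (V * U)).

(** [G] generates the graph of a partial linear isometry. Single-valuedness and injectivity need no
    separate clause: a pair in the span with one coordinate zero has both zero. *)
Definition isom G := forall p, lspan G p -> `|p.1| = `|p.2|.

Definition gcl G : set (V * U) := [set p | forall e : R, 0 < e ->
  exists2 q, lspan G q & `|p.1 - q.1| < e /\ `|p.2 - q.2| < e].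

Lemma sub_gcl G : lspan G `<=` gcl G.
Proof. by move=> p Gp e e0; exists p => //; rewrite !subrr !normr0. Qed.

Lemma isom_gcl G p : isom G -> gcl G p -> `|p.1| = `|p.2|.
Proof.
move=> iG Gp; apply/eqP; rewrite -subr_eq0 -normr_le0; apply/ler_addgt0Pr => e e0.
have e2 : 0 < e / 2 by lra.
have [q Gq [pq1 pq2]] := Gp _ e2; rewrite add0r.
have := lerB_dist p.1 q.1; have := lerB_dist q.1 p.1; rewrite (distrC q.1).
have := lerB_dist p.2 q.2; have := lerB_dist q.2 p.2; rewrite (distrC q.2).
by rewrite (iG _ Gq) ler_norml; lra.
Qed.

Lemma gclZD G a p q : gcl G p -> gcl G q -> gcl G (a *: p + q).
Proof.
move=> Gp Gq e e0; have e2 : 0 < e / 2 by lra.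
pose d := e / 2 / (`|a| + 1).
have a1 : 0 < `|a| + 1 by have := normr_ge0 a; lra.
have d0 : 0 < d by apply: divr_gt0.
have dE : (`|a| + 1) * d = e / 2 by rewrite mulrC divfK // gt_eqF.
have [p' Gp' [p1 p2]] := Gp _ d0; have [q' Gq' [q1 q2]] := Gq _ e2.
exists (a *: p' + q'); first by apply: lspanD => //; exact: lspanZ.
have h (W : completeNormedModType R) (x x' y y' : W) : `|x - x'| < d -> `|y - y'| < e / 2 ->
    `|(a *: x + y) - (a *: x' + y')| < e.
  move=> xx yy; have -> : a *: x + y - (a *: x' + y') = a *: (x - x') + (y - y').
    by rewrite scalerBr opprD addrACA.
  apply: le_lt_trans (ler_normD _ _) _; rewrite normrZ.
  have : `|a| * `|x - x'| <= `|a| * d by apply: ler_wpM2l => //; exact: ltW.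
  by move: dE yy; rewrite mulrDl mul1r; lra.
by split; exact: h.
Qed.

Lemma lspan_fst G : lspan (fst @` G) = fst @` lspan G.
Proof.
apply/seteqP; split=> x.
  elim=> [|a u v [p Gp <-] _ [q Gq <-]]; first by exists 0 => //; exact: lspan0.
  by exists (a *: p + q) => //; exact: lspanS.
move=> [p Gp <-]; elim: Gp => [|a u v Gu _ IH]; first exact: lspan0.
by apply: lspanS => //; exists u.
Qed.

Lemma lspan_snd G : lspan (snd @` G) = snd @` lspan G.
Proof.
apply/seteqP; split=> x.
  elim=> [|a u v [p Gp <-] _ [q Gq <-]]; first by exists 0 => //; exact: lspan0.
  by exists (a *: p + q) => //; exact: lspanS.
move=> [p Gp <-]; elim: Gp => [|a u v Gu _ IH]; first exact: lspan0.
by apply: lspanS => //; exists u.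
Qed.

Lemma gcl_total G x : isom G -> cspan (fst @` G) x -> exists y, gcl G (x, y).
Proof.
move=> iG; rewrite /cspan lspan_fst => /closureNP xG.
have p0 n : 0 < (2^-1 ^+ n) / 2 :> R by rewrite divr_gt0 // exprn_gt0 // invr_gt0.
have /choice[q qP] : forall n : nat, exists q, lspan G q /\ `|x - q.1| < (2^-1 ^+ n) / 2.
  by move=> n; have [_ [q Gq <-] xq] := xG _ (p0 n); exists q.
have [n m nm|e e0|y yP] := @fast_cauchy_lim R U (fun n => (q n).2) (fun n => 2^-1 ^+ n).
- have [Gn xn] := qP n; have [Gm xm] := qP m.
  rewrite -(iG (q n - q m)); last exact: lspanB.
  apply: le_trans (ler_distD x _ _) _; rewrite (distrC _ x).
  have : 2^-1 ^+ m <= 2^-1 ^+ n :> R by apply: ler_wiXn2l => //; lra.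
  by move: xn xm => /=; lra.
- by have [n] := half_pow_small e0; exists n.
exists y => e e0; have e2 : 0 < e / 2 by lra.
have [n ne] := half_pow_small e2; exists (q n); first by have [] := qP n.
split=> /=; last by rewrite distrC; apply: le_lt_trans (yP n) _; lra.
by apply: lt_trans (qP n).2 _; have := p0 n; lra.
Qed.

(** By homogeneity it is enough to test the combinations in which the new pair has coefficient 1. *)
Lemma isom_adjoin G a z : isom G -> (forall p, lspan G p -> `|z - p.2| = `|a - p.1|) ->
  isom (G `|` [set (a, z)]).
Proof.
move=> iG az p /lspan_setU1[t [q [Gq ->]]] /=.
have [->|t0] := eqVneq t 0; first by rewrite !scale0r !add0r; exact: iG.
have := az (- t^-1 *: q) (lspanZ _ Gq).
rewrite /= !scaleNr !opprK => e.
have h (W : completeNormedModType R) (x y : W) : t *: x + y = t *: (x + t^-1 *: y).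
  by rewrite scalerDr scalerA divff // scale1r.
by rewrite (h V) (h U) !normrZ e.
Qed.

Lemma graph_fun G : isom G -> (forall x, cspan (fst @` G) x) ->
  exists2 w : {linear V -> U}, isometric_embedding w & forall p, gcl G p -> w p.1 = p.2.
Proof.
move=> iG Gt; have /choice[f fP] := fun x => gcl_total iG (Gt x).
have fu x y : gcl G (x, y) -> y = f x.
  move=> xy; apply/eqP; rewrite -subr_eq0 -normr_eq0.
  have := isom_gcl iG (gclZD (-1) (fP x) xy).
  by rewrite /= !scaleN1r addNr normr0 addrC => <-.
have [a x y|g gE] := @linear_pack R V U f.
  by apply/esym/fu; exact: (gclZD a (fP x) (fP y)).
exists g => [x|[x y] /fu /= ->]; last by rewrite gE.
by rewrite gE -(isom_gcl iG (fP x)).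
Qed.

End Graphs.

Section Data.
Context {R : realType} {U : completeNormedModType R}.
Implicit Types (M : set (U * R)) (X T : set U).

(* A pair [(p, d)] of [M] stands for the constraint [|z - p| <= d] on an unknown vector [z]. *)
Inductive conv M : U -> R -> Prop :=
| conv_in p d : M (p, d) -> conv M p d
| conv_mix t p q d e : 0 <= t -> t <= 1 -> conv M p d -> conv M q e ->
    conv M (t *: p + (1 - t) *: q) (t * d + (1 - t) * e).

Lemma mix_dist t (p q x y : U) d e : 0 <= t -> t <= 1 -> `|x - p| <= d -> `|y - q| <= e ->
  `|(t *: x + (1 - t) *: y) - (t *: p + (1 - t) *: q)| <= t * d + (1 - t) * e.
Proof.
move=> t0 t1 xp yq; rewrite opprD addrACA -!scalerBr.
apply: le_trans (ler_normD _ _) _; rewrite !normrZ !ger0_norm //; last by lra.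
by apply: lerD; apply: ler_wpM2l => //; lra.
Qed.

Lemma mix_same (t : R) (x : U) : t *: x + (1 - t) *: x = x.
Proof. by rewrite -scalerDl addrC subrK scale1r. Qed.

Lemma conv_boundD M z c p d : (forall p d, M (p, d) -> `|z - p| <= c + d) ->
  conv M p d -> `|z - p| <= c + d.
Proof.
move=> Mz; elim=> [{}p {}d /Mz//|t {}p q {}d e t0 t1 _ IHp _ IHq].
rewrite -[z](mix_same t); apply: le_trans (mix_dist t0 t1 IHp IHq) _; lra.
Qed.

Lemma conv_bound M z p d : (forall p d, M (p, d) -> `|z - p| <= d) -> conv M p d -> `|z - p| <= d.
Proof.
move=> Mz Mp; rewrite -[d]add0r; apply: conv_boundD Mp => q e Mq.
by rewrite add0r; exact: Mz.
Qed.

Definition consistent M := forall p d q e, M (p, d) -> M (q, e) -> `|p - q| <= d + e.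

Lemma conv_consistent M p d q e : consistent M -> conv M p d -> conv M q e -> `|p - q| <= d + e.
Proof.
move=> cM Mp Mq; apply: conv_boundD Mq => {}q {}e Mq.
rewrite distrC (addrC d); apply: conv_boundD Mp => {}p {}d Mp.
exact: cM.
Qed.

Lemma conv_ge0 M p d : consistent M -> conv M p d -> 0 <= d.
Proof. by move=> cM Mp; have := conv_consistent cM Mp Mp; rewrite subrr normr0; lra. Qed.

Lemma conv_sub M M' p d : M `<=` M' -> conv M p d -> conv M' p d.
Proof.
move=> MM; elim=> [{}p {}d /MM|t {}p q {}d e t0 t1 _ IHp _ IHq]; first exact: conv_in.
exact: conv_mix.
Qed.

Lemma conv_lspan M p d : conv M p d -> lspan (fst @` M) p.
Proof.
elim=> [{}p {}d Mp|t {}p q {}d e t0 t1 _ IHp _ IHq]; first by apply: lspan_sub; exists (p, d).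
by apply: lspanD; exact: lspanZ.
Qed.

Lemma conv_bigcup (J : Type) (D : set J) (F : J -> set (U * R)) p d :
  (forall i j, D i -> D j -> exists k, [/\ D k, F i `<=` F k & F j `<=` F k]) ->
  conv (\bigcup_(j in D) F j) p d -> exists2 j, D j & conv (F j) p d.
Proof.
move=> dir; elim=> [{}p {}d [j Dj Fp]|t {}p q {}d e t0 t1 _ [i Di IHp] _ [j Dj IHq]].
  by exists j => //; exact: conv_in.
have [k [Dk ik jk]] := dir i j Di Dj; exists k => //.
by apply: conv_mix => //; [exact: conv_sub IHp|exact: conv_sub IHq].
Qed.

(* [z] realizes over [X] the largest distance function [x |-> |z - x|] allowed by the
   constraints [|z - p| <= d], for [(p, d)] in [M]. *)
Definition realizes M X z := (forall p d, M (p, d) -> `|z - p| <= d) /\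
  forall x, X x -> forall e : R, 0 < e ->
    exists p d, conv M p d /\ d + `|p - x| < `|z - x| + e.

(** [sm] bounds the data and [kc] the base. The centres of [M] are added to the base, so that the
    distances compared include those to the centres. *)
Definition realizing (sm kc : card_class) := forall (X : set U) M,
  kc _ X -> sm _ M -> M !=set0 -> consistent M ->
  exists z, realizes M (cspan (X `|` fst @` M)) z.

(* For subspaces [T] and [X], this is clause (ii) of [PO[T, X]]. *)
Definition Ind T X := forall t x, T t -> X x -> forall e : R, 0 < e ->
  exists r, [/\ T r, X r & `|t - r| + `|r - x| < `|t - x| + e].

End Data.

(** Translation: if x is close to x0 + b with b in the span of [B], interpolate between t - b and
    x0, then add b to the interpolating vector. *)
Lemma Ind_span {R : realType} {V : completeNormedModType R} (A X B : set V) : subsp X ->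
  Ind (cspan A) X -> B `<=` cspan A -> Ind (cspan A) (cspan (X `|` B)).
Proof.
move=> hX iA BA t x At Xx e e0; have e4 : 0 < e / 4 by lra.
have [y Xy xy] := cspan_approx e4 Xx.
have [x0 [b [Xx0 Bb yE]]] := lspan_setU Xy.
have {}Xx0 : X x0 by move: Xx0; apply: lspan_le.
have Ab : cspan A b by apply: (lspan_le (cspan_subsp A) BA).
have [r [Ar Xr rP]] := iA (t - b) x0 (subspB (cspan_subsp A) At Ab) Xx0 _ e4.
exists (r + b); split.
- exact: subspD (cspan_subsp A) Ar Ab.
- apply: subspD (cspan_subsp _) _ _; first by apply: cspan_sub; left.
  by apply: lspan_cspan; apply: lspanS_sub Bb => ? ?; right.
- have e1 : `|t - (r + b)| = `|t - b - r| by rewrite opprD addrA addrAC.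
  have e2 : `|t - b - x0| <= `|t - x| + e / 4.
    have -> : t - b - x0 = (t - x) + (x - y) by rewrite subrKA yE opprD addrA addrAC.
    by apply: le_trans (ler_normD _ _) _; lra.
  have e3 : `|r + b - x| <= `|r - x0| + e / 4.
    have -> : r + b - x = (r - x0) + (y - x) by rewrite yE -[x0 + b - x]addrA subrKA addrA.
    by apply: le_trans (ler_normD _ _) _; rewrite (distrC y); lra.
  by rewrite e1; lra.
Qed.

(** * Extending a partial isometry *)

Section Forth.
Context {R : realType} {V U : completeNormedModType R}.
Variables sm kc : card_class.
Hypothesis (smP : small_class sm) (kcP : small_class kc).
Hypothesis smkc : forall T (A : set T), sm A -> kc A.
Hypothesis real : realizing (U := U) sm kc.
Implicit Types (G P : set (V * U)).

(** Transport to [U] the distances from [a] to a small dense subset of the intersection of [cspan A]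
    with the domain, and let [z] realize them. Independence makes these few distances determine the
    distance of [a] to the whole domain. *)
Lemma forth1 G (B : set U) (A : set V) (a : V) : kc B -> (forall p, G p -> cspan B p.2) ->
  isom G -> sm A -> cspan A a -> Ind (cspan A) (cspan (fst @` G)) ->
  exists z, isom (G `|` [set (a, z)]).
Proof.
move=> kB GB iG sA Aa iA; pose X := cspan (fst @` G); pose T := cspan A.
have [E [sE ET TE]] : exists E, [/\ sm E, E `<=` T `&` X & T `&` X `<=` closure E].
  apply: (small_dense_sub (D := qspan A)) => //; first exact: small_qspan.
  by rewrite cspan_qspan => x [].
have /choice[f fP] : forall r, exists r', X r -> gcl G (r, r').
  move=> r; have [Xr|] := pselect (X r); last by exists 0.
  by have [r' rr'] := gcl_total iG Xr; exists r'.
pose M : set (U * R) := [set (f r, `|a - r|) | r in E].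
have Ef r : E r -> gcl G (r, f r) by move=> /ET[_ Xr]; exact: fP.
have d_gcl r x r' y : gcl G (r, r') -> gcl G (x, y) -> `|r - x| = `|r' - y|.
  move=> Gr Gx; have := isom_gcl iG (gclZD (-1) Gx Gr).
  by rewrite /= !scaleN1r !(addrC (- _)).
have cM : consistent M.
  move=> _ _ _ _ [r Er [<- <-]] [q Eq [<- <-]].
  rewrite -(d_gcl _ _ _ _ (Ef r Er) (Ef q Eq)); apply: le_trans (ler_distD a _ _) _.
  by rewrite (distrC r).
have T0 : (T `&` X) 0 by split; exact: (cspan_subsp _).1.
have [r0 Er0 _] := (closureNP _ _).1 (TE _ T0) 1 ltr01.
have [z [z1 z2]] : exists z, realizes M (cspan (B `|` fst @` M)) z.
  by apply: real => //; [exact: (small_image smP)|exists (f r0, `|a - r0|); exists r0].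
exists z; apply: isom_adjoin => // -[x y] Gp /=.
have Xx : X x by apply: lspan_cspan; rewrite lspan_fst; exists (x, y).
have By : cspan B y.
  have : lspan (snd @` G) y by rewrite lspan_snd; exists (x, y).
  by apply: (lspan_le (cspan_subsp B)) => _ [p /GB Bp <-].
have Gxy := sub_gcl Gp.
apply/eqP; rewrite eq_le; apply/andP; split; apply/ler_addgt0Pr => e e0.
  (* Upper bound: by independence the distance from [a] to [x] is nearly attained through some [r]
     of the intersection, and near [r] there is a centre of [M]. *)
  have e4 : 0 < e / 4 by lra.
  have [r [Tr Xr rP]] := iA a x Aa Xx _ e4.
  have [r1 Er1 r1P] := (closureNP _ _).1 (TE _ (conj Tr Xr)) _ e4.
  have zr1 : `|z - f r1| <= `|a - r1| by apply: z1; exists r1.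
  apply: le_trans (ler_distD (f r1) _ _) _.
  rewrite -(d_gcl _ _ _ _ (Ef r1 Er1) Gxy).
  have := ler_distD r a r1; have := ler_distD r r1 x; rewrite (distrC r1 r); lra.
(* Lower bound: the distance from [z] to [y] is nearly attained through a convex combination of
   centres, which is the image of a combination lying as close to [a]. *)
have By' : cspan (B `|` fst @` M) y by apply: cspanS By => ? ?; left.
have [p [d [Mp pd]]] := z2 y By' e e0.
have [p' [Gp' ap']] : exists p', gcl G (p', p) /\ `|a - p'| <= d.
  elim: Mp {pd} => [_ _ [r Er [<- <-]]|t {}p q {}d e' t0 t1 _ [p' [Gp' p'd]] _ [q' [Gq' q'd]]].
    by exists r; split=> //; exact: Ef.
  exists (t *: p' + (1 - t) *: q'); split.
    have -> : (t *: p' + (1 - t) *: q', t *: p + (1 - t) *: q) =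
      t *: (p', p) + ((1 - t) *: (q', q) + 0) by rewrite addr0.
    by apply: gclZD => //; apply: gclZD => //; exact/sub_gcl/lspan0.
  by rewrite -[a](mix_same t); exact: mix_dist.
apply: le_trans (ler_distD p' _ _) _; rewrite (d_gcl _ _ _ _ Gp' Gxy); lra.
Qed.

(** All of [A] is reached by taking a maximal extension. It stays small, whatever its construction,
    because first projection is injective on it with values in [A]; independence survives by
    [Ind_span], since only vectors of [A] are added to the domain. [P0] is the small part of the
    isometry already built over [G]. *)
Lemma forth G P0 (B : set U) (A : set V) : kc B -> (forall p, G p -> cspan B p.2) ->
  sm P0 -> isom (G `|` P0) -> sm A -> fst @` P0 `<=` A -> Ind (cspan A) (cspan (fst @` G)) ->
  exists P, [/\ sm P, P0 `<=` P, isom (G `|` P), A `<=` fst @` P & fst @` P `<=` A].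
Proof.
move=> kB GB sP0 iP0 sA P0A iA.
pose ok (Q : set (V * U)) := isom (G `|` P0 `|` Q) /\ fst @` Q `<=` A.
have [F FP tF|Q [[iQ QA] Qmax]] := @Zorn_bigcup _ ok.
  split; last by move=> _ [p [Q FQ Qp] <-]; apply: (FP _ FQ).2; exists p.
  have [->|/set0P[Q0 FQ0]] := eqVneq F set0.
    by rewrite bigcup_set0 setU0.
  move=> p; have -> : G `|` P0 `|` \bigcup_(Q in F) Q = \bigcup_(Q in F) (G `|` P0 `|` Q).
    by rewrite bigcupUr //; exists Q0.
  move=> Gp; have dir Q Q' : F Q -> F Q' -> exists Q'', [/\ F Q'',
      G `|` P0 `|` Q `<=` G `|` P0 `|` Q'' & G `|` P0 `|` Q' `<=` G `|` P0 `|` Q''].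
    move=> FQ FQ'; have [QQ|QQ] := tF _ _ FQ FQ'; [exists Q'|exists Q]; split=> //;
      exact: setUS.
  have [Q FQ Qp] := lspan_bigcup dir FQ0 Gp.
  exact: (FP _ FQ).1.
have QU : G `|` P0 `|` Q = G `|` (P0 `|` Q) by rewrite setUA.
have finj p q : (P0 `|` Q) p -> (P0 `|` Q) q -> p.1 = q.1 -> p = q.
  move=> Pp Pq pq; have : `|(p - q).1| = `|(p - q).2|.
    by apply: iQ; rewrite QU; apply: lspanB; apply: lspan_sub; right.
  rewrite /= pq subrr normr0 => /esym/normr0_eq0/eqP; rewrite subr_eq0 => /eqP.
  by move: p q pq {Pp Pq} => [? ?] [? ?] /= -> ->.
have PA : fst @` (P0 `|` Q) `<=` A by move=> _ [p [Pp|Qp] <-]; [apply: P0A|apply: QA]; exists p.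
have sP : sm (P0 `|` Q).
  apply: (small_le smP) sA; apply: (@card_le_inj _ _ _ _ fst); last exact: finj.
  by move=> p Pp; apply: PA; exists p.
exists (P0 `|` Q); split; [exact: sP|by move=> p ?; left|by rewrite -QU| |exact: PA].
move=> a Aa; apply: contrapT => na.
have [||||||z iz] := @forth1 (G `|` (P0 `|` Q)) (B `|` snd @` (P0 `|` Q)) A a.
- by apply: (smallU kcP) => //; apply: smkc; exact: (small_image smP).
- move=> p [/GB|Pp]; first by apply: cspanS => ? ?; left.
  by apply: cspan_sub; right; exists p.
- by rewrite -QU.
- exact: sA.
- exact: cspan_sub.
- suff -> : cspan (fst @` (G `|` (P0 `|` Q))) = cspan (cspan (fst @` G) `|` fst @` (P0 `|` Q)).
    by apply: Ind_span => //; [exact: cspan_subsp|move=> x /PA; exact: cspan_sub].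
  rewrite image_setU; apply/seteqP; split; apply: cspan_mono.
    by move=> x [Gx|Px]; apply: cspan_sub; [left; exact: cspan_sub|right].
  move=> x [|Px]; first by apply: cspanS => ? ?; left.
  by apply: cspan_sub; right.
apply: (Qmax (Q `|` [set (a, z)])).
  split; first exact: subsetUl.
  move=> /(_ (a, z) (or_intror erefl)) Qaz; apply: na.
  by exists (a, z) => //; right.
split; first by rewrite setUA QU.
by move=> _ [p [Qp|->] <-]; [apply: QA; exists p|].
Qed.

End Forth.

(** * Realizations and push-outs *)

Definition lt_class (K : Type) : card_class := fun T A => A #< [set: K].

Section Pushouts.
Context {R : realType} {V : completeNormedModType R}.
Implicit Types (S X Y : set V).

Lemma is_subspaceE S : is_subspace S <-> closed S /\ subsp S.
Proof. by split=> [[cS hS]|/is_subspaceP[hS cS]]; [exact/is_subspaceP|split]. Qed.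

Let po_set S X (x s : V) : set R := [set `|x + r| + `|s - r| | r in S `&` X].

Lemma po_adherent S X x s (e : R) : subsp S -> subsp X -> 0 < e ->
  exists2 r, S r /\ X r & `|x + r| + `|s - r| < inf (po_set S X x s) + e.
Proof.
move=> hS hX e0; have [|_ [r [Sr Xr] <-] rP] := @inf_adherent R (po_set S X x s) e e0.
  split; first by exists (`|x + 0| + `|s - 0|); exists 0 => //; split; [exact: hS.1|exact: hX.1].
  by exists 0 => _ [r _ <-]; apply: addr_ge0.
by exists r.
Qed.

Lemma pushout_Ind S X Y : is_pushout S X Y -> Ind S X.
Proof.
move=> [[/is_subspaceE[_ hS] /is_subspaceE[_ hX] _] _ _ _ PO] t x St Xx e e0.
have := PO _ _ (subspN hX Xx) St; have [r [Sr Xr]] := po_adherent (- x) t hS hX e0.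
move=> rP PO'; exists r; split=> //; move: rP; rewrite /po_set -PO'.
by rewrite (addrC (- x) r) (addrC (- x) t) (addrC `|r - x|).
Qed.

Lemma Ind_pushout S X Y : is_subspace S -> is_subspace X -> is_subspace Y ->
  S `<=` Y -> X `<=` Y -> Y = closure [set s + x | s in S & x in X] ->
  Ind S X -> is_pushout S X Y.
Proof.
move=> sS sX sY SY XY YE iSX; split=> // x s Xx Ss.
have hS := (is_subspaceE S).1 sS; have hX := (is_subspaceE X).1 sX.
apply/eqP; rewrite eq_le; apply/andP; split.
  apply: lb_le_inf; first by exists (`|x + 0| + `|s - 0|); exists 0 => //; split; [exact: hS.2.1|exact: hX.2.1].
  move=> _ [r _ <-]; have -> : x + s = (x + r) + (s - r) by rewrite addrC -(subrKA r) addrC (addrC r).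
  exact: ler_normD.
apply/ler_addgt0Pr => e e0.
have [r [Sr Xr rP]] := iSX s (- x) Ss (subspN hX.2 Xx) e e0.
apply: le_trans (_ : `|x + r| + `|s - r| <= _).
  apply: ge_inf; first by exists 0 => _ [q _ <-]; apply: addr_ge0.
  by exists r.
by move: rP; rewrite !opprK (addrC x r) (addrC x s) (addrC `|r + x|) => /ltW.
Qed.

End Pushouts.

Section Extension.
Context {R : realType} {U : completeNormedModType R} (kappa tau : Type).
Hypothesis ctau : ~ countable [set: tau].
Hypothesis tau_kappa : [set: tau] #<= [set: kappa].

Lemma uncountable_kappa : ~ countable [set: kappa].
Proof. by move=> ck; apply: ctau; exact: card_le_trans tau_kappa ck. Qed.

Let smP := lt_class_small ctau.
Let kcP := lt_class_small uncountable_kappa.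
Let smkc T (A : set T) : lt_class tau A -> lt_class kappa A.
Proof. by move=> h; exact: card_lt_le_trans tau_kappa. Qed.

(** The pairs (v x, u x) form a partial isometry from [Y] to [U], and a small dense subset of the
    push-out factor [S] is independent of its domain. So [forth] extends it to a set spanning a
    dense subspace of [Y]. *)
Lemma realizing_extension : realizing (U := U) (lt_class tau) (lt_class kappa) ->
  posex_extension_property kappa tau U.
Proof.
move=> real X Y u v iu [iv [S PO /dens_ltP[A [AS SA sA]]]] /dens_ltP[D [_ XD kD]].
pose G : set (Y * U) := [set (v x, u x) | x in [set: X]].
have SE : cspan A = S.
  have [[/is_subspaceE[cS hS] _ _] _ _ _ _] := PO.
  apply/seteqP; split; first exact: cspan_le.
  by apply: (subset_trans SA); apply: closure_subset; exact: lspan_sub.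
have vE : cspan (fst @` G) = range v.
  have [[_ /is_subspaceE[cv hv] _] _ _ _ _] := PO.
  apply/seteqP; split; first by apply: cspan_le => // _ [_ [x _ <-] <-]; exists x.
  by move=> _ [x _ <-]; apply: cspan_sub; exists (v x, u x) => //; exists x.
have iG : isom G.
  move=> p; suff : lspan G p -> exists x, p = (v x, u x).
    by move=> /[apply] -[x ->] /=; rewrite iu iv.
  elim=> [|a q r [x _ <-] _ [y ->]]; first by exists 0; rewrite !linear0.
  by exists (a *: x + y); rewrite !linearP.
have [|||||||P [sP _ iP AP PA]] := @forth _ Y U _ _ smP kcP smkc real G set0 (u @` D) A.
- exact: (small_image kcP).
- move=> _ [x _ <-] /=; apply/closureNP => e e0.
  have [y Dy xy] := (closureNP _ _).1 (XD x I) e e0.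
  by exists (u y); [apply: lspan_sub; exists y|rewrite -linearB iu].
- exact: (small0 smP).
- by rewrite setU0.
- exact: sA.
- by move=> _ [? []].
- by rewrite SE vE; exact: pushout_Ind PO.
have [|w iw wP] := graph_fun iP.
  have [_ _ _ YE _] := PO; move=> y; have : [set: Y] y by [].
  rewrite YE => /closureNP Yy; apply/closureNP => e e0.
  have [_ [s Ss [_ [x _ <-] <-]] sx] := Yy _ e0.
  have e2 : 0 < e - `|y - (s + v x)| by rewrite subr_gt0.
  move: Ss; rewrite -SE => /(cspan_approx e2)[s' As' ss'].
  exists (s' + v x).
    apply: lspanD; last by apply: lspan_sub; exists (v x, u x) => //; left; exists x.
    by apply: lspanS_sub As' => a /AP[p Pp <-]; exists p => //; right.
  have -> : y - (s' + v x) = y - (s + v x) + (s - s').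
    by rewrite [s + _]addrC [s' + _]addrC !opprD !addrA subrK.
  by apply: le_lt_trans (ler_normD _ _) _; lra.
exists w => //; apply/funext => x /=; apply: (wP (v x, u x)).
by apply: sub_gcl; apply: lspan_sub; left; exists x.
Qed.

End Extension.

(** * The extension of a space by one vector *)

Section Adjoin.
Context {R : realType} {U : completeNormedModType R} (M : set (U * R)).
Hypothesis cM : consistent M.

(* The norm of [x + t e], where [e] is a new vector subject to [|e - p| <= d] (up to sign). *)
Definition dnorm (q : U * R) : R :=
  inf [set `|q.2| * pd.2 + `|q.1 + q.2 *: pd.1| | pd in [set pd | conv M pd.1 pd.2]].

Let lb (q : U * R) : has_lbound [set `|q.2| * pd.2 + `|q.1 + q.2 *: pd.1| | pd in [set pd | conv M pd.1 pd.2]].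
Proof.
exists 0 => _ [[p d] /= Mp <-]; apply: addr_ge0 => //; apply: mulr_ge0 => //.
exact: conv_ge0 Mp.
Qed.

Lemma dnorm_le q p d : conv M p d -> dnorm q <= `|q.2| * d + `|q.1 + q.2 *: p|.
Proof. by move=> Mp; apply: ge_inf; [exact: lb|exists (p, d)]. Qed.

Hypothesis M0 : M !=set0.

Let conv0 : exists p d, conv M p d.
Proof. by have [[p d] Mp] := M0; exists p, d; exact: conv_in. Qed.

Lemma dnorm_ge q b : (forall p d, conv M p d -> b <= `|q.2| * d + `|q.1 + q.2 *: p|) -> b <= dnorm q.
Proof.
move=> h; apply: lb_le_inf; last by move=> _ [[p d] /= Mp <-]; exact: h.
by have [p [d Mp]] := conv0; exists (`|q.2| * d + `|q.1 + q.2 *: p|); exists (p, d).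
Qed.

Lemma dnorm_adherent q e : 0 < e -> exists p d, conv M p d /\
  `|q.2| * d + `|q.1 + q.2 *: p| < dnorm q + e.
Proof.
move=> e0; have [|_ [[p d] /= Mp <-] pd] := @inf_adherent R
  [set `|q.2| * pd.2 + `|q.1 + q.2 *: pd.1| | pd in [set pd | conv M pd.1 pd.2]] e e0.
  split; last exact: lb.
  by have [p [d Mp]] := conv0; exists (`|q.2| * d + `|q.1 + q.2 *: p|); exists (p, d).
by exists p, d.
Qed.

Lemma dnorm_fst x : dnorm (x, 0) = `|x|.
Proof.
apply/eqP; rewrite eq_le; apply/andP; split.
  have [p [d Mp]] := conv0; have := dnorm_le (x, 0) Mp.
  by rewrite /= normr0 mul0r add0r scale0r addr0.
by apply: dnorm_ge => p d _ /=; rewrite normr0 mul0r add0r scale0r addr0.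
Qed.

(** For coefficients of equal sign, mix the two pairs with weights proportional to them. For
    opposite signs keep the pair of the larger coefficient; replacing [p'] by [p] costs |s| (d + d')
    by consistency, which is what |t + s| = |t| - |s| saves. *)
Let dnormD_aux (x y p p' : U) (t s d d' : R) : conv M p d -> conv M p' d' -> `|s| <= `|t| ->
  dnorm (x + y, t + s) <= (`|t| * d + `|x + t *: p|) + (`|s| * d' + `|y + s *: p'|).
Proof.
move=> Mp Mp' st.
have [ts0|ts0] := lerP 0 (t * s).
  have [t0|t0] := eqVneq t 0.
    have s0 : s = 0 by move: st; rewrite t0 normr0 normr_le0 => /eqP.
    have := dnorm_le (x + y, t + s) Mp; rewrite /= t0 s0 addr0 normr0 !mul0r !scale0r !addr0 !add0r.
    by move=> /le_trans; apply; exact: ler_normD.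
  have tsn : t + s != 0.
    apply: contraNneq t0 => e; move: ts0; have -> : s = - t by lra.
    by rewrite mulrN oppr_ge0 => h; rewrite -sqrf_eq0 eq_le sqr_ge0 andbT expr2.
  pose l := t / (t + s).
  have ts1 : 0 < (t + s) ^+ 2 by rewrite exprn_even_gt0.
  have l0 : 0 <= l.
    rewrite -(pmulr_lge0 _ ts1) /l expr2 mulrA divfK //; have := sqr_ge0 t; nra.
  have l1 : 0 <= 1 - l.
    rewrite -(pmulr_lge0 _ ts1) mulrBl mul1r /l expr2 mulrA divfK //; have := sqr_ge0 s; nra.
  have tl : (t + s) * l = t by rewrite mulrC divfK.
  have sl : (t + s) * (1 - l) = s by rewrite mulrBr tl mulr1; lra.
  have tl' : `|t + s| * l = `|t| by rewrite -[in RHS]tl normrM (ger0_norm l0).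
  have sl' : `|t + s| * (1 - l) = `|s| by rewrite -[in RHS]sl normrM (ger0_norm l1).
  clearbody l.
  have Ml : conv M (l *: p + (1 - l) *: p') (l * d + (1 - l) * d').
    by apply: conv_mix => //; lra.
  apply: le_trans (dnorm_le _ Ml) _ => /=.
  rewrite mulrDr !mulrA tl' sl' scalerDr !scalerA tl sl addrACA [leRHS]addrACA lerD2l.
  exact: ler_normD.
apply: le_trans (dnorm_le _ Mp) _ => /=.
have nE : `|t + s| = `|t| - `|s|.
  move: ts0 st; case: (ger0P t) => ht; case: (ger0P s) => hs ts0 st.
  - by nra.
  - by rewrite ger0_norm; lra.
  - by rewrite ler0_norm; lra.
  - by nra.
have -> : x + y + (t + s) *: p = (x + t *: p) + ((y + s *: p') + s *: (p - p')).
  by rewrite scalerBr [s *: p - _]addrC [_ + (- _ + _)]addrA addrK addrACA -scalerDl.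
have h1 := ler_normD (x + t *: p) ((y + s *: p') + s *: (p - p')).
have h2 := ler_normD (y + s *: p') (s *: (p - p')).
have h3 : `|s *: (p - p')| <= `|s| * (d + d').
  by rewrite normrZ; apply: ler_wpM2l => //; exact: conv_consistent cM Mp Mp'.
rewrite nE mulrBl; move: h3; rewrite mulrDr; lra.
Qed.

Lemma dnormD q q' : dnorm (q + q') <= dnorm q + dnorm q'.
Proof.
move: q q' => [x t] [y s]; apply/ler_addgt0Pr => e e0; have e2 : 0 < e / 2 by lra.
have [p [d [Mp pd]]] := dnorm_adherent (x, t) e2.
have [p' [d' [Mp' pd']]] := dnorm_adherent (y, s) e2.
move: pd pd' => /= pd pd'; rewrite -[(x, t) + (y, s)]/(x + y, t + s).
have [st|ts] := lerP `|s| `|t|.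
  have := dnormD_aux x y Mp Mp' st; lra.
have := dnormD_aux y x Mp' Mp (ltW ts).
by rewrite (addrC y) (addrC s); lra.
Qed.

Lemma dnormZ a q : dnorm (a *: q) = `|a| * dnorm q.
Proof.
have [->|a0] := eqVneq a 0.
  by rewrite normr0 mul0r scale0r -[0]/((0 : U), (0 : R)) dnorm_fst normr0.
have le b r : b != 0 -> `|b| * dnorm r <= dnorm (b *: r).
  move=> b0; apply: dnorm_ge => p d Mp /=.
  rewrite normrM -mulrA -scalerA -scalerDr normrZ -mulrDr.
  by apply: ler_wpM2l => //; exact: dnorm_le.
apply/eqP; rewrite eq_le le // andbT.
have := le a^-1 (a *: q); rewrite invr_eq0 scalerA mulVf // scale1r => /(_ a0).
by rewrite normfV ler_pdivrMl // normr_gt0.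
Qed.

Variable c : R.
Hypotheses (c0 : 0 < c) (cd : forall p d, conv M p d -> c <= d).

Lemma dnorm_snd q : c * `|q.2| <= dnorm q.
Proof.
apply: dnorm_ge => p d Mp; have := cd Mp; have := normr_ge0 (q.1 + q.2 *: p).
have := normr_ge0 q.2; nra.
Qed.

(** The norm is equivalent to the sum norm, which gives completeness. [K] is chosen to exceed both 1
    + (d + |p|) / c, needed in the first estimate, and d + |p|, needed in the second. *)
Lemma dnorm_fst_le : exists2 K : R, 0 < K & forall q, `|q.1| <= K * dnorm q /\
  dnorm q <= `|q.1| + K * `|q.2|.
Proof.
have [p [d Mp]] := conv0; have d0 := conv_ge0 cM Mp.
have n2 (q : U * R) : dnorm (0, q.2) <= (d + `|p|) * `|q.2|.
  have := dnorm_le (0, q.2) Mp; rewrite /= add0r normrZ; lra.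
have p0 := normr_ge0 p.
exists (1 + (d + `|p|) + (d + `|p|) / c).
  have : 0 <= (d + `|p|) / c by apply: divr_ge0; [lra|exact: ltW].
  lra.
move=> q; have qq2 := dnorm_snd q; have n0 := normr_ge0 q.2.
have k0 : 0 <= (d + `|p|) / c by apply: divr_ge0; [lra|exact: ltW].
have q0 : 0 <= dnorm q by apply: le_trans qq2; apply: mulr_ge0 => //; exact: ltW.
split.
  have := dnormD q (- (0, q.2)).
  have -> : q + - (0, q.2) = (q.1, 0).
    by rewrite [X in X = _]surjective_pairing /= subr0 subrr.
  rewrite dnorm_fst -scaleN1r dnormZ normrN normr1 mul1r => h.
  have h1 : (d + `|p|) * `|q.2| <= (d + `|p|) / c * dnorm q.
    rewrite -mulrA; apply: ler_wpM2l; first by lra.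
    by rewrite ler_pdivlMl.
  have h2 : 0 <= (d + `|p|) * dnorm q by apply: mulr_ge0; lra.
  have := n2 q; rewrite !mulrDl mul1r in h1 h2 *; lra.
have := dnormD (q.1, 0) (0, q.2).
have -> : (q.1, 0) + (0, q.2) = q by rewrite [RHS]surjective_pairing; congr pair; rewrite /= ?addr0 ?add0r.
rewrite dnorm_fst => h; have := n2 q.
have : 0 <= (1 + (d + `|p|) / c) * `|q.2| by apply: mulr_ge0; lra.
by rewrite !mulrDl; lra.
Qed.

Lemma dnorm_complete (X : set U) : closed X -> subsp X ->
  complete_norm [set q : U * R | X q.1] dnorm.
Proof.
move=> cX hX; have [K K0 Kle] := dnorm_fst_le; split.
- split; first by apply/mem_set; exact: hX.1.
  by move=> a x y /set_mem Xx /set_mem Xy; apply/mem_set; exact: hX.2.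
- by move=> *; exact: dnormD.
- by move=> *; exact: dnormZ.
- move=> q _ q0; have := dnorm_snd q; have [+ _] := Kle q.
  rewrite q0 mulr0 normr_le0 => /eqP q1; rewrite pmulr_rle0 // normr_le0 => /eqP q2.
  by rewrite [q]surjective_pairing q1 q2.
- move=> u Xu uc.
  have small (r e : R) : 0 < r -> 0 < e -> exists n : nat, r * 2^-1 ^+ n < e.
    move=> r0 e0; have er : 0 < e / r by apply: divr_gt0.
    by have [n] := half_pow_small er; exists n; rewrite -ltr_pdivlMl // mulrC.
  have [n m nm|e|l1 l1P] := @fast_cauchy_lim R U (fun n => (u n).1) (fun n => K * 2^-1 ^+ n).
  + have [+ _] := Kle (u n - u m); move=> /le_trans; apply.
    by apply: ler_wpM2l; [exact: ltW|exact: uc].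
  + exact: small.
  have [n m nm|e e0|l2 l2P] := @fast_cauchy_lim R R^o (fun n => (u n).2) (fun n => c^-1 * 2^-1 ^+ n).
  + by rewrite ler_pdivlMl //; apply: le_trans (dnorm_snd (u n - u m)) _; exact: uc.
  + by apply: small => //; rewrite invr_gt0.
  exists (l1, l2) => [/=|e e0].
    rewrite ((closure_id X).1 cX); apply/closureNP => e e0.
    have [n ne] := small K e K0 e0; exists (u n).1; first exact: Xu.
    by rewrite distrC; apply: le_lt_trans (l1P n) ne.
  have KK : 0 < K + K * c^-1 by apply: addr_gt0 => //; apply: mulr_gt0 => //; rewrite invr_gt0.
  have [n0 n0P] := small _ e KK e0; exists n0 => n nn.
  have [_ +] := Kle (u n - (l1, l2)); move=> /le_lt_trans; apply.
  apply: le_lt_trans n0P; rewrite mulrDl; apply: lerD.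
    apply: le_trans (l1P n) _; apply: ler_wpM2l; first exact: ltW.
    by apply: ler_wiXn2l => //; lra.
  rewrite -mulrA; apply: ler_wpM2l; first exact: ltW.
  apply: le_trans (l2P n) _; apply: ler_wpM2l; first by rewrite invr_ge0 ltW.
  by apply: ler_wiXn2l => //; lra.
Qed.

End Adjoin.

Section BanachInterface.
Context {R : realType} {L : lmodType R} {S : set L} {N : L -> R} (P : complete_norm S N).

Definition bof_val (x : banach_of P) : L := sval x.

Arguments bof_val : simpl never.

Lemma bof_valP x : S (bof_val x). Proof. exact: bvalP. Qed.

Lemma bof_mk x : S x -> exists y, bof_val y = x.
Proof. by move=> Sx; exists (exist _ x (mem_set Sx)). Qed.

Lemma bof_norm x : `|x| = N (bof_val x). Proof. by []. Qed.

Lemma bof_inj : injective bof_val. Proof. exact: val_inj. Qed.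

Lemma bof_lin a x y : bof_val (a *: x + y) = a *: bof_val x + bof_val y.
Proof. exact: (linearP (val : banach_sub P -> L)). Qed.

Lemma bofB x y : bof_val (x - y) = bof_val x - bof_val y.
Proof. exact: (raddfB (val : banach_sub P -> L)). Qed.

Lemma bofD x y : bof_val (x + y) = bof_val x + bof_val y.
Proof. exact: (raddfD (val : banach_sub P -> L)). Qed.

Lemma bof0 : bof_val 0 = 0.
Proof. exact: (raddf0 (val : banach_sub P -> L)). Qed.

End BanachInterface.

Lemma subspace_complete {R : realType} {U : completeNormedModType R} (X : set U) :
  closed X -> subsp X -> complete_norm X (fun x => `|x|).
Proof.
move=> cX hX; split.
- split; first exact/mem_set/hX.1.
  by move=> a x y /set_mem Xx /set_mem Xy; apply/mem_set; exact: hX.2.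
- by move=> *; exact: ler_normD.
- by move=> *; exact: normrZ.
- by move=> x _ /normr0_eq0.
- move=> u Xu uc.
  have [e|l lP] := @fast_cauchy_lim R U u (fun n => 2^-1 ^+ n) uc; first exact: half_pow_small.
  have ul e : 0 < e -> exists n0, forall n, (n0 <= n)%N -> `|u n - l| < e.
    move=> e0; have [n0 n0P] := half_pow_small e0; exists n0 => n nn.
    apply: le_lt_trans (lP n) _; apply: le_lt_trans n0P; apply: ler_wiXn2l => //; lra.
  exists l => //; rewrite ((closure_id X).1 cX); apply/closureNP => e /ul[n nP].
  by exists (u n) => //; rewrite distrC; exact: nP.
Qed.

Section Realizing.
Context {R : realType} {U : completeNormedModType R} (kappa tau : Type).
Hypothesis ctau : ~ countable [set: tau].
Hypothesis tau_kappa : [set: tau] #<= [set: kappa].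

Let smP := lt_class_small ctau.
Let kcP := lt_class_small (uncountable_kappa ctau tau_kappa).
Let smkc T (A : set T) : lt_class tau A -> lt_class kappa A.
Proof. by move=> h; exact: card_lt_le_trans tau_kappa. Qed.

(** The degenerate case, in which the one-vector extension would carry only a seminorm: consistency
    makes centres of vanishing radius a Cauchy sequence, and its limit is already a realization. *)
Lemma realizes_limit (M : set (U * R)) X : consistent M ->
  (forall e, 0 < e -> exists p d, conv M p d /\ d < e) -> exists z, realizes M X z.
Proof.
move=> cM Me.
have p0 n : 0 < (2^-1 ^+ n) / 2 :> R by rewrite divr_gt0 // exprn_gt0 // invr_gt0.
have /choice[q qP] : forall n : nat, exists q : U * R, conv M q.1 q.2 /\ q.2 < (2^-1 ^+ n) / 2.
  by move=> n; have [p [d pd]] := Me _ (p0 n); exists (p, d).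
have [n m nm|e|z zP] := @fast_cauchy_lim R U (fun n => (q n).1) (fun n => 2^-1 ^+ n).
- have [qn dn] := qP n; have [qm dm] := qP m.
  apply: le_trans (conv_consistent cM qn qm) _.
  have : 2^-1 ^+ m <= 2^-1 ^+ n :> R by apply: ler_wiXn2l => //; lra.
  by move: dn dm; lra.
- exact: half_pow_small.
exists z; split=> [p d Mp|x _ e e0].
  apply/ler_addgt0Pr => e e0; have e2 : 0 < e / 2 by lra.
  have [n ne] := half_pow_small e2; have [qn dn] := qP n.
  have := conv_consistent cM qn (conv_in Mp); have := zP n; have := ler_distD (q n).1 z p.
  rewrite (distrC z (q n).1); move: dn; have := p0 n; lra.
have e2 : 0 < e / 2 by lra.
have [n ne] := half_pow_small e2; have [qn dn] := qP n.
exists (q n).1, (q n).2; split=> //; have := zP n; have := ler_distD z (q n).1 x.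
by move: dn; have := p0 n; lra.
Qed.

(** With radii bounded below, [dnorm] makes X + R e a Banach space [BY], which is a [tau]-posex of
    [X]. The image of e under the embedding given by property (3) has the required distances. *)
Lemma extension_realizing : posex_extension_property kappa tau U ->
  realizing (U := U) (lt_class tau) (lt_class kappa).
Proof.
move=> ext X0 M kX sM M0 cM; set X := cspan _.
have [Me|nMe] := pselect (forall e, 0 < e -> exists p d, conv M p d /\ d < e).
  exact: realizes_limit.
have [c [c0 cd]] : exists c : R, 0 < c /\ forall p d, conv M p d -> c <= d.
  move/existsNP : nMe => [c /not_implyP[c0 nc]]; exists c; split=> // p d Mp.
  by rewrite leNgt; apply/negP => dc; apply: nc; exists p, d.
have cX : closed X := @cspan_closed _ _ _.
have hX : subsp X := @cspan_subsp _ _ _.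
pose C := cspan (fst @` M).
have CX : C `<=` X by apply: cspanS => ? ?; right.
pose BX := banach_of (subspace_complete cX hX).
pose PY := dnorm_complete cM M0 c0 cd cX hX.
pose BY := banach_of PY.
have [K K0 Kle] := dnorm_fst_le cM M0 c0 cd.
have [u uE] : exists u : {linear BX -> U}, u = @bof_val _ _ _ _ _ :> (BX -> U).
  by apply: linear_pack => a x y; rewrite bof_lin.
pose mk (x : BX) : BY := exist _ (bof_val x, 0) (mem_set (bof_valP x : [set q | X q.1] (bof_val x, 0))).
have mkE x : bof_val (mk x) = (bof_val x, 0) by [].
have [v vE] : exists v : {linear BX -> BY}, v = mk :> (BX -> BY).
  apply: linear_pack => a x y; apply: bof_inj; rewrite bof_lin !mkE bof_lin.
  by congr pair => /=; rewrite ?scaler0 ?mulr0 addr0.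
have iu : isometric_embedding u by move=> x; rewrite uE bof_norm.
have iv : isometric_embedding v.
  by move=> x; rewrite vE !bof_norm mkE dnorm_fst.
have rvE y : range v y <-> (bof_val y).2 = 0.
  split=> [[x _ <-]|y2]; first by rewrite vE.
  have [x xE] := @bof_mk _ _ _ _ (subspace_complete cX hX) _ (bof_valP y).
  exists x => //; rewrite vE; apply: bof_inj; rewrite mkE xE [RHS]surjective_pairing.
  by rewrite y2.
(* The small factor of the push-out: the closed span of the centres together with the new vector. *)
pose S : set BY := [set y | C (bof_val y).1].
have sT : is_subspace [set: BY].
  by apply/is_subspaceE; split; [exact: closedT|split].
have sS : is_subspace S.
  apply/is_subspaceE; split.
    rewrite closure_id; apply/seteqP; split; first exact: subset_closure.
    move=> y /closureNP Sy; rewrite /S /= /C ((closure_id _).1 (@cspan_closed _ _ _)).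
    apply/closureNP => e e0; have eK : 0 < e / K by apply: divr_gt0.
    have [y' Sy' yy'] := Sy _ eK; exists (bof_val y').1; first exact: Sy'.
    have [+ _] := Kle (bof_val (y - y')); rewrite bofB => /le_lt_trans; apply.
    by move: yy'; rewrite bof_norm bofB ltr_pdivlMr // mulrC.
  split; first by rewrite /S /=; exact: (cspan_subsp _).1.
  by move=> a x y Sx Sy; rewrite /S /mkset bof_lin; apply: (cspan_subsp _).2.
have srv : is_subspace (range v).
  apply/is_subspaceE; split.
    rewrite closure_id; apply/seteqP; split; first exact: subset_closure.
    move=> y /closureNP Sy; apply/rvE/eqP; rewrite -normr_le0; apply/ler_addgt0Pr => e e0.
    have ec : 0 < c * e by apply: mulr_gt0.
    have [y' /rvE Sy' yy'] := Sy _ ec; have := dnorm_snd M0 cd (bof_val (y - y')).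
    rewrite bofB /= Sy' subr0 add0r => h; rewrite -(ler_pM2l c0).
    by apply: le_trans h _; move: yy'; rewrite bof_norm bofB => /ltW.
  split; first by apply/rvE; rewrite bof0.
  by move=> a x y /rvE x2 /rvE y2; apply/rvE; rewrite bof_lin /= x2 y2 ?scaler0 ?mulr0 addr0.
have mem (y1 : U) (t : R) : X y1 -> exists y : BY, bof_val y = (y1, t).
  by move=> Xy; apply: bof_mk.
have [w iw wE] : exists2 w : {linear BY -> U}, isometric_embedding w & w \o v = u.
  apply: ext => //; first (split=> //; exists S).
  - apply: Ind_pushout => //.
      apply/seteqP; split=> // y _; apply: subset_closure.
      have [s sE] := mem 0 (bof_val y).2 hX.1.
      have [x xE] := @bof_mk _ _ _ _ (subspace_complete cX hX) _ (bof_valP y).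
      exists s; first by rewrite /S /mkset sE; exact: (cspan_subsp _).1.
      exists (v x); first by exists x.
      apply: bof_inj; rewrite bofD sE vE mkE xE [RHS]surjective_pairing.
      by congr pair; rewrite /= ?add0r ?addr0.
    move=> s x Ss /rvE x2 e e0.
    have [p [d [Mp pd]]] := dnorm_adherent cM M0 (bof_val (s - x)) e0.
    have Cp : C p by apply: lspan_cspan; exact: conv_lspan Mp.
    (* A combination p nearly attaining the norm of s - x yields the interpolating vector: s with
       its multiple t e of the new vector replaced by t p. *)
    pose t := (bof_val s).2.
    have Cr : C ((bof_val s).1 + t *: p).
      by apply: (subspD (cspan_subsp _)) => //; exact: (subspZ _ (cspan_subsp _)).
    have [r rE] := mem _ 0 (CX _ Cr).
    exists r; split; [by rewrite /S /mkset rE|by apply/rvE; rewrite rE|].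
    have xE : bof_val x = ((bof_val x).1, 0) by rewrite [LHS]surjective_pairing x2.
    rewrite 3!bof_norm; apply: le_lt_trans pd; rewrite !bofB rE xE; move: (bof_val x).1 => x1 /=.
    have -> : bof_val s - ((bof_val s).1 + t *: p, 0) = (- (t *: p), t).
      by rewrite [bof_val s]surjective_pairing; congr pair; rewrite /= ?subr0 // opprD addrA subrr add0r.
    have -> : ((bof_val s).1 + t *: p, 0 : R) - (x1, 0 : R) = ((bof_val s).1 - x1 + t *: p, 0 : R).
      by rewrite [LHS]surjective_pairing; congr pair; rewrite /= ?subr0 // addrAC.
    rewrite dnorm_fst // subr0 -/t lerD2r.
    have := dnorm_le cM (- (t *: p), t) Mp.
    by rewrite /= addNr normr0 addr0.
  - apply/dens_ltP.
    pose D : set BY := [set y | (qspan (fst @` M) `*` range (ratr : rat -> R)) (bof_val y)].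
    exists D; split=> //.
    + by move=> y [/= qy _]; apply: lspan_cspan; exact: qspan_lspan.
    + move=> y Sy; apply/closureNP => e e0; have e2 : 0 < e / 2 by lra.
      have e2K : 0 < e / 2 / K by apply: divr_gt0.
      have : closure (qspan (fst @` M)) (bof_val y).1 by rewrite cspan_qspan.
      move=> /closureNP/(_ _ e2)[y1 qy1 yy1].
      pose b := (bof_val y).2.
      have [q] := @rat_in_itvoo R (b - e / 2 / K) (b + e / 2 / K) ltac:(lra).
      rewrite in_itv /= => /andP[q1 q2].
      have Xy1 : X y1 by apply: CX; apply: lspan_cspan; exact: qspan_lspan.
      have [y' y'E] := mem y1 (ratr q) Xy1.
      exists y'; first by rewrite /D /mkset y'E; split=> //; exists q.
      rewrite bof_norm bofB y'E; have [_ +] := Kle (bof_val y - (y1, ratr q)).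
      move=> /le_lt_trans; apply; rewrite /= -/b.
      have : K * `|b - ratr q| <= K * (e / 2 / K).
        by apply: ler_wpM2l; [exact: ltW|rewrite ler_norml; lra].
      by rewrite [K * (e / 2 / K)]mulrC divfK ?gt_eqF //; lra.
    + apply: (small_le smP (B := qspan (fst @` M) `*` range (ratr : rat -> R))).
        by apply: (@card_le_inj _ _ _ _ (@bof_val _ _ _ _ PY)) => // ? ? _ _; exact: bof_inj.
      apply: (small_X smP).
        by apply: (small_qspan smP); exact: (small_image smP).
      by apply: (small_image smP); apply: (small_countable smP); exact: countableP.
  - apply/dens_ltP; pose Q := qspan (X0 `|` fst @` M).
    exists [set x | Q (bof_val x)]; split=> //.
      move=> x _; apply/closureNP => e e0.
      have : closure Q (bof_val x) by rewrite cspan_qspan; exact: bof_valP.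
      move=> /closureNP/(_ _ e0)[y Qy xy].
      have [y' y'E] := @bof_mk _ _ _ _ (subspace_complete cX hX) y
        (lspan_cspan (qspan_lspan Qy)).
      by exists y'; rewrite ?bof_norm ?bofB /= y'E.
    apply: (small_le kcP (B := Q)).
      by apply: (@card_le_inj _ _ _ _ (@bof_val _ _ _ _ (subspace_complete cX hX))) => // ? ? _ _; exact: bof_inj.
    apply: (small_qspan kcP); apply: (smallU kcP) => //.
    by apply: smkc; exact: (small_image smP).
have [e eE] := mem 0 1 hX.1.
have wx x : X x -> `|w e - x| = dnorm M (- x, 1).
  move=> Xx; have [x' x'E] := @bof_mk _ _ _ _ (subspace_complete cX hX) x Xx.
  have xw : w (v x') = x by rewrite -[LHS]/((w \o v) x') wE uE.
  rewrite -[X in _ - X]xw -linearB iw bof_norm bofB eE vE mkE x'E; congr (dnorm M _).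
  by rewrite [LHS]surjective_pairing; congr pair; rewrite /= ?subr0 ?sub0r ?add0r.
exists (w e); split=> [p d Mp|x Xx e' e0].
  rewrite wx; last by apply: cspan_sub; right; exists (p, d).
  have := dnorm_le cM (- p, 1) (conv_in Mp).
  by rewrite /= normr1 mul1r scale1r addNr normr0 addr0.
have [p [d [Mp pd]]] := dnorm_adherent cM M0 (- x, 1) e0.
exists p, d; split=> //; rewrite wx //.
by move: pd; rewrite /= normr1 mul1r scale1r [- x + p]addrC.
Qed.

End Realizing.

(** * Singular cardinals *)

Definition le_class (K : Type) : card_class := fun T A => A #<= [set: K].

Section Singular.
Context {R : realType} {U : completeNormedModType R}.
Implicit Types (M P Q : set (U * R)) (X : set U).

(* The infimum of [d + |p - x|] over [conv P] is the same for [P'], for every [x] in [X]. *)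
Definition extends X P P' := P `<=` P' /\ forall x, X x -> forall p d, conv P' p d ->
  forall e : R, 0 < e -> exists p' d', conv P p' d' /\ d' + `|p' - x| < d + `|p - x| + e.

Lemma extends_refl X P : extends X P P.
Proof. by split=> // x _ p d Pp e e0; exists p, d; split=> //; rewrite ltrDl. Qed.

Lemma extends_trans X P P' P'' : extends X P P' -> extends X P' P'' -> extends X P P''.
Proof.
move=> [s h] [s' h']; split; first exact: subset_trans s'.
move=> x Xx p d Pp e e0; have e2 : 0 < e / 2 by lra.
have [p' [d' [Pp' pd']]] := h' x Xx p d Pp _ e2.
have [p2 [d2 [Pp2 pd2]]] := h x Xx p' d' Pp' _ e2.
by exists p2, d2; split=> //; lra.
Qed.

Lemma extends_le X X' P P' : X' `<=` X -> extends X P P' -> extends X' P P'.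
Proof. by move=> XX [s h]; split=> // x /XX; exact: h. Qed.

Lemma conv_setU1 P z c p d : P !=set0 -> conv (P `|` [set (z, c)]) p d ->
  exists t q e, [/\ 0 <= t, t <= 1, conv P q e,
    p = t *: q + (1 - t) *: z & d = t * e + (1 - t) * c].
Proof.
move=> [[q0 e0] Pq0]; elim=> [{}p {}d [Pp|[-> ->]]|s {}p p' {}d d' s0 s1 _ [t [q [e [t0 t1 Pq -> ->]]]]
    _ [t' [q' [e' [t0' t1' Pq' -> ->]]]]].
- exists 1, p, d; rewrite subrr scale1r scale0r mul1r mul0r !addr0; split=> //.
  exact: conv_in.
- exists 0, q0, e0; rewrite subr0 scale1r scale0r mul1r mul0r !add0r; split=> //.
  exact: conv_in.
(* The total weight carried by [P]. When it vanishes it cannot be divided by, and any pair of [P]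
   serves. *)
have [st0|st0] := eqVneq (s * t + (1 - s) * t') 0.
  have st : s * t = 0 by nra.
  have st' : (1 - s) * t' = 0 by nra.
  have a : s * (1 - t) = s by rewrite mulrBr mulr1 st subr0.
  have b : (1 - s) * (1 - t') = 1 - s by rewrite mulrBr mulr1 st' subr0.
  exists 0, q, e; split=> //.
    by rewrite scale0r subr0 scale1r add0r !scalerDr !scalerA st st' !scale0r !add0r a b mix_same.
  rewrite mul0r subr0 mul1r add0r !mulrDr [s * (t * _)]mulrA [s * (_ * c)]mulrA.
  rewrite [(1 - s) * (t' * _)]mulrA [(1 - s) * (_ * c)]mulrA st st' a b; lra.
pose r := s * t + (1 - s) * t'; pose l := s * t / r.
have r0 : 0 < r by rewrite lt_neqAle eq_sym st0 /= /r; nra.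
have rl : r * l = s * t by rewrite mulrC divfK.
have rl' : r * (1 - l) = (1 - s) * t' by rewrite mulrBr rl mulr1 /r; lra.
have l0 : 0 <= l by rewrite -(pmulr_rge0 _ r0) rl; apply: mulr_ge0.
have l1 : l <= 1 by rewrite -subr_ge0 -(pmulr_rge0 _ r0) rl'; apply: mulr_ge0 => //; lra.
clearbody l.
exists r, (l *: q + (1 - l) *: q'), (l * e + (1 - l) * e'); split.
- exact: ltW.
- by rewrite /r; nra.
- exact: conv_mix.
- rewrite !scalerDr !scalerA rl rl' addrACA -scalerDl; congr (_ + _ *: _).
  by rewrite /r; lra.
- rewrite !mulrDr [r * (l * e)]mulrA [r * (_ * e')]mulrA rl rl' /r; lra.
Qed.

(** Seen from x, the point t q + (1 - t) z is at distance (1 - t) |z - w|, where w = (x - t q) / (1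
    - t) lies in [X]. So it suffices to replace z by a combination that is nearly as good when seen
    from w. *)
Lemma extends_adjoin X P z c : subsp X -> P !=set0 -> fst @` P `<=` X ->
  (forall w, X w -> forall e : R, 0 < e ->
    exists p d, conv P p d /\ d + `|p - w| < `|z - w| + c + e) ->
  extends X P (P `|` [set (z, c)]).
Proof.
move=> hX P0 PX H; split; first exact: subsetUl.
move=> x Xx _ _ /(conv_setU1 P0)[t [q [e' [t0 t1 Pq -> ->]]]] e e0.
have [t1'|t1'] := eqVneq t 1.
  exists q, e'; split=> //.
  by rewrite t1' subrr scale1r scale0r mul1r mul0r !addr0 ltrDl.
pose w := (1 - t)^-1 *: (x - t *: q).
have t1n : 0 < 1 - t by rewrite subr_gt0 lt_neqAle t1'.
have Xw : X w.
  apply: subspZ => //; apply: subspB => //; apply: subspZ => //.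
  by have := conv_lspan Pq; apply: lspan_le.
have wE : (1 - t) *: w = x - t *: q by rewrite scalerA divff ?gt_eqF // scale1r.
have [p [d [Pp pd]]] := H w Xw e e0.
have dist y : `|t *: q + (1 - t) *: y - x| = (1 - t) * `|y - w|.
  rewrite -[X in X * _](ger0_norm (ltW t1n)) -normrZ scalerBr wE opprB addrA.
  by congr `|_ - _|; rewrite addrC.
exists (t *: q + (1 - t) *: p), (t * e' + (1 - t) * d); split; first exact: conv_mix.
rewrite !dist; have : (1 - t) * (d + `|p - w|) < (1 - t) * (`|z - w| + c + e).
  by rewrite ltr_pM2l.
by have : (1 - t) * e <= e; nra.
Qed.

Variables (kappa tau : Type).
Hypothesis ctau : ~ countable [set: tau].
Hypothesis tau_kappa : [set: tau] #< [set: kappa].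
Hypothesis real : realizing (U := U) (lt_class tau) (lt_class kappa).

Let tau_le := card_lt_le tau_kappa.
Let smP := lt_class_small ctau.
Let tau_inf : infinite_set [set: tau].
Proof. by move=> /finite_set_countable. Qed.
Let lP := le_class_small tau_inf.
Let kcP := lt_class_small (uncountable_kappa ctau tau_le).
Let lkc T (A : set T) : le_class tau A -> lt_class kappa A.
Proof. by move=> h; exact: card_le_lt_trans tau_kappa. Qed.
Let sml T (A : set T) : lt_class tau A -> le_class tau A.
Proof. exact: card_lt_le. Qed.

(* The new constraint [(z, 2 * d0 / 2 ^ m)] says that [z] approximates a realization of [P];
   exactness on the small part [Q] is what makes the induction on [m] work. *)
Let approx m := forall X P p0 d0 Q, lt_class kappa X -> le_class tau P -> consistent P ->
  P (p0, d0) -> Q `<=` P -> lt_class tau Q -> exists P' z,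
  [/\ le_class tau P', consistent P', extends (cspan (X `|` fst @` P)) P P',
      P' (z, 2 * d0 * 2^-1 ^+ m) & forall q d, Q (q, d) -> `|z - q| <= d].

Let consistentU1 P z c : consistent P -> 0 <= c -> (forall p d, P (p, d) -> `|z - p| <= d + c) ->
  consistent (P `|` [set (z, c)]).
Proof.
move=> cP c0 Pz p d q e [Pp|[-> ->]] [Pq|[-> ->]]; first exact: cP.
- by rewrite distrC; exact: Pz.
- by rewrite (addrC c); exact: Pz.
- by rewrite subrr normr0; lra.
Qed.

Let le_class1 P z : le_class tau P -> le_class tau (P `|` [set z]).
Proof. by move=> lPP; apply: (smallU lP) => //; exact: (small1 lP). Qed.

Lemma approx0 : approx 0.
Proof.
move=> X P p0 d0 Q kX lPP cP Pp0 QP sQ; rewrite expr0 mulr1.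
pose M := Q `|` [set (p0, d0)].
have MP : M `<=` P by move=> q [/QP|->].
have d0_ge0 := conv_ge0 cP (conv_in Pp0).
have [z [z1 z2]] : exists z, realizes M (cspan ((X `|` fst @` P) `|` fst @` M)) z.
  apply: real; last by move=> p d q e /MP Pp /MP Pq; exact: cP.
  - apply: (smallU kcP) => //; apply: lkc; exact: (small_image lP).
  - by apply: (smallU smP) => //; exact: (small1 smP).
  - by exists (p0, d0); right.
(* The radius 2 d0 comes from passing through [p0]: |z - p| <= |z - p0| + |p0 - p| <= d0 + (d0 +
   d). *)
exists (P `|` [set (z, 2 * d0)]), z; split.
- exact: le_class1.
- apply: consistentU1 => //; first by lra.
  move=> p d Pp; have := z1 _ _ (or_intror erefl : M (p0, d0)).
  have := cP _ _ _ _ Pp0 Pp; have := ler_distD p0 z p; lra.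
- apply: extends_adjoin; first exact: cspan_subsp.
  + by exists (p0, d0).
  + by move=> x Px; apply: cspan_sub; right.
  + move=> w Xw e e0; have [|p [d [Mp pd]]] := z2 w _ e e0.
      by apply: cspanS Xw => ? ?; left.
    by exists p, d; split; [exact: conv_sub Mp|lra].
- by right.
- by move=> q d Qq; apply: z1; left.
Qed.

Hypothesis nreg : ~ regular_class (lt_class tau).

(* [tau] is the union of fewer than [tau] smaller sets, so [P] is exhausted by fewer than [tau]
   small parts. Approximations that are exact on these parts (and on the earlier
   approximations) are within [eps] of each other; they form a small consistent set of
   constraints of radius [eps / 2], whose realization is the better approximation. *)
Lemma approxS m : approx m -> approx m.+1.
Proof.
move=> IH X P p0 d0 Q kX lPP cP Pp0 QP sQ.
have d0_ge0 := conv_ge0 cP (conv_in Pp0).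
pose eps := 2 * d0 * 2^-1 ^+ m; pose del := 2 * d0 * 2^-1 ^+ m.+1.
have epsE : eps = del + del by rewrite /eps /del exprS; lra.
have del0 : 0 <= del by apply: mulr_ge0; [lra|apply: exprn_ge0; lra].
have [J [le [D [N [wo sD Nm sN KN]]]]] := not_regular_decomposition ctau nreg.
(* [D] has no last element: the part of a last index would contain all the others, and the union
   would be small. *)
have Dup i l : D i -> D l -> exists j, [/\ D j, strict le i j & le l j].
  move=> Di Dl; apply: contrapT => nj.
  pose k := if pselect (le i l) is left _ then l else i.
  have [Dk [ik lk]] : D k /\ le i k /\ le l k.
    rewrite /k; case: pselect => il; first by split=> //; split=> //; exact: (wo_refl wo).
    split=> //; split; first exact: (wo_refl wo).
    by have [] := (not_le wo _ _).1 il.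
  have : (\bigcup_(j in D) N j) #< [set: tau].
    apply: card_le_lt_trans (sN k Dk); apply: subset_card_le => x [j Dj Nx].
    have [jk|kj] := wo_cases wo j k; first exact: Nm Dk jk Dj _ Nx.
    exfalso; apply: nj; exists j; split=> //; first exact: (le_strict_trans wo) kj.
    exact: (wo_trans wo) lk (strict_le kj).
  by move=> /card_ltNle; exact.
have [j0 Dj0] : D !=set0.
  apply/set0P/eqP => DE; move: KN; rewrite DE bigcup_set0 card_le0 => /eqP K0.
  by apply: tau_inf; rewrite K0.
pose W := \bigcup_(j in D) N j.
have enumP (A : set (U * R)) : exists f : tau -> U * R, le_class tau A -> A (p0, d0) ->
    A `<=` f @` W /\ forall k, A (f k).
  have [lA|] := pselect (le_class tau A); last by exists (fun=> (p0, d0)).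
  have [Ap|] := pselect (A (p0, d0)); last by exists (fun=> (p0, d0)).
  by have [f ?] := card_le_onto (card_le_trans lA KN) (ex_intro _ _ Ap); exists f.
have {enumP}[phi phiP] := choice enumP.
(* Stage [j] works over [SS], all constraints gathered so far, and its approximation must be exact
   on the small set [QQ]: on [Q], on the [j]-th parts of [P] and of every earlier stage, and on the
   earlier approximations taken with radius [eps]. *)
pose SS (j : J) (prev : J -> set (U * R) * U) : set (U * R) :=
  P `|` \bigcup_(i in [set i | D i /\ strict le i j]) (prev i).1.
pose QQ (j : J) (prev : J -> set (U * R) * U) : set (U * R) :=
  Q `|` phi P @` N j `|` \bigcup_(i in [set i | D i /\ strict le i j])
    (phi (prev i).1 @` N j `|` [set ((prev i).2, eps)]).
pose good (S Q' : set (U * R)) (Pz : set (U * R) * U) :=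
  [/\ le_class tau Pz.1, consistent Pz.1, extends (cspan (X `|` fst @` S)) S Pz.1,
      Pz.1 (Pz.2, eps) & forall q d, Q' (q, d) -> `|Pz.2 - q| <= d].
have stepP (SQ : set (U * R) * set (U * R)) : exists Pz, le_class tau SQ.1 -> consistent SQ.1 ->
    SQ.1 (p0, d0) -> SQ.2 `<=` SQ.1 -> lt_class tau SQ.2 -> good SQ.1 SQ.2 Pz.
  have [lS|] := pselect (le_class tau SQ.1); last by exists (set0, 0).
  have [cS|] := pselect (consistent SQ.1); last by exists (set0, 0).
  have [Sp|] := pselect (SQ.1 (p0, d0)); last by exists (set0, 0).
  have [QS|] := pselect (SQ.2 `<=` SQ.1); last by exists (set0, 0).
  have [sQ'|] := pselect (lt_class tau SQ.2); last by exists (set0, 0).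
  by have [P' [z ?]] := IH X SQ.1 p0 d0 SQ.2 kX lS cS Sp QS sQ'; exists (P', z).
have {stepP}[step stepP] := choice stepP.
have [s sE] := wo_rec wo (set0 : set (U * R), 0 : U) (fun j prev => step (SS j prev, QQ j prev)).
have prevE j (prev := fun i => if pselect (strict le i j) then s i else (set0, 0)) :
    SS j prev = SS j s /\ QQ j prev = QQ j s.
  have h i : strict le i j -> prev i = s i by rewrite /prev; case: pselect.
  by split; congr (_ `|` _); apply: eq_bigcupr => i [_ /h] ->.
have {}sE j : s j = step (SS j s, QQ j s).
  by rewrite {1}sE; have [-> ->] := prevE j.
have sgood j : D j -> good (SS j s) (QQ j s) (s j).
  elim/(wo_ind wo) : j => j IHj Dj.
  have IHi i : D i -> strict le i j -> good (SS i s) (QQ i s) (s i) by move=> Di ij; exact: IHj.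
  have PS i : SS i s (p0, d0) by left.
  have Pi i : D i -> strict le i j -> P `<=` (s i).1.
    by move=> Di ij p Pp; have [_ _ [h _] _ _] := IHi i Di ij; apply: h; left.
  have mono i i' : D i -> D i' -> strict le i i' -> strict le i' j -> (s i).1 `<=` (s i').1.
    move=> Di Di' ii ij p Sp; have [_ _ [h _] _ _] := IHi i' Di' ij; apply: h.
    by right; exists i.
  have lS : le_class tau (SS j s).
    apply: (smallU lP) => //; apply: (le_class_regular tau_inf).
      by apply: sml; apply: card_le_lt_trans sD; apply: subset_card_le => i [].
    by move=> i [Di ij]; have [] := IHi i Di ij.
  rewrite sE; apply: stepP => //=.
  - move=> p d q e [Pp|[i [Di ij] Sp]] [Pq|[i' [Di' ij'] Sq]]; first exact: cP.
    + by have [_ c _ _ _] := IHi i' Di' ij'; apply: c Sq; exact: Pi.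
    + by have [_ c _ _ _] := IHi i Di ij; apply: c Sp _; exact: Pi.
    + have [e'|ne] := pselect (i = i').
        by have [_ c _ _ _] := IHi i Di ij; apply: c Sp _; rewrite e'.
      have [ii|[ii _]] := wo_cases wo i i'.
        have [_ c _ _ _] := IHi i' Di' ij'; apply: c Sq.
        by apply: (mono i i') Sp.
      have [_ c _ _ _] := IHi i Di ij; apply: c Sp _.
      by apply: (mono i' i) Sq => //; split=> // e'; apply: ne.
  - move=> p [[/QP Pp|[k _ <-]]|[i [Di ij] [[k _ <-]|->]]]; first by left.
    + by left; have [_] := phiP P lPP Pp0.
    + have [l _ _ _ _] := IHi i Di ij.
      by right; exists i => //; have [_] := phiP _ l (Pi i Di ij _ Pp0).
    + by right; exists i => //; have [_ _ _ h _] := IHi i Di ij.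
  - apply: (smallU smP).
      by apply: (smallU smP) => //; apply: (small_image smP); exact: sN.
    (* A union of small sets need not be small here. But with [j] fixed all the pieces are images of
       the same [N j], so their union is an image of a product; [None] codes the approximation
       itself. *)
    apply: (small_sub smP (B := (fun ik : J * option tau =>
        if ik.2 is Some k then phi (s ik.1).1 k else ((s ik.1).2, eps)) @`
        (D `*` (some @` N j `|` [set None])))).
      move=> p [i [Di ij] [[k Nk <-]|->]]; first by exists (i, Some k) => //; split=> //; left; exists k.
      by exists (i, None) => //; split=> //; right.
    apply: (small_image smP); apply: (small_X smP) => //.
    by apply: (smallU smP); [apply: (small_image smP); exact: sN|exact: (small1 smP)].
pose PT := P `|` \bigcup_(j in D) (s j).1.
have Psub j : D j -> P `<=` (s j).1.
  by move=> Dj p Pp; have [_ _ [h _] _ _] := sgood j Dj; apply: h; left.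
have mono i j : D i -> D j -> le i j -> (s i).1 `<=` (s j).1.
  move=> Di Dj ij; have [->|ne] := pselect (i = j); first exact: subset_refl.
  by move=> p Sp; have [_ _ [h _] _ _] := sgood j Dj; apply: h; right; exists i.
have PTE : PT = \bigcup_(j in D) (s j).1.
  by apply/seteqP; split=> [p [Pp|//]|p]; [exists j0 => //; exact: Psub Pp|right].
have dir i j : D i -> D j -> exists k, [/\ D k, (s i).1 `<=` (s k).1 & (s j).1 `<=` (s k).1].
  move=> Di Dj; have [ij|[ji _]] := wo_cases wo i j; [exists j|exists i]; split=> //; exact: mono.
have cPT : consistent PT.
  rewrite PTE => p d q e [i Di Sp] [j Dj Sq]; have [k [Dk ik jk]] := dir i j Di Dj.
  by have [_ c _ _ _] := sgood k Dk; apply: c; [exact: ik|exact: jk].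
have lPT : le_class tau PT.
  apply: (smallU lP) => //; apply: (le_class_regular tau_inf); first exact: sml.
  by move=> j /sgood[].
have extj j : D j -> extends (cspan (X `|` fst @` P)) P (s j).1.
  elim/(wo_ind wo) : j => j IHj Dj; have [_ _ h _ _] := sgood j Dj.
  apply: (extends_trans (P' := SS j s)); last first.
    by apply: extends_le h; apply: cspanS; apply: setUS; apply: image_subset; exact: subsetUl.
  split; first exact: subsetUl.
  move=> x Xx p d Sp e e0.
  have [[i0 [Di0 i0j]]|ni] := pselect (exists i, D i /\ strict le i j); last first.
    exists p, d; split; last by rewrite ltrDl.
    apply: conv_sub Sp => q [//|[i [Di ij] _]]; exfalso; apply: ni; by exists i.
  have Sp' : conv (\bigcup_(i in [set i | D i /\ strict le i j]) (s i).1) p d.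
    by apply: conv_sub Sp => q [Pq|//]; exists i0 => //; exact: Psub Pq.
  have dir' i i' : [set i | D i /\ strict le i j] i -> [set i | D i /\ strict le i j] i' ->
      exists k, [/\ [set i | D i /\ strict le i j] k, (s i).1 `<=` (s k).1 & (s i').1 `<=` (s k).1].
    move=> [Di ij] [Di' ij']; have [ii|[ii _]] := wo_cases wo i i'; [exists i'|exists i];
      split=> //; exact: mono.
  have [i [Di ij] Si] := conv_bigcup dir' Sp'.
  by have [_ hi] := IHj i ij Di; exact: hi Si e e0.
have extT : extends (cspan (X `|` fst @` P)) P PT.
  split; first exact: subsetUl.
  move=> x Xx p d; rewrite PTE => /(conv_bigcup dir)[j Dj Sp] e e0.
  by have [_ hj] := extj j Dj; exact: hj Sp e e0.
have zP j : D j -> (s j).1 ((s j).2, eps) by move=> /sgood[].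
have zQ j q d : D j -> QQ j s (q, d) -> `|(s j).2 - q| <= d by move=> /sgood[_ _ _ _]; exact.
(* Approximations at distance at most [eps] from each other admit balls of half that radius around
   them as consistent data. A realization of these balls is within [del] of every approximation. *)
pose M := (fun j => ((s j).2, del)) @` D `|` Q.
have MU : forall p d, conv M p d -> exists2 d', conv PT p d' & d' <= d + del.
  move=> p d; elim=> [{}p {}d [[j Dj [<- <-]]|Qp]|t {}p q {}d e t0 t1 _ [d' Pp dd] _ [e' Pq ee]].
  - by exists eps; [apply: conv_in; right; exists j => //; exact: zP|rewrite epsE].
  - by exists d; [apply: conv_in; left; exact: QP|lra].
  - exists (t * d' + (1 - t) * e'); first exact: conv_mix.
    nra.
have [z [z1 z2]] : exists z, realizes M (cspan ((X `|` fst @` PT) `|` fst @` M)) z.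
  apply: real.
  - apply: (smallU kcP) => //; apply: lkc; exact: (small_image lP).
  - by apply: (smallU smP) => //; exact: (small_image smP).
  - by exists ((s j0).2, del); left; exists j0.
  - have zz i j : D i -> D j -> le i j -> `|(s j).2 - (s i).2| <= del + del.
      move=> Di Dj ij; rewrite -epsE; have [->|ne] := pselect (i = j).
        by rewrite subrr normr0 epsE; lra.
      by apply: zQ => //; right; exists i => //; right.
    move=> p d q e [[i Di [<- <-]]|Qp] [[j Dj [<- <-]]|Qq].
    + by have [ij|[ji _]] := wo_cases wo i j; [rewrite distrC|]; exact: zz.
    + by have := zQ i q e Di (or_introl (or_introl Qq)); lra.
    + by have := zQ j p d Dj (or_introl (or_introl Qp)); rewrite distrC; lra.
    + by apply: cP; exact: QP.
(* Each constraint of [PT] is met exactly by the approximation of some later stage, and [z] is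
   within [del] of that approximation. *)
have zPT p d : PT (p, d) -> `|z - p| <= d + del.
  move=> PTp; have [j [Dj Qp]] : exists j, D j /\ QQ j s (p, d).
    case: PTp => [Pp|[i Di Sp]].
      have [/(_ _ Pp)[k [j Dj Nk] kp] _] := phiP P lPP Pp0.
      by exists j; split=> //; left; right; exists k.
    have [l _ _ _ _] := sgood i Di.
    have [/(_ _ Sp)[k [l' Dl' Nk] kp] _] := phiP _ l (Psub i Di _ Pp0).
    have [j [Dj ij lj]] := Dup i l' Di Dl'; exists j; split=> //.
    by right; exists i => //; left; exists k => //; exact: Nm Dj lj Dl' _ Nk.
  have := zQ j p d Dj Qp; have : `|z - (s j).2| <= del by apply: z1; left; exists j.
  have := ler_distD (s j).2 z p; lra.
exists (PT `|` [set (z, del)]), z; split.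
- exact: le_class1.
- exact: consistentU1.
- apply: extends_trans extT _.
  apply: (extends_le (X := cspan (X `|` fst @` PT))).
    by apply: cspanS; apply: setUS; apply: image_subset; exact: subsetUl.
  apply: extends_adjoin; first exact: cspan_subsp.
  + by exists (p0, d0); left.
  + by move=> x Px; apply: cspan_sub; right.
  + move=> w Xw e e0; have [|p [d [Mp pd]]] := z2 w _ e e0.
      by apply: cspanS Xw => ? ?; left.
    by have [d' Pp dd] := MU p d Mp; exists p, d'; split=> //; lra.
- by right.
- by move=> q d Qq; apply: z1; right.
Qed.

Lemma approxP m : approx m.
Proof. by elim: m => [|m /approxS //]; exact: approx0. Qed.

(** Apply [approxP] for m = 0, 1, 2, ..., feeding each enlarged set to the next step. The pairs
    (z_m, eps_m) end up in common consistent sets, so the z_m converge; since the enlargements leave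
    the infima over the base unchanged, the limit realizes [M]. *)
Lemma singular_realizing : realizing (U := U) (le_class tau) (lt_class kappa).
Proof.
move=> X M kX lM [[p0 d0] Mp0] cM; have d0_ge0 := conv_ge0 cM (conv_in Mp0).
pose eps (m : nat) := 2 * d0 * 2^-1 ^+ m.
have eps0 m : 0 <= eps m by apply: mulr_ge0; [lra|apply: exprn_ge0; lra].
pose good m P (Pz : set (U * R) * U) := [/\ le_class tau Pz.1, consistent Pz.1,
  extends (cspan (X `|` fst @` P)) P Pz.1 & Pz.1 (Pz.2, eps m)].
have stepP (mP : nat * set (U * R)) : exists Pz, le_class tau mP.2 -> consistent mP.2 ->
    mP.2 (p0, d0) -> good mP.1 mP.2 Pz.
  have [lS|] := pselect (le_class tau mP.2); last by exists (set0, 0).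
  have [cS|] := pselect (consistent mP.2); last by exists (set0, 0).
  have [Sp|] := pselect (mP.2 (p0, d0)); last by exists (set0, 0).
  have [//||P' [z [? ? ? ? _]]] := @approxP mP.1 X mP.2 p0 d0 set0 kX lS cS Sp.
    exact: (small0 smP).
  by exists (P', z).
have {stepP}[step stepP] := choice stepP.
pose P_ := fix P_ (m : nat) := if m is k.+1 then (step (k, P_ k)).1 else M.
pose z_ m := (step (m, P_ m)).2.
have PP m : [/\ le_class tau (P_ m), consistent (P_ m) & P_ m (p0, d0)].
  elim: m => // m [lPm cPm Pm]; have [/= l c [h _] _] := stepP (m, P_ m) lPm cPm Pm.
  by split=> //; exact: h.
have gd m : good m (P_ m) (P_ m.+1, z_ m).
  by have [lPm cPm Pm] := PP m; exact: stepP (m, P_ m) lPm cPm Pm.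
have Pmono m n : (m <= n)%N -> P_ m `<=` P_ n.
  move=> /subnK <-; elim: (n - m)%N => [|k IH]; first exact: subset_refl.
  by have [_ _ [h _] _] := gd (k + m)%N; exact: subset_trans h.
have extM m : extends (cspan (X `|` fst @` M)) M (P_ m).
  elim: m => [|m IH]; first exact: extends_refl.
  have [_ _ h _] := gd m; apply: extends_trans IH _; apply: extends_le h.
  by apply: cspanS; apply: setUS; apply: image_subset; exact: (Pmono 0%N).
have zz m n : (m <= n)%N -> `|z_ m - z_ n| <= 2 * eps m.
  move=> mn; have [_ c _ zn] := gd n; have [_ _ _ zm] := gd m.
  have := c _ _ _ _ (Pmono _ _ (mn : (m.+1 <= n.+1)%N) _ zm) zn.
  have : eps n <= eps m by rewrite /eps; apply: ler_wpM2l; [lra|apply: ler_wiXn2l => //; lra].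
  by rewrite /=; lra.
have epsmall e : 0 < e -> exists n, 2 * eps n < e.
  move=> e0; have e1 : 0 < e / (4 * d0 + 1) by apply: divr_gt0 => //; lra.
  have [n ne] := half_pow_small e1; exists n; move: ne.
  rewrite ltr_pdivlMr; last by lra.
  have : 0 <= 2^-1 ^+ n :> R by apply: exprn_ge0; lra.
  by rewrite /eps; lra.
have [z zP] := fast_cauchy_lim zz epsmall.
exists z; split=> [p d Mp|x Xx e e0].
  apply/ler_addgt0Pr => e e0; have e3 : 0 < e / 2 by lra.
  have [n ne] := epsmall _ e3; have [_ c _ zn] := gd n.
  have := c _ _ _ _ zn (Pmono _ _ (leq0n n.+1) _ Mp) => /= h.
  have := zP n; have := ler_distD (z_ n) z p; rewrite (distrC z (z_ n)).
  by have := eps0 n; lra.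
have e3 : 0 < e / 3 by lra.
have [n ne] := epsmall _ e3; have [_ _ _ zn] := gd n.
have [_ h] := extM n.+1; have [p [d [Mp pd]]] := h x Xx _ _ (conv_in zn) _ e3.
exists p, d; split=> //; have := zP n; have := ler_distD z (z_ n) x.
by have := eps0 n; move: pd => /=; lra.
Qed.

End Singular.

(** * Skeletons of tightly filtered spaces *)

Section SkeletonDef.
Context {R : realType} {U : completeNormedModType R}.

(** Members are sets of generators rather than closed subspaces, so that plain unions of members are
    members. *)
Record skeleton (sm : card_class) (Fam : set (set U)) : Prop := Skeleton {
  skel_bigcup : forall F, F `<=` Fam -> Fam (\bigcup_(A in F) A);
  skel_Ind : forall A B, Fam A -> Fam B -> Ind (cspan A) (cspan B);
  skel_small : forall B, sm U B -> exists A, [/\ Fam A, sm U A & B `<=` cspan A] }.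

End SkeletonDef.

(** * Saturated index sets of a tower *)

Section Tower.
Context {R : realType} {U : completeNormedModType R} {I : Type} (le : rel I).
Variables (sm : card_class) (E D : I -> set U) (lambda : I).
Hypotheses (smP : small_class sm) (smR : regular_class sm).
Hypotheses (wo : wochoice.well_order le) (le_lambda : forall a, le a lambda).
Hypothesis Ecl : forall a, closed (E a) /\ subsp (E a).
Hypothesis Emono : forall a b, le a b -> E a `<=` E b.
Hypothesis Ezero : forall a, is_zero le a -> E a = [set 0].
Hypothesis ET : E lambda = [set: U].
Hypothesis Elimit : forall b, is_limit le b ->
  E b = closure (\bigcup_(a in [set a | strict le a b]) E a).
Hypothesis Dsm : forall a, sm (D a).
Hypothesis Dlambda : D lambda = set0.
Hypothesis Dsucc : forall a b, is_succ le a b ->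
  [/\ D a `<=` E b, Ind (cspan (D a)) (E a) & E b `<=` cspan (D a `|` E a)].

Let gen (G : set I) := \bigcup_(c in G) D c.
Let below (G : set I) (a : I) := [set c | G c /\ strict le c a].

Lemma strict_succ a b : strict le a b -> exists c, is_succ le a c /\ le c b.
Proof.
move=> ab; have [c ac cmin] := wo_least wo (A := [set c | strict le a c]) (ex_intro _ b ab).
by exists c; split; [split|exact: cmin].
Qed.

Lemma succ_le a b c : is_succ le a b -> strict le c b -> le c a.
Proof.
move=> [ab bmin] cb; have [//|ac] := wo_cases wo c a.
by case: ((not_le wo b c).2 cb); exact: bmin.
Qed.

Lemma Dsub a b : strict le a b -> D a `<=` E b.
Proof.
move=> /strict_succ[c [ac cb]]; have [+ _ _] := Dsucc ac.
by move=> /subset_trans; apply; exact: Emono.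
Qed.

Lemma DInd c : Ind (cspan (D c)) (E c).
Proof.
have [e|ne] := pselect (c = lambda).
  move=> t x; rewrite e Dlambda => t0 _ e' e0; exists 0.
  suff -> : t = 0 by rewrite ET; split; rewrite ?subr0 ?sub0r ?normr0 ?add0r ?normrN ?ltrDl //; exact: (cspan_subsp _).1.
  have z0 y : lspan (set0 : set U) y -> y = 0 by elim.
  apply/eqP; rewrite -normr_le0; apply/ler_addgt0Pr => d d0; rewrite add0r.
  by have [y /z0 ->] := cspan_approx d0 t0; rewrite subr0 => /ltW.
have [b [cb _]] := strict_succ (conj (le_lambda c) ne).
by have [] := Dsucc cb.
Qed.

Lemma E_gen a : E a `<=` cspan (gen [set c | strict le c a]).
Proof.
elim/(wo_ind wo) : a => a IH.
have [za|nz] := pselect (is_zero le a).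
  by rewrite Ezero // => _ ->; exact: (cspan_subsp _).1.
have [[b ba]|ns] := pselect (exists b, is_succ le b a).
  have [_ _ h] := Dsucc ba; apply: (subset_trans h); apply: cspan_mono => x [Dx|Ex].
    by apply: cspan_sub; exists b => //; exact: ba.1.
  apply: cspanS (IH b ba.1 x Ex) => y [c cb Dy]; exists c => //=.
  by apply: (strict_le_trans wo) cb _; exact: (strict_le ba.1).
rewrite Elimit; last by split=> // b ba; apply: ns; exists b.
have cl := @cspan_closed _ U (gen [set c | strict le c a]).
rewrite ((closure_id _).1 cl); apply: closure_subset => x [b /= ba Ex].
apply: cspanS (IH b ba x Ex) => y [c cb Dy]; exists c => //=.
by apply: (strict_le_trans wo) cb _; exact: (strict_le ba).
Qed.

(* The vectors of [D c] that already occur before stage [c] must be generated by earlier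
   elements of [G]. *)
Definition sat (G : set I) := forall c, G c -> cspan (D c) `&` E c `<=` cspan (gen (below G c)).

Lemma gen_below_E G c : cspan (gen (below G c)) `<=` E c.
Proof.
apply: cspan_le; [exact: (Ecl c).1|exact: (Ecl c).2|].
by move=> x [b [_ bc]]; exact: Dsub.
Qed.

(** Isolates the part of a combination carried by the largest index occurring in it, for the
    induction in [sat_Ind]. *)
Lemma lspan_top G y : lspan (gen G) y -> y = 0 \/
  exists c s x, [/\ G c, lspan (D c) s, lspan (gen (below G c)) x & y = s + x].
Proof.
elim=> [|a u v [c Gc Du] _ IH]; first by left.
right; have Ds : lspan (D c) (a *: u) by apply: lspanZ; exact: lspan_sub.
case: IH => [->|[c' [s [x [Gc' Ds' Gx ->]]]]].
  by exists c, (a *: u), 0; split=> //; exact: lspan0.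
have [e|ne] := pselect (c = c').
  exists c', (a *: u + s), x; rewrite addrA; split=> //.
  by apply: lspanD => //; rewrite -e.
have [cc'|[c'c _]] := wo_cases wo c c'.
  exists c', s, (a *: u + x); split=> //; last by rewrite addrCA.
  apply: lspanS => //; exists c => //; by split.
exists c, (a *: u), (s + x); split=> //; apply: lspanD.
  apply: lspanS_sub Ds' => z Dz; exists c' => //; split=> //; split=> // e; exact: ne.
apply: lspanS_sub Gx => z [b [Gb bc'] Dz]; exists b => //; split=> //.
exact: (strict_le_trans wo) bc' c'c.
Qed.

(* By induction on the largest index occurring in [x] or [y]: independence at that stage
   replaces one of them by vectors of lower stages, thanks to saturation. *)
Lemma sat_Ind G G' : sat G -> sat G' -> forall x y, cspan (gen G) x -> cspan (gen G') y ->
  forall e : R, 0 < e -> exists2 r, cspan (gen (G `&` G')) r &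
    `|x - r| + `|r - y| < `|x - y| + e.
Proof.
move=> sG sG'.
have key : forall b x y, cspan (gen (below G b)) x -> cspan (gen (below G' b)) y ->
  forall e : R, 0 < e -> exists2 r, cspan (gen (below (G `&` G') b)) r &
    `|x - r| + `|r - y| < `|x - y| + e; last first.
  move=> x y Gx Gy e e0.
  have red H : cspan (gen H) `<=` cspan (gen (below H lambda)).
    apply: cspanS => z [c Hc Dz]; exists c => //; split=> //; split=> // cl.
    by move: Dz; rewrite cl Dlambda.
  have [r rr rP] := key lambda x y (red _ _ Gx) (red _ _ Gy) e e0.
  by exists r => //; apply: cspanS rr => z [c [? _] Dz]; exists c.
elim/(wo_ind wo) => b IH x y Gx Gy e e0.
have e8 : 0 < e / 8 by lra.
have [x1 Gx1 xx1] := cspan_approx e8 Gx; have [y1 Gy1 yy1] := cspan_approx e8 Gy.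
suff [r Gr rP] : exists2 r, cspan (gen (below (G `&` G') b)) r &
    `|x1 - r| + `|r - y1| < `|x1 - y1| + e / 2.
  exists r => //.
  have := ler_distD x1 x r; have := ler_distD y1 r y; rewrite (distrC y1).
  have := ler_distD x x1 y1; have := ler_distD y x y1; rewrite (distrC x1 x); lra.
have e4 : 0 < e / 4 by lra.
have sub0 H : cspan (gen H) 0 := (cspan_subsp _).1.
have trans0 (u v : U) : u = 0 \/ v = 0 -> exists2 r, cspan (gen (below (G `&` G') b)) r &
    `|u - r| + `|r - v| < `|u - v| + e / 2.
  move=> uv; exists 0 => //; case: uv => ->; rewrite ?subr0 ?sub0r ?normr0 ?normrN ?add0r ?addr0;
    by rewrite ltrDl; lra.
have lift H c : strict le c b -> cspan (gen (below H c)) `<=` cspan (gen (below H b)).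
  move=> cb; apply: cspanS => z [d [Hd dc] Dz]; exists d => //; split=> //.
  exact: (strict_le_trans wo) dc (strict_le cb).
have low H c : cspan (gen (below (below H b) c)) `<=` cspan (gen (below H c)).
  by apply: cspanS => z [d [[Hd _] dc] Dz]; exists d.
have up H c d : H d -> strict le d c -> cspan (D d) `<=` cspan (gen (below H c)).
  by move=> Hd dc; apply: cspanS => z Dz; exists d.
case: (lspan_top Gx1) => [->|[c [s [x' [[Gc cb] Ds /lspan_cspan/low Gx' x1E]]]]].
  by apply: trans0; left.
case: (lspan_top Gy1) => [->|[c' [s' [y' [[Gc' cb'] Ds' /lspan_cspan/low Gy' y1E]]]]].
  by apply: trans0; right.
have {}Ds : cspan (D c) s by exact: lspan_cspan.
have {}Ds' : cspan (D c') s' by exact: lspan_cspan.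
(* Equal top indices: interpolate between s - s' in the span of [D c] and y' - x' in [E c].
   Saturation of [G] puts r + x' below stage [c], where the induction hypothesis separates it from
   y'; the vector sought is the result plus s'. *)
have [cc'|ncc'] := pselect (c = c').
  subst c'.
  have t1 : cspan (D c) (s - s') by apply: (subspB (cspan_subsp _)).
  have t2 : E c (y' - x').
    by apply: subspB; [exact: (Ecl c).2|exact: gen_below_E Gy'|exact: gen_below_E Gx'].
  have [r [Dr Er rP]] := DInd t1 t2 e4.
  have Gr : cspan (gen (below G c)) (r + x').
    by apply: (subspD (cspan_subsp _)) => //; exact: (sG c Gc r (conj Dr Er)).
  have [q Gq qP] := IH c cb (r + x') y' Gr Gy' _ e4.
  exists (q + s').
    apply: (subspD (cspan_subsp _)); first exact: lift Gq.
    exact: (up (G `&` G') b c).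
  have h1 : `|x1 - (q + s')| <= `|s - s' - r| + `|r + x' - q|.
    have -> : x1 - (q + s') = (s - s' - r) + (r + x' - q).
      by rewrite x1E -[r + x' - q]addrA subrKA addrA opprD addrA addrAC -!addrA; congr (s + _); rewrite addrCA addrC -addrA.
    exact: ler_normD.
  have h2 : q + s' - y1 = q - y' by rewrite y1E opprD addrA addrK.
  have h3 : s - s' - (y' - x') = x1 - y1.
    by rewrite x1E y1E opprB addrACA opprD.
  have h4 : r - (y' - x') = r + x' - y' by rewrite opprB addrA.
  by move: rP qP; rewrite h2 h3 h4; lra.
(* Different top indices: the vector with the lower one already lies in the stage of the higher one,
   so only the top part of the other vector is replaced. *)
have [cc|[c'c _]] := wo_cases wo c c'.
  have Gx2 : cspan (gen (below G c')) x1.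
    rewrite x1E; apply: (subspD (cspan_subsp _)); [exact: (up G c' c)|].
    by apply: cspanS Gx' => z [d [Hd dc] Dz]; exists d => //; split=> //; exact: (strict_le_trans wo) dc cc.
  have t2 : E c' (x1 - y').
    by apply: subspB; [exact: (Ecl c').2|exact: gen_below_E Gx2|exact: gen_below_E Gy'].
  have [r [Dr Er rP]] := DInd Ds' t2 e4.
  have Gr : cspan (gen (below G' c')) (r + y').
    by apply: (subspD (cspan_subsp _)) => //; exact: (sG' c' Gc' r (conj Dr Er)).
  have [q Gq qP] := IH c' cb' x1 (r + y') Gx2 Gr _ e4.
  exists q; first exact: lift Gq.
  have h1 : `|q - y1| <= `|q - (r + y')| + `|s' - r|.
    have -> : q - y1 = (q - (r + y')) - (s' - r).
      by rewrite y1E opprB [r + y']addrC [s' + y']addrC !opprD !addrA subrK.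
    exact: ler_normB.
  have h3 : `|s' - (x1 - y')| = `|x1 - y1|.
    by rewrite y1E [RHS]distrC opprB addrA.
  have h4 : `|r - (x1 - y')| = `|x1 - (r + y')|.
    by rewrite opprB addrA distrC.
  by move: rP qP; rewrite h3 h4; lra.
have c'c2 : strict le c' c by split=> // e'; apply: ncc'.
have Gy2 : cspan (gen (below G' c)) y1.
  rewrite y1E; apply: (subspD (cspan_subsp _)); [exact: (up G' c c')|].
  by apply: cspanS Gy' => z [d [Hd dc] Dz]; exists d => //; split=> //; exact: (strict_le_trans wo) dc c'c.
have t2 : E c (y1 - x').
  by apply: subspB; [exact: (Ecl c).2|exact: gen_below_E Gy2|exact: gen_below_E Gx'].
have [r [Dr Er rP]] := DInd Ds t2 e4.
have Gr : cspan (gen (below G c)) (r + x').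
  by apply: (subspD (cspan_subsp _)) => //; exact: (sG c Gc r (conj Dr Er)).
have [q Gq qP] := IH c cb (r + x') y1 Gr Gy2 _ e4.
exists q; first exact: lift Gq.
have h1 : `|x1 - q| <= `|s - r| + `|r + x' - q|.
  have -> : x1 - q = (s - r) + (r + x' - q).
    by rewrite x1E -[r + x' - q]addrA subrKA addrA.
  exact: ler_normD.
have h3 : s - (y1 - x') = x1 - y1 by rewrite x1E opprB addrA.
have h4 : r - (y1 - x') = r + x' - y1 by rewrite opprB addrA.
by move: rP qP; rewrite h3 h4; lra.
Qed.

(** A vector is the limit of a sequence of finite combinations. This countability is what lets a
    small set be closed to a small saturated one. *)
Lemma E_countable a u : E a u -> exists G, [/\ countable G, G `<=` [set c | strict le c a] &
  cspan (gen G) u].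
Proof.
move=> /E_gen/closureNP Eu.
have fin G y : lspan (gen G) y -> exists F, [/\ countable F, F `<=` G & lspan (gen F) y].
  elim=> [|b v w [c Gc Dv] _ [F [cF FG Fw]]].
    by exists set0; split=> //; exact: lspan0.
  exists (F `|` [set c]); split.
  - have -> : F `|` [set c] = \bigcup_(i in [set: bool]) (if i then F else [set c]).
      apply/seteqP; split=> x; first by case=> [Fx|->]; [exists true|exists false].
      by move=> [[] _ //=]; [left|right].
    by apply: bigcup_countable => // -[].
  - by move=> x [/FG|->].
  - apply: lspanS; first by exists c => //; right.
    by apply: lspanS_sub Fw => x [d Fd Dx]; exists d => //; left.
have p0 n : 0 < 2^-1 ^+ n :> R by apply: exprn_gt0; lra.
have FP n : exists F, [/\ countable F, F `<=` [set c | strict le c a] &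
    exists2 y, lspan (gen F) y & `|u - y| < 2^-1 ^+ n].
  have [y /fin[F [? ? ?]] uy] := Eu _ (p0 n); exists F; split=> //; by exists y.
have /choice[F {}FP] := FP.
exists (\bigcup_n F n); split.
- by apply: bigcup_countable => // n _; have [] := FP n.
- by move=> c [n _ Fc]; have [_ h _] := FP n; exact: h.
- apply/closureNP => e e0; have [n ne] := half_pow_small e0.
  have [_ _ [y Fy uy]] := FP n; exists y; last exact: lt_trans ne.
  by apply: lspanS_sub Fy => x [c Fc Dx]; exists c => //; exists n.
Qed.

(** Saturation is preserved by unions. To saturate a small set, attach to each [c] a small set [H c]
    of lower indices generating the intersection of [cspan (D c)] with [E c], and close under [H] in
    countably many rounds. *)
Lemma tower_skeleton : skeleton sm [set A | exists2 G, sat G & A = gen G].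
Proof.
have satU (J : Type) (K : set J) (H : J -> set I) : (forall j, K j -> sat (H j)) ->
    sat (\bigcup_(j in K) H j).
  move=> sH c [j Kj Hc] x /(sH j Kj c Hc); apply: cspanS => y [d [Hd dc] Dy].
  by exists d => //; split=> //; exists j.
split.
- move=> F FP; pose K := [set G | sat G /\ F (gen G)].
  exists (\bigcup_(G in K) G); first by apply: satU => G [].
  apply/seteqP; split=> x.
    move=> [A FA Ax]; have [G sG AE] := FP A FA.
    move: Ax; rewrite AE => -[c Gc Dc]; exists c => //; exists G => //.
    by split=> //; rewrite -AE.
  by move=> [c [G [sG FG] Gc] Dx]; exists (gen G) => //; exists c.
- move=> _ _ [G sG ->] [G' sG' ->] x y Gx Gy e e0.
  have [r Gr rP] := sat_Ind sG sG' Gx Gy e0; exists r; split=> //; apply: cspanS Gr.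
    by move=> z [c [? ?] Dz]; exists c.
  by move=> z [c [? ?] Dz]; exists c.
have /choice[H HP] : forall c, exists H, [/\ sm H, H `<=` [set d | strict le d c] &
    cspan (D c) `&` E c `<=` cspan (gen H)].
  move=> c; have [W [sW WS SW]] : exists W, [/\ sm W, W `<=` cspan (D c) `&` E c &
      cspan (D c) `&` E c `<=` closure W].
    apply: (small_dense_sub (D := qspan (D c))) => //; first exact: (small_qspan smP).
    by rewrite cspan_qspan => x [].
  have /choice[g gP] : forall u, exists G, W u -> [/\ countable G, G `<=` [set d | strict le d c] &
      cspan (gen G) u].
    move=> u; have [Wu|] := pselect (W u); last by exists set0.
    by have [_ /E_countable[G ?]] := WS _ Wu; exists G.
  exists (\bigcup_(u in W) g u); split.
  - by apply: smR => // u Wu; apply: (small_countable smP); have [] := gP u Wu.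
  - by move=> d [u Wu gd]; have [_ h _] := gP u Wu; exact: h.
  - apply: (subset_trans SW).
    rewrite [X in _ `<=` X]((closure_id _).1 (@cspan_closed _ _ _)); apply: closure_subset.
    move=> u Wu; have [_ _] := gP u Wu; apply: cspanS => z [d gd Dz].
    by exists d => //; exists u.
move=> B sB.
have /choice[g gP] : forall u, exists G, countable G /\ cspan (gen G) u.
  move=> u; have [|G [cG _ Gu]] := @E_countable lambda u; first by rewrite ET.
  by exists G.
pose T := fix T n := if n is k.+1 then T k `|` \bigcup_(c in T k) H c else \bigcup_(u in B) g u.
have sT n : sm (T n).
  elim: n => [|n IH] /=.
    by apply: smR => // u _; apply: (small_countable smP); have [] := gP u.
  by apply: (smallU smP) => //; apply: smR => // c _; have [] := HP c.
exists (gen (\bigcup_n T n)); split.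
- exists (\bigcup_n T n) => // c [n _ Tc]; have [_ Hc h] := HP c.
  apply: (subset_trans h); apply: cspanS => z [d Hd Dz]; exists d => //; split; last exact: Hc.
  by exists n.+1 => //; right; exists c.
- apply: smR => //; apply: smR => //; exact: (small_countable smP).
- move=> u Bu; have [_] := gP u; apply: cspanS => z [d gd Dz]; exists d => //.
  by exists 0%N => //; exists u.
Qed.

End Tower.

Lemma tightly_filtered_skeleton {R : realType} (U : completeNormedModType R) (tau : Type)
  (sm : card_class) : small_class sm -> regular_class sm ->
  (forall T (A : set T), lt_class tau A -> sm T A) ->
  tightly_filtered tau U -> exists Fam : set (set U), skeleton sm Fam.
Proof.
move=> smP smR tsm [I [le [lambda [E [[wo lel sE] [Em Ez ET Es El]]]]]].
(* A small dense subset of the push-out factor of the step from [a] to its successor, which is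
   unique; empty where there is no successor, in particular at [lambda]. *)
have DP a : exists D : set U, [/\ sm U D, (a = lambda -> D = set0) & forall b, is_succ le a b ->
    [/\ D `<=` E b, Ind (cspan D) (E a) & E b `<=` cspan (D `|` E a)]].
  have [[b ab]|ns] := pselect (exists b, is_succ le a b); last first.
    exists set0; split=> //; first exact: (small0 smP).
    by move=> b ab; exfalso; apply: ns; exists b.
  have [S PO /dens_ltP[D [DS SD tD]]] := Es a b ab.
  have [[/is_subspaceE[cS hS] _ _] SE _ EE _] := PO.
  have DE : cspan D = S.
    apply/seteqP; split; first exact: cspan_le.
    by apply: (subset_trans SD); apply: closure_subset; exact: lspan_sub.
  exists D; split; first exact: tsm.
    move=> e; move: ab; rewrite e => -[[lb ne] _]; exfalso; apply: ne.
    exact: (wo_anti wo).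
  move=> b' [ab' mb']; have -> : b' = b.
    by case: ab => ab mb; apply: (wo_anti wo); [exact: mb'|exact: mb].
  split; [exact: subset_trans SE|by rewrite DE; exact: pushout_Ind PO|].
  rewrite EE [X in _ `<=` X]((closure_id _).1 (@cspan_closed _ _ _)); apply: closure_subset.
  move=> _ [s Ss [x Ex <-]]; apply: (subspD (cspan_subsp _)).
    by apply: (cspanS (A := D)); [move=> ? ?; left|rewrite DE].
  by apply: cspan_sub; right.
have /choice[D {}DP] := DP.
exists [set A | exists2 G, sat le E D G & A = \bigcup_(c in G) D c].
apply: (@tower_skeleton _ _ _ _ _ _ _ lambda) => //.
- by move=> a; exact/is_subspaceE.
- move=> a b ab; have [->|ne] := pselect (a = b); first exact: subset_refl.
  by apply: Em; split.
- by move=> a; have [] := DP a.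
- by have [_ ->] := DP lambda.
- by move=> a b ab; have [_ _] := DP a; exact.
Qed.

(** * Uniqueness *)

Section Swap.
Context {R : realType} {V U : completeNormedModType R}.

Definition swap {T T' : Type} (p : T * T') := (p.2, p.1).

Lemma isom_swap (G : set (V * U)) : isom G -> isom (swap @` G).
Proof.
move=> iG p Gp; suff [q Gq ->] : exists2 q, lspan G q & p = swap q by rewrite /= iG.
elim: Gp => [|a _ x [q Gq <-] _ [r Gr ->]]; first by exists 0 => //; exact: lspan0.
by exists (a *: q + r) => //; exact: lspanS.
Qed.

Lemma isom_bigcup (J : Type) (D : set J) (F : J -> set (V * U)) :
  (forall i j, D i -> D j -> exists k, [/\ D k, F i `<=` F k & F j `<=` F k]) ->
  (forall j, D j -> isom (F j)) -> isom (\bigcup_(j in D) F j).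
Proof.
move=> dir iF p; have [->|/set0P[j Dj]] := eqVneq D set0.
  by rewrite bigcup_set0; elim=> [|? ? ? []]; rewrite /= !normr0.
by move=> /(lspan_bigcup dir Dj)[k Dk]; exact: iF.
Qed.

End Swap.

Lemma swapK T T' (G : set (T * T')) : swap @` (swap @` G) = G.
Proof.
apply/seteqP; split=> [_ [_ [[x y] Gxy <-] <-] //|[x y] Gxy].
by exists (y, x) => //; exists (x, y).
Qed.

Lemma fst_swap T T' (G : set (T * T')) : fst @` (swap @` G) = snd @` G.
Proof. by rewrite image_comp. Qed.

Section HalfStep.
Context {R : realType} {V U : completeNormedModType R}.
Variables sm kc : card_class.
Hypothesis (smP : small_class sm) (kcP : small_class kc).
Hypothesis smkc : forall T (A : set T), sm A -> kc A.
Hypothesis real : realizing (U := U) sm kc.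
Variable Fam : set (set V).
Hypothesis skel : skeleton sm Fam.

(** A small member [B] of the skeleton absorbs the domain of [P] and the set [D]. It is independent
    of the domain of [G], which is spanned by a member, so [forth] maps it. *)
Lemma half_step (G P : set (V * U)) A D : Fam A -> cspan (fst @` G) = cspan A -> kc G ->
  sm P -> isom (G `|` P) -> sm D -> exists Q B, [/\ P `<=` Q, sm Q, isom (G `|` Q),
    Fam B & fst @` P `|` D `<=` cspan B /\ B `<=` cspan (fst @` Q)].
Proof.
move=> FA GA kG sP iP sD.
have s0 : sm (fst @` P `|` D) by apply: (smallU smP) => //; exact: (small_image smP).
have [B [FB sB PB]] := skel_small skel s0.
(* [forth] wants the domain of [P] inside the set being mapped, not merely inside its closed
   span. *)
pose B1 := B `|` (fst @` P `|` D).
have B1E : cspan B1 = cspan B.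
  apply/seteqP; split; first by apply: cspan_mono => x [|/PB//]; exact: cspan_sub.
  by apply: cspanS => x; left.
have [|||||||Q [sQ PQ iQ B1Q QB1]] := @forth _ V U sm kc smP kcP smkc real G P (snd @` G) B1.
- exact: (small_image kcP).
- by move=> p Gp; apply: cspan_sub; exists p.
- exact: sP.
- exact: iP.
- exact: (smallU smP).
- by move=> x Px; right; left.
- by rewrite B1E GA; exact: (skel_Ind skel).
exists Q, B; split=> //; split=> // x Bx; apply: cspan_sub; apply: B1Q; left; exact: Bx.
Qed.

End HalfStep.

(** * Back and forth *)

Section BackForth.
Context {R : realType} {U U' : completeNormedModType R}.
Variables sm kc : card_class.
Hypothesis (smP : small_class sm) (kcP : small_class kc) (smR : regular_class sm).
Hypothesis smkc : forall T (A : set T), sm A -> kc A.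
Hypothesis real : realizing (U := U) sm kc.
Hypothesis real' : realizing (U := U') sm kc.
Variables (Fam : set (set U)) (Fam' : set (set U')).
Hypotheses (skel : skeleton sm Fam) (skel' : skeleton sm Fam').

Let good (G : set (U * U')) := [/\ isom G, exists2 A, Fam A & cspan (fst @` G) = cspan A &
  exists2 A', Fam' A' & cspan (snd @` G) = cspan A'].

Let cspan_bigcup (V : completeNormedModType R) (J : Type) (D : set J) (A B : J -> set V) :
  (forall j, D j -> A j `<=` cspan (B j)) ->
  cspan (\bigcup_(j in D) A j) `<=` cspan (\bigcup_(j in D) B j).
Proof.
move=> AB; apply: cspan_mono => x [j Dj /(AB j Dj)]; apply: cspanS => y By; by exists j.
Qed.

Let good_bigcup (J : Type) (D : set J) (F : J -> set (U * U')) :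
  (forall i j, D i -> D j -> exists k, [/\ D k, F i `<=` F k & F j `<=` F k]) ->
  (forall j, D j -> good (F j)) -> good (\bigcup_(j in D) F j).
Proof.
move=> dir gF; split; first by apply: isom_bigcup => // j /gF[].
- have /choice[A AP] : forall j, exists A, D j -> Fam A /\ cspan (fst @` F j) = cspan A.
    move=> j; have [/gF[_ [A FA AE] _]|] := pselect (D j); last by exists set0.
    by exists A.
  exists (\bigcup_(j in D) A j).
    rewrite -(bigcup_image D A id); apply: (skel_bigcup skel) => _ [j Dj <-].
    exact: (AP j Dj).1.
  rewrite image_bigcup; apply/seteqP; split; apply: cspan_bigcup => j Dj;
    have [_ E] := AP j Dj; [rewrite -E|rewrite E]; exact: cspan_sub.
- have /choice[A AP] : forall j, exists A, D j -> Fam' A /\ cspan (snd @` F j) = cspan A.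
    move=> j; have [/gF[_ _ [A FA AE]]|] := pselect (D j); last by exists set0.
    by exists A.
  exists (\bigcup_(j in D) A j).
    rewrite -(bigcup_image D A id); apply: (skel_bigcup skel') => _ [j Dj <-].
    exact: (AP j Dj).1.
  rewrite image_bigcup; apply/seteqP; split; apply: cspan_bigcup => j Dj;
    have [_ E] := AP j Dj; [rewrite -E|rewrite E]; exact: cspan_sub.
Qed.

(** A half step spoils the other side: the range of the enlarged map need not be spanned by a member
    of [Fam']. Alternating half steps countably often and taking unions repairs both sides, because
    skeletons are closed under unions. *)
Lemma good_step G u u' : good G -> kc G -> exists H, [/\ G `<=` H, good H, kc H,
  cspan (fst @` H) u & cspan (snd @` H) u'].
Proof.
move=> [iG [A FA GA] [A' FA' GA']] kG.
have step P : exists QBB : set (U * U') * (set U * set U'), sm P -> isom (G `|` P) ->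
  let: (Q, (B, B')) := QBB in [/\ [/\ P `<=` Q, sm Q & isom (G `|` Q)], Fam B, Fam' B',
    fst @` P `|` [set u] `<=` cspan B /\ B `<=` cspan (fst @` Q) &
    snd @` P `|` [set u'] `<=` cspan B' /\ B' `<=` cspan (snd @` Q)].
  have [sP|] := pselect (sm P); last by exists (P, (set0, set0)).
  have [iP|] := pselect (isom (G `|` P)); last by exists (P, (set0, set0)).
  have [Q [B [PQ sQ iQ FB [PB BQ]]]] := half_step smP kcP smkc real' skel FA GA kG sP iP
    (small1 smP u).
  have [||||||Q' [B' [QQ' sQ' iQ' FB' [QB' BQ']]]] := @half_step _ U' U sm kc smP kcP smkc real
    Fam' skel' (swap @` G) (swap @` Q) A' [set u'].
  - exact: FA'.
  - by rewrite fst_swap.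
  - exact: (small_image kcP).
  - exact: (small_image smP).
  - by rewrite -image_setU; exact: isom_swap.
  - exact: (small1 smP).
  exists (swap @` Q', (B, B')); split=> //.
  - split.
    + by apply: (subset_trans PQ); rewrite -{1}[Q]swapK; exact: image_subset.
    + exact: (small_image smP).
    + by rewrite -{1}[G]swapK -image_setU; exact: isom_swap.
  - split=> //; apply: (subset_trans BQ); apply: cspanS; apply: image_subset.
    by rewrite -{1}[Q]swapK; exact: image_subset.
  - split; last by rewrite -fst_swap swapK.
    move=> x [[p Pp <-]|->]; apply: QB'; last by right.
    by left; rewrite fst_swap; exists p => //; exact: PQ.
have /choice[S SP] := step.
pose T := fix T n := if n is k.+1 then (S (T k)).1 else set0.
have TP n : sm (T n) /\ isom (G `|` T n).
  elim: n => [|n [sT iT]] /=; first by rewrite setU0; split=> //; exact: (small0 smP).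
  by have := SP _ sT iT; case: (S (T n)) => [Q [B B']] [[]].
pose B n := (S (T n)).2.1; pose B' n := (S (T n)).2.2.
have {}SP n : [/\ T n `<=` T n.+1, Fam (B n), Fam' (B' n),
    fst @` T n `|` [set u] `<=` cspan (B n) /\ B n `<=` cspan (fst @` T n.+1) &
    snd @` T n `|` [set u'] `<=` cspan (B' n) /\ B' n `<=` cspan (snd @` T n.+1)].
  have [sT iT] := TP n; have := SP _ sT iT.
  by rewrite /= /B /B'; case: (S (T n)) => [Q [? ?]] /= [[]].
have Tmono m n : (m <= n)%N -> T m `<=` T n.
  elim: n => [|n IH]; first by rewrite leqn0 => /eqP ->.
  rewrite leq_eqVlt => /predU1P[->//|/IH h]; apply: (subset_trans h).
  by have [] := SP n.
pose H := \bigcup_n (G `|` T n).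
have HE : H = G `|` \bigcup_n T n by rewrite /H bigcupUr //; exists 0%N.
have fstH : cspan (fst @` H) = cspan (A `|` \bigcup_n B n).
  rewrite HE image_setU image_bigcup; apply/seteqP; split; apply: cspan_mono.
    move=> x [Gx|[n _ Tx]].
      by apply: (cspanS (A := A)); [left|rewrite -GA; exact: cspan_sub].
    have [_ _ _ [h _] _] := SP n; move: (h x (or_introl Tx)); apply: cspanS => y By.
    by right; exists n.
  move=> x [Ax|[n _ Bx]].
    by apply: (cspanS (A := fst @` G)); [left|rewrite GA; exact: cspan_sub].
  have [_ _ _ [_ h] _] := SP n; move: (h x Bx); apply: cspanS => y By.
  by right; exists n.+1.
have sndH : cspan (snd @` H) = cspan (A' `|` \bigcup_n B' n).
  rewrite HE image_setU image_bigcup; apply/seteqP; split; apply: cspan_mono.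
    move=> x [Gx|[n _ Tx]].
      by apply: (cspanS (A := A')); [left|rewrite -GA'; exact: cspan_sub].
    have [_ _ _ _ [h _]] := SP n; move: (h x (or_introl Tx)); apply: cspanS => y By.
    by right; exists n.
  move=> x [Ax|[n _ Bx]].
    by apply: (cspanS (A := snd @` G)); [left|rewrite GA'; exact: cspan_sub].
  have [_ _ _ _ [_ h]] := SP n; move: (h x Bx); apply: cspanS => y By.
  by right; exists n.+1.
have famU (V : completeNormedModType R) (F : set (set V)) C (D : nat -> set V) :
    skeleton sm F -> F C -> (forall n, F (D n)) -> F (C `|` \bigcup_n D n).
  move=> sF FC FD; have -> : C `|` \bigcup_n D n = \bigcup_(X in [set C] `|` range D) X.
    by rewrite bigcup_setU bigcup_set1 bigcup_image.
  by apply: (skel_bigcup sF) => X [->//|[n _ <-]].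
exists H; split.
- by rewrite HE; exact: subsetUl.
- split.
  + apply: isom_bigcup => [m n _ _|n _]; last exact: (TP n).2.
    exists (maxn m n); split=> //; apply: setUS; apply: Tmono;
      [exact: leq_maxl|exact: leq_maxr].
  + by exists (A `|` \bigcup_n B n) => //; apply: famU => // n; have [] := SP n.
  + by exists (A' `|` \bigcup_n B' n) => //; apply: famU => // n; have [] := SP n.
- rewrite HE; apply: (smallU kcP) => //; apply: smkc; apply: smR; first exact: (small_nat smP).
  by move=> n _; have [] := TP n.
- rewrite fstH; have [_ _ _ [h _] _] := SP 0%N; move: (h u (or_intror erefl)).
  by apply: cspanS => y By; right; exists 0%N.
- rewrite sndH; have [_ _ _ _ [h _]] := SP 0%N; move: (h u' (or_intror erefl)).
  by apply: cspanS => y By; right; exists 0%N.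
Qed.

(** The [i]-th step puts [e i] into the domain and [e' i] into the range. At every stage the union
    of the earlier maps stays in [kc], since initial segments are in [kc] and [kc] is closed under
    such unions. *)
Lemma back_forth (K : Type) (le : rel K) (e : K -> U) (e' : K -> U') :
  regular_class kc -> wochoice.well_order le -> (forall i, kc [set j | strict le j i]) ->
  [set: U] `<=` cspan (range e) -> [set: U'] `<=` cspan (range e') -> isometric U U'.
Proof.
move=> kcR wo seg eT eT'.
pose F i G := xget set0 [set H | [/\ G `<=` H, good H, kc H,
  cspan (fst @` H) (e i) & cspan (snd @` H) (e' i)]].
have [s sE] := wo_rec_bigcup wo F.
have dir (P : set K) : (forall i, P i -> \bigcup_(j in [set j | strict le j i]) s j `<=` s i) ->
    forall i j, P i -> P j -> exists k, [/\ P k, s i `<=` s k & s j `<=` s k].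
  move=> Ps; have mono i j : P j -> le i j -> s i `<=` s j.
    move=> Pj ij; have [->|ne] := pselect (i = j); first exact: subset_refl.
    by apply: subset_trans (Ps j Pj) => p sp; exists i => //; split.
  by move=> i j Pi Pj; have [ij|ji] := wo_total wo i j; [exists j|exists i]; split=> //; exact: mono.
have sP i : [/\ \bigcup_(j in [set j | strict le j i]) s j `<=` s i, good (s i), kc (s i),
  cspan (fst @` s i) (e i) & cspan (snd @` s i) (e' i)].
  elim/(wo_ind wo) : i => i IH.
  have [H HP] : exists H, [/\ \bigcup_(j in [set j | strict le j i]) s j `<=` H, good H, kc H,
      cspan (fst @` H) (e i) & cspan (snd @` H) (e' i)].
    apply: good_step; last by apply: kcR => // j /IH[].
    by apply: good_bigcup => [|j /IH[]//]; apply: dir => j /IH[].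
  by rewrite sE /F; case: xgetP => [G _ //|/(_ H)].
pose G := \bigcup_i s i.
have [iG _ _] : good G.
  by apply: good_bigcup => [|j _]; [apply: dir => j _; have [] := sP j|have [] := sP j].
have fstG x : cspan (fst @` G) x.
  have : cspan (range e) x by exact: eT.
  apply: cspan_mono => _ [i _ <-]; have [_ _ _ + _] := sP i.
  by apply: cspanS; apply: image_subset => p sp; exists i.
have sndG x : cspan (snd @` G) x.
  have : cspan (range e') x by exact: eT'.
  apply: cspan_mono => _ [i _ <-]; have [_ _ _ _] := sP i.
  by apply: cspanS; apply: image_subset => p sp; exists i.
have [w iw wP] := graph_fun iG fstG.
exists w => //; apply/seteqP; split=> // y _.
have [|x xP] := @gcl_total _ _ _ (swap @` G) y (isom_swap iG); first by rewrite fst_swap.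
exists x => //; apply: (wP (x, y)) => d d0.
have [q Gq [q1 q2]] := xP d d0; exists (swap q) => //.
elim: Gq {q1 q2} => [|a _ z [r Gr <-] _ ?]; first exact: lspan0.
by have -> : swap (a *: swap r + z) = a *: r + swap z by []; exact: lspanS.
Qed.

End BackForth.

(** Diagonal argument: at [k], [g] avoids the value at [k] of the function coded by [k]; two
    distinct elements of [K] suffice for this. *)
Lemma card_lt_funspace (K : Type) : infinite_set [set: K] -> [set: K] #< [set: K -> K].
Proof.
move=> Kinf; apply/card_ltNle => /card_le_fun[|f [_ finj]].
  by exists id.
have [a [b ab]] : exists a b : K, a <> b.
  apply: contrapT => nab; apply: Kinf.
  have [->|/set0P[a _]] := eqVneq [set: K] set0; first exact: finite_set0.
  suff -> : [set: K] = [set a] by exact: finite_set1.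
  by apply/seteqP; split=> // b _; apply: contrapT => ba; apply: nab; exists b, a.
have /choice[g gP] : forall k, exists y, forall h, f h = k -> y <> h k.
  move=> k; have [[h hk]|nh] := pselect (exists h, f h = k); last first.
    by exists a => h hk; exfalso; apply: nh; exists h.
  have hE h' : f h' = k -> h' = h by move=> h'k; apply: finj => //; rewrite h'k.
  have [hka|] := pselect (h k = a); last by exists a => h' /hE -> //; exact: nesym.
  by exists b => h' /hE ->; rewrite hka => /nesym.
exact: (gP (f g) g erefl).
Qed.

(** If kappa were below tau, kappa^kappa would be among the powers bounded by kappa. *)
Lemma weak_power_le (kappa tau : Type) : infinite_set [set: kappa] ->
  weak_power_eq kappa tau kappa -> [set: tau] #<= [set: kappa].
Proof.
move=> Kinf [pw _]; apply: contrapT => /card_ltNle kt.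
have /card_ltNle := card_lt_funspace Kinf; apply; apply: pw; by exists kappa.
Qed.

Section Unique.
Context {R : realType} (kappa tau : Type).
Hypothesis kappa_regular : regular_card kappa.
Hypothesis ctau : ~ countable [set: tau].
Hypothesis tau_kappa : [set: tau] #<= [set: kappa].

Let kcP := lt_class_small (uncountable_kappa ctau tau_kappa).
Let kcR := lt_class_regular kappa_regular.

Lemma skeleton_unique (sm : card_class) (U U' : completeNormedModType R) :
  small_class sm -> regular_class sm ->
  (forall T (A : set T), lt_class tau A -> sm T A) ->
  (forall T (A : set T), sm T A -> lt_class kappa A) ->
  realizing (U := U) sm (lt_class kappa) -> realizing (U := U') sm (lt_class kappa) ->
  is_X_kappa_tau kappa tau U -> is_X_kappa_tau kappa tau U' -> isometric U U'.
Proof.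
move=> smP smR tsm smk real real' [dU tU _] [dU' tU' _].
have [Fam skel] := tightly_filtered_skeleton smP smR tsm tU.
have [Fam' skel'] := tightly_filtered_skeleton smP smR tsm tU'.
have enum (V : completeNormedModType R) : has_dens [set: V] kappa ->
    exists e : kappa -> V, [set: V] `<=` cspan (range e).
  move=> [[D [_ VD] /card_eqPle[Dk _]] _].
  have D0 : D !=set0 by have [y Dy _] := (closureNP _ _).1 (VD 0 I) 1 ltr01; exists y.
  have [e [De _]] := card_le_onto Dk D0; exists e; apply: (subset_trans VD).
  by apply: closure_subset => x /De; exact: lspan_sub.
have [[e eT] [e' eT']] := (enum _ dU, enum _ dU').
have [_ [le [wo seg] _]] := kappa_regular.
exact: (back_forth smP kcP smR smk real real' skel skel' kcR wo seg eT eT').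
Qed.

Lemma X_kappa_tau_unique (U U' : completeNormedModType R) :
  is_X_kappa_tau kappa tau U -> is_X_kappa_tau kappa tau U' -> isometric U U'.
Proof.
move=> XU XU'.
have [real real'] : realizing (U := U) (lt_class tau) (lt_class kappa) /\
    realizing (U := U') (lt_class tau) (lt_class kappa).
  by split; apply: extension_realizing => //; [have [] := XU|have [] := XU'].
have [treg|nreg] := pselect (regular_class (lt_class tau)).
  apply: (@skeleton_unique (lt_class tau)) => //; first exact: lt_class_small.
  by move=> T A At; exact: card_lt_le_trans tau_kappa.
(* Otherwise tau and kappa would have the same size, and tau would inherit regularity from kappa. *)
have tk : [set: tau] #< [set: kappa].
  apply/card_ltNle => kt; apply: nreg => J T D A sD sA.
  apply: (card_lt_le_trans (B := [set: kappa])) => //.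
  by apply: kcR => [|j /sA sj]; [exact: card_lt_le_trans tau_kappa|exact: card_lt_le_trans tau_kappa].
have tinf : infinite_set [set: tau] by move=> /finite_set_countable.
apply: (@skeleton_unique (le_class tau)) => //.
- exact: le_class_small.
- exact: le_class_regular.
- by move=> T A; exact: card_lt_le.
- by move=> T A At; exact: card_le_lt_trans tk.
- exact: singular_realizing.
- exact: singular_realizing.
Qed.

End Unique.

(** * Existence *)

(** Enumerate [M] greedily along tau and stop at the first [b] that exhausts it. Small sets thus
    become images of functions on segments of tau, and there are only tau many segments. *)
Lemma image_segment (T tau : Type) (le : rel tau) (M : set T) : wochoice.well_order le ->
  M !=set0 -> M #< [set: tau] -> exists b (f : tau -> T),
    [set a | strict le a b] #< [set: tau] /\ M = f @` [set a | strict le a b].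
Proof.
move=> wo [x0 Mx0] Mtau; pose seg b := [set a | strict le a b].
have /choice[pick pickP] : forall A : set T, exists y, A !=set0 -> A y.
  by move=> A; have [[y Ay]|] := pselect (A !=set0); [exists y|exists x0].
pose F b (g : tau -> T) := pick (M `\` g @` seg b).
have [s sE] := wo_rec wo x0 F.
have sF b : ~ (M `<=` s @` seg b) -> (M `\` s @` seg b) (s b).
  move=> nb; rewrite sE /F.
  have -> : (fun j => if pselect (strict le j b) then s j else x0) @` seg b = s @` seg b.
    by apply: eq_imagel => a ab; case: pselect.
  apply: pickP; apply: contrapT => no; apply: nb => x Mx; apply: contrapT => nx.
  by apply: no; exists x.
have inj a b : ~ (M `<=` s @` seg a) -> ~ (M `<=` s @` seg b) -> s a = s b -> a = b.
  move=> /sF[_ na] /sF[_ nb] sab; apply: contrapT => ab.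
  have [le_ab|[ba _]] := wo_cases wo a b.
    by apply: nb; exists a.
  by apply: na; exists b; [split=> // e; exact/ab/esym|].
have [ex|nex] := pselect (exists b, M `<=` s @` seg b); last first.
  exfalso; move/card_ltNle: Mtau; apply; apply: (@card_le_inj _ _ _ _ s) => [b _|a b _ _].
    by have [] := sF b (fun h => nex (ex_intro _ b h)).
  by apply: inj => h; apply: nex; [exists a|exists b].
have [b Mb bmin] := wo_least wo ex.
have nb a : seg b a -> ~ (M `<=` s @` seg a).
  by move=> ab /bmin ba; case: ((not_le wo b a).2 ab).
have sM : {homo s : a / seg b a >-> M a} by move=> a /nb/sF[].
exists b, s; split; last by apply/seteqP; split=> // _ [a /sM ? <-].
apply: card_le_lt_trans Mtau; apply: card_le_inj sM _ => a a' /nb na /nb na'; exact: inj.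
Qed.

(** * Counting small sets and bookkeeping *)

Section Bookkeeping.
Variables (kappa tau : Type) (le : rel kappa).
Hypothesis le_init : initial_order le.
Hypothesis kappa_inf : infinite_set [set: kappa].
Hypothesis tau_kappa : [set: tau] #<= [set: kappa].
Hypothesis kappa_tau : weak_power_eq kappa tau kappa.

Lemma funspace_le (M W : Type) (w0 : W) : [set: M] #< [set: tau] -> [set: W] #<= [set: kappa] ->
  [set: M -> W] #<= [set: kappa].
Proof.
move=> Mtau Wk; apply: (@card_le_trans _ _ _ [set: M -> kappa]); last first.
  by apply: kappa_tau.1; exists M.
have [f [_ finj]] := card_le_fun Wk (ex_intro _ w0 I).
apply: (@card_le_inj _ _ _ _ (fun g m => f (g m))) => // g h _ _ gh.
by apply/funext => m; apply: finj => //; exact: (congr1 (@^~ m) gh).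
Qed.

(** At most tau <= kappa segments, and for each small one at most kappa functions on it by
    [kappa_tau]. *)
Lemma small_subsets_le (W : Type) (w0 : W) : [set: W] #<= [set: kappa] ->
  [set M : set W | M #< [set: tau]] #<= [set: kappa].
Proof.
move=> Wk; have [let_ wo] := wo_exists tau; have kP := le_class_small kappa_inf.
pose seg b := [set a | strict let_ a b].
pose S b : set (set W) := if pselect (seg b #< [set: tau]) then
  range (fun f : {a | seg b a} -> W => range f) else set0.
suff : [set M : set W | M #< [set: tau]] `<=` [set set0] `|` \bigcup_b S b.
  move=> sub; apply: (small_le kP) (subset_card_le sub) _.
  apply: (smallU kP); first exact: (small1 kP).
  apply: (le_class_regular kappa_inf); first exact: tau_kappa.
  move=> b _; rewrite /S; case: pselect => [bt|nb].
    apply: (small_image kP); apply: funspace_le => //.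
    apply: card_le_lt_trans bt; apply: (@card_le_inj _ _ _ _ sval).
      by move=> x _; exact: (svalP x).
    by move=> x y _ _; exact: eq_sig_hprop.
  exact: (small0 kP).
move=> M Mt; have [->|/set0P M0] := eqVneq M set0; [by left|right].
have [b [f [bt ->]]] := image_segment wo M0 Mt.
exists b => //; rewrite /S; case: pselect => [bt'|//]; exists (fun a => f (sval a)) => //.
apply/seteqP; split=> [_ [x _ <-]|_ [a sa <-]]; last by exists (exist _ a sa).
by exists (sval x) => //; exact: (svalP x).
Qed.

Lemma bookkeeping (W : Type) (w0 : W) : [set: W] #<= [set: kappa] ->
  exists c : kappa -> set W, forall M, M #< [set: tau] -> forall a0, exists a, le a0 a /\ c a = M.
Proof.
move=> Wk; have kP := le_class_small kappa_inf.
have [wo seg] := le_init; pose Q := [set M : set W | M #< [set: tau]].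
have Qk : (Q `*` [set: kappa]) #<= [set: kappa].
  by apply: (small_X kP) => //; exact: small_subsets_le.
have [Q0|/set0P Q0] := eqVneq Q set0.
  by exists (fun=> set0) => M Mt; have : Q M by []; rewrite Q0.
have [k _] : [set: kappa] !=set0 by apply: infinite_setN0.
have [g [gQ _]] := card_le_onto Qk (let: ex_intro M QM := Q0 in ex_intro _ (M, k) (conj QM I)).
exists (fun a => (g a).1) => M QM a0; apply: contrapT => no.
(* Each [M] is listed once with every [b] as a tag. If all its occurrences preceded [a0], the tags
   would map that segment onto kappa. *)
have /card_ltNle := seg a0; apply; apply: (@card_le_surj _ _ _ _ (fun a => (g a).2)).
move=> b _; have [a _ ga] := gQ (M, b) (conj QM I).
exists a; last by rewrite ga.
by have [aa|//] := wo_cases wo a0 a; case: no; exists a; rewrite ga.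
Qed.

End Bookkeeping.

Lemma bounded_set (kappa : Type) (le : rel kappa) (C : set kappa) :
  wochoice.well_order le -> (forall C : set kappa, cofinal le C -> [set: kappa] #<= C) ->
  C #< [set: kappa] -> exists a, forall b, C b -> strict le b a.
Proof.
move=> wo cof /card_ltNle Ck; apply: contrapT => nb; apply: Ck; apply: cof => x.
apply: contrapT => nx; apply: nb; exists x => b Cb.
by apply/(not_le wo) => xb; apply: nx; exists b.
Qed.

(** * Sublinear functionals *)

Section Sublinear.
Context {R : realType} {V : lmodType R}.

Definition sublinear (P : V -> R) := (forall x y, P (x + y) <= P x + P y) /\
  forall t x, 0 < t -> P (t *: x) = t * P x.

Lemma sublinear0 P : sublinear P -> P 0 = 0.
Proof. by move=> [_ /(_ 2 0)]; rewrite scaler0; lra. Qed.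

(** The members need not be sublinear, only the family jointly so. This covers three uses: chains in
    Zorn's lemma, the perturbation in [hahn_banach], and the gauge in [conv_separation]. *)
Lemma inf_sublinear (J : Type) (D : set J) (F : J -> V -> R) (b : V -> R) :
  D !=set0 -> (forall j x, D j -> b x <= F j x) ->
  (forall i j x y, D i -> D j -> exists2 k, D k & F k (x + y) <= F i x + F j y) ->
  (forall i t x, D i -> 0 < t -> exists2 k, D k & F k (t *: x) <= t * F i x) ->
  exists P, [/\ sublinear P, forall x, b x <= P x & forall j x, D j -> P x <= F j x].
Proof.
move=> [j0 Dj0] bF FD FZ; pose P x := inf [set F j x | j in D].
have lb x : has_lbound [set F j x | j in D] by exists (b x) => _ [j Dj <-]; exact: bF.
have hi x : has_inf [set F j x | j in D] by split; [exists (F j0 x); exists j0|].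
have PF j x : D j -> P x <= F j x by move=> Dj; apply: ge_inf => //; exists j.
have Pe x e : 0 < e -> exists2 j, D j & F j x < P x + e.
  by move=> e0; have [_ [j Dj <-] ?] := inf_adherent e0 (hi x); exists j.
have PZ t x : 0 < t -> P (t *: x) <= t * P x.
  move=> t0; apply/ler_addgt0Pr => e e0; have et : 0 < e / t by rewrite divr_gt0.
  have [j Dj jP] := Pe x _ et; have [k Dk kP] := FZ j t x Dj t0.
  apply: le_trans (PF _ _ Dk) (le_trans kP _).
  have -> : t * P x + e = t * (P x + e / t) by rewrite mulrDr mulrCA divff ?mulr1 ?gt_eqF.
  by rewrite ler_pM2l // ltW.
exists P; split=> //; last by move=> x; apply: lb_le_inf; [exists (F j0 x); exists j0|move=> _ [j Dj <-]; exact: bF].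
split=> [x y|t x t0].
  apply/ler_addgt0Pr => e e0; have e2 : 0 < e / 2 by lra.
  have [i Di iP] := Pe x _ e2; have [j Dj jP] := Pe y _ e2.
  have [k Dk kP] := FD i j x y Di Dj; have := PF k (x + y) Dk; lra.
apply/eqP; rewrite eq_le PZ //=.
have ti : 0 < t^-1 by rewrite invr_gt0.
have := PZ t^-1 (t *: x) ti; rewrite scalerA mulVf ?gt_eqF // scale1r.
by rewrite -(ler_pM2l t0) mulrA divff ?gt_eqF // mul1r.
Qed.

Lemma sublinear_opp P x : sublinear P -> - P (- x) <= P x.
Proof. by move=> hP; have [/(_ x (- x)) + _] := hP; rewrite subrr sublinear0 //; lra. Qed.

(* Hahn-Banach without extensions: a minimal sublinear functional is linear. *)
Lemma minimal_sublinear P : sublinear P -> exists Q, [/\ sublinear Q, forall x, Q x <= P x &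
  forall Q', sublinear Q' -> (forall x, Q' x <= Q x) -> Q' = Q].
Proof.
move=> hP; pose T := {Q : V -> R | sublinear Q /\ forall x, Q x <= P x}.
pose r (Q Q' : T) := `[< forall x, sval Q' x <= sval Q x >].
have [||||Q Qmax] := @Zorn T r.
- by move=> Q; apply/asboolP.
- move=> Q1 Q2 Q3 /asboolP h /asboolP h'; apply/asboolP => x.
  exact: le_trans (h' x) (h x).
- move=> Q1 Q2 /asboolP h /asboolP h'; apply: eq_sig_hprop; first by move=> ?; exact: Prop_irrelevance.
  by apply/funext => x; apply/eqP; rewrite eq_le h h'.
- move=> A tA; have [->|/set0P[Q0 AQ0]] := eqVneq A set0.
    by exists (exist _ P (conj hP (fun x => lexx _))).
  have le_or Q Q' : A Q -> A Q' -> exists Q'', [/\ A Q'', forall x, sval Q'' x <= sval Q x &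
      forall x, sval Q'' x <= sval Q' x].
    move=> AQ AQ'; have [/asboolP h|/asboolP h] := tA _ _ AQ AQ'; [exists Q'|exists Q]; by split.
  have [|||| Q [hQ _ QA]] := @inf_sublinear T A (fun Q => sval Q) (fun x => - P (- x)).
  + by exists Q0.
  + move=> Q x _; have [hQ QP] := svalP Q; apply: le_trans (sublinear_opp x hQ).
    by rewrite lerN2.
  + move=> Q Q' x y AQ AQ'; have [Q'' [AQ'' h h']] := le_or Q Q' AQ AQ'; exists Q'' => //.
    have [[hQ _] _] := svalP Q''; apply: le_trans (hQ x y) _; exact: lerD.
  + by move=> Q t x AQ t0; exists Q => //; have [[_ ->]] := svalP Q.
  have QP : sublinear Q /\ forall x, Q x <= P x.
    split=> // x; apply: le_trans (QA Q0 x AQ0) _; exact: (svalP Q0).2.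
  by exists (exist _ Q QP) => Q' AQ'; apply/asboolP => x; exact: QA.
have [hQ QP] := svalP Q; exists (sval Q); split=> // Q' hQ' Q'Q.
have Q'P : sublinear Q' /\ forall x, Q' x <= P x.
  by split=> // x; apply: le_trans (Q'Q x) _.
by rewrite -(Qmax (exist _ Q' Q'P)) //; apply/asboolP.
Qed.

(** For a minimal m, the infimum over t >= 0 of m (z + t x) - t m x is sublinear and below m, hence
    equal to m. Taking z = - x and t = 1 gives m (- x) <= - m x, and odd sublinear functionals are
    linear. *)
Lemma hahn_banach P : sublinear P -> exists2 g : V -> R,
  (forall a x y, g (a *: x + y) = a * g x + g y) & forall x, g x <= P x.
Proof.
move=> /minimal_sublinear[m [hm mP mmin]]; have [mD mZ] := hm.
have mN x : m (- x) = - m x.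
  have [|||| Q [hQ _ Qm]] := @inf_sublinear R [set t | 0 <= t]
      (fun t z => m (z + t *: x) - t * m x) (fun z => - m (- z)).
  - by exists 0 => /=.
  - move=> t z /= t0; have [->|tn] := eqVneq t 0.
      by rewrite scale0r addr0 mul0r subr0; exact: sublinear_opp.
    have := mD (z + t *: x) (- z); rewrite addrAC subrr add0r mZ ?lt0r ?tn //; lra.
  - move=> s t y z /= s0 t0; exists (s + t); first by rewrite /= addr_ge0.
    have := mD (y + s *: x) (z + t *: x); rewrite addrACA -scalerDl mulrDl; lra.
  - move=> s t z /= s0 t0; exists (t * s); first by rewrite /= mulr_ge0 // ltW.
    by rewrite -scalerA -scalerDr mZ // mulrBr mulrA.
  have QE : Q = m.
    by apply: mmin => // z; have := Qm 0 z (lexx _); rewrite scale0r addr0 mul0r subr0.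
  have := Qm 1 (- x) ler01; rewrite QE scale1r addNr sublinear0 // mul1r.
  have := sublinear_opp x hm; lra.
have mA x y : m (x + y) = m x + m y.
  have := mD x y; have := mD (- x) (- y); rewrite -opprD !mN; lra.
exists m => // a x y; rewrite mA; congr (_ + _).
have [a0|a0|->] := ltgtP a 0; last by rewrite scale0r mul0r sublinear0.
  by rewrite -[a *: x]opprK -scaleNr mN mZ ?oppr_gt0 //; lra.
exact: mZ.
Qed.

End Sublinear.

Section Combinations.
Context {R : realType} {K : Type}.

Definition comb (V : lmodType R) (x : K -> V) (l : seq (R * K)) : V :=
  \sum_(p <- l) p.1 *: x p.2.

Lemma comb_linear (V W : lmodType R) (g : V -> W) (x : K -> V) l :
  (forall a u v, g (a *: u + v) = a *: g u + g v) -> g (comb x l) = comb (g \o x) l.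
Proof.
move=> hg; have g0 : g 0 = 0.
  by have := hg (-1) 0 0; rewrite scaler0 addr0 scaleN1r addNr.
by rewrite /comb; elim: l => [|p l IH]; rewrite ?big_nil // !big_cons hg IH.
Qed.

Lemma eq_comb (V : lmodType R) (x y : K -> V) (D : set K) l :
  all_in [set p | D p.2] l -> (forall b, D b -> x b = y b) -> comb x l = comb y l.
Proof.
move=> + xy; rewrite /comb; elim: l => [|p l IH] /=; first by rewrite !big_nil.
by move=> [/xy xyp /IH E]; rewrite !big_cons xyp E.
Qed.

Lemma comb1 (V : lmodType R) (x : K -> V) b : comb x [:: (1, b)] = x b.
Proof. by rewrite /comb big_seq1 scale1r. Qed.

Lemma comb_cons (V : lmodType R) (x : K -> V) p l : comb x (p :: l) = p.1 *: x p.2 + comb x l.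
Proof. by rewrite /comb big_cons. Qed.

Lemma comb_cat (V : lmodType R) (x : K -> V) l m : comb x (l ++ m) = comb x l + comb x m.
Proof. by rewrite /comb big_cat. Qed.

Lemma lspan_comb (V : lmodType R) (x : K -> V) (D : set K) v :
  lspan (x @` D) v <-> exists2 l, all_in [set p | D p.2] l & v = comb x l.
Proof.
split; last first.
  move=> [l + ->]; elim: l => [|p l IH] /=; first by rewrite /comb big_nil => _; exact: lspan0.
  by rewrite comb_cons => -[Dp /IH h]; apply: lspanS => //; exists p.2.
elim=> [|a _ w [b Db <-] _ [l Dl ->]]; first by exists [::] => //; rewrite /comb big_nil.
by exists ((a, b) :: l) => //; rewrite comb_cons.
Qed.

Lemma all_in_sub T (A B : set T) s : A `<=` B -> all_in A s -> all_in B s.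
Proof. by move=> AB; elim: s => //= x s IH [/AB ? /IH]. Qed.

End Combinations.

Section DualSpace.
Context {R : realType} {K : Type} (P : set (K -> R^o)).
Hypothesis P0 : P !=set0.
Hypothesis Pb : forall b, exists c, forall f, P f -> `|f b| <= c.

Let T := {f | P f}.
Let L : lmodType R := T -> R^o.

Let N (F : L) : R := sup [set `|F f| | f in [set: T]].
Let ev l : L := fun f => comb (sval f) l.
Let S : set L := [set F | forall e : R, 0 < e -> exists l, forall f, `|F f - ev l f| <= e].

Let t0 : T. Proof. by case: (cid P0) => f Pf; exists f. Qed.

Let comb_bound l : exists c, forall f, P f -> `|comb f l| <= c.
Proof.
elim: l => [|p l [c IH]]; first by exists 0 => f _; rewrite /comb big_nil normr0.
have [b bP] := Pb p.2; exists (`|p.1| * b + c) => f Pf; rewrite comb_cons.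
apply: le_trans (ler_normD _ _) _; apply: lerD; last exact: IH.
by rewrite normrM; apply: ler_wpM2l => //; exact: bP.
Qed.

Let S_bound F : S F -> exists c, forall f, `|F f| <= c.
Proof.
move=> /(_ 1 ltr01)[l lP]; have [c cP] := comb_bound l; exists (1 + c) => f.
have := lP f; have := cP _ (svalP f); have := ler_normD (F f - ev l f) (ev l f).
by rewrite subrK /ev; lra.
Qed.

Let leN F f : S F -> `|F f| <= N F.
Proof. by move=> /S_bound[c cP]; apply: ub_le_sup; [exists c => _ [g _ <-]|exists f]. Qed.

Let Nle (F : L) c : (forall f, `|F f| <= c) -> N F <= c.
Proof.
by move=> Fc; apply: ge_sup; [exists `|F t0|; exists t0|move=> _ [f _ <-]; exact: Fc].
Qed.

Let S_lin a F G : S F -> S G -> S (a *: F + G).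
Proof.
move=> SF SG e e0; have e2 : 0 < e / 2 by lra.
have ea : 0 < e / 2 / (`|a| + 1) by apply: divr_gt0 => //; rewrite ltr_wpDl.
have [l lP] := SF _ ea; have [m mP] := SG _ e2.
exists ([seq (a * p.1, p.2) | p <- l] ++ m) => f.
have -> : (a *: F + G) f - ev ([seq (a * p.1, p.2) | p <- l] ++ m) f =
    a * (F f - ev l f) + (G f - ev m f).
  rewrite /ev comb_cat; have -> : comb (sval f) [seq (a * p.1, p.2) | p <- l] = a * comb (sval f) l.
    by rewrite /comb big_map mulr_sumr; apply: eq_bigr => p _; rewrite -scalerA.
  by rewrite mulrBr addrACA -opprD.
apply: le_trans (ler_normD _ _) _; rewrite normrM.
have -> : e = e / 2 + e / 2 by lra.
apply: lerD => //; have a1 : 0 < `|a| + 1 by rewrite ltr_wpDl.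
apply: (@le_trans _ _ ((`|a| + 1) * (e / 2 / (`|a| + 1)))).
  by apply: ler_pM => //; rewrite lerDl.
by rewrite mulrC divfK ?gt_eqF.
Qed.

Let S0 : S 0.
Proof. by move=> e e0; exists [::] => f; rewrite /ev /comb big_nil subr0 normr0 ltW. Qed.

Let SB F G : S F -> S G -> S (F - G).
Proof. by move=> SF SG; rewrite addrC -scaleN1r; exact: S_lin. Qed.

Let complete : complete_norm S N.
Proof.
split.
- split; first exact/mem_set.
  by move=> a F G /set_mem SF /set_mem SG; apply/mem_set; exact: S_lin.
- move=> F G SF SG; apply: Nle => f; apply: le_trans (ler_normD _ _) _.
  by apply: lerD; exact: leN.
- move=> a F SF; have aF : S (a *: F) by rewrite -[a *: F]addr0; exact: S_lin.
  have h b G : S G -> N (b *: G) <= `|b| * N G.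
    by move=> SG; apply: Nle => f; rewrite normrM; apply: ler_wpM2l => //; exact: leN.
  apply/eqP; rewrite eq_le h //=; have [->|a0] := eqVneq a 0.
    rewrite normr0 mul0r; apply: le_trans (normr_ge0 _) (leN t0 _).
    by rewrite scale0r.
  rewrite -ler_pdivlMl ?normr_gt0 // -normfV.
  by have := h a^-1 _ aF; rewrite scalerA mulVf // scale1r.
- move=> F SF F0; apply/funext => f; apply/eqP; rewrite -normr_le0 -F0; exact: leN.
- move=> u Su uc.
  have /choice[l lP] : forall f, exists l : R^o, forall n, `|u n f - l| <= 2^-1 ^+ n.
    move=> f; apply: (@fast_cauchy_lim R R^o (fun n => u n f)) => [n m nm|e]; last exact: half_pow_small.
    by apply: le_trans (uc n m nm); apply: (leN (F := u n - u m)); exact: SB.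
  exists l => [e e0|e e0].
    have e2 : 0 < e / 2 by lra.
    have [n ne] := half_pow_small e2; have [m mP] := Su n _ e2; exists m => f.
    have := lP f n; have := mP f; have := ler_distD (u n f) (l f) (ev m f).
    by rewrite (distrC (l f) (u n f)); lra.
  have [n0 ne] := half_pow_small e0; exists n0 => n nn.
  apply: le_lt_trans ne; apply: Nle => f; apply: le_trans (lP f n) _.
  by apply: ler_wiXn2l => //; lra.
Qed.

(** [U] is the uniform closure of the evaluations among the real functions on [P], with the supremum
    norm. Completion and the identification of combinations that agree on [P] are thereby obtained
    without a quotient. *)
Lemma dual_space : exists (U : completeNormedModType R) (x : K -> U),
  (forall l c, `|comb x l| <= c <-> forall f, P f -> `|comb f l| <= c) /\
  [set: U] `<=` cspan (range x).
Proof.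
pose U := banach_of complete.
have Sev l : S (ev l) by move=> e e0; exists l => f; rewrite subrr normr0 ltW.
have /choice[x xP] : forall b, exists y : U, bof_val y = ev [:: (1, b)].
  by move=> b; exact: bof_mk.
exists U, x.
have combE l : bof_val (comb x l) = ev l.
  rewrite (comb_linear (g := @bof_val _ _ _ _ complete)); last by move=> *; exact: bof_lin.
  apply/funext => f; have := @comb_linear R K L R^o (fun F => F f) (@bof_val _ _ _ _ complete \o x) l.
  move=> -> //; apply: (eq_comb (D := setT)); first by elim: l.
  by move=> b _ /=; rewrite xP /ev comb1.
split.
- move=> l c; rewrite bof_norm combE; split=> [h f Pf|h].
    exact: le_trans (leN (exist _ f Pf) (Sev l)) h.
  by apply: Nle => f; apply: h; exact: (svalP f).
- move=> y _; apply/closureNP => e e0; have e2 : 0 < e / 2 by lra.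
  have Sy : S (bof_val y) := bof_valP y; have [l lP] := Sy _ e2; exists (comb x l).
    by apply/lspan_comb; exists l => //; elim: l {lP}.
  apply: (@le_lt_trans _ _ (e / 2)); last by lra.
  by rewrite bof_norm bofB combE; apply: Nle.
Qed.

End DualSpace.

(** Apply Hahn-Banach to the infimum of |u + t (p - y)| + t (d - c) over t >= 0 and (p, d) in the
    hull; the hypothesis bounds it below by - |u|. The term t = 0 gives norm at most 1, and t = 1 at
    u = y - p gives the inequality for (p, d). *)
Lemma conv_separation {R : realType} {U : completeNormedModType R} (M : set (U * R)) (y : U) (c : R) :
  M !=set0 -> (forall p d, conv M p d -> c <= d + `|p - y|) ->
  exists g : U -> R^o, [/\ forall a u v, g (a *: u + v) = a *: g u + g v,
    forall u, `|g u| <= `|u| & forall p d, M (p, d) -> c <= g p - g y + d].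
Proof.
move=> [[p0 d0] Mp0] Mc.
pose D := [set j : R * (U * R) | 0 <= j.1 /\ conv M j.2.1 j.2.2].
pose F (j : R * (U * R)) (u : U) := `|u + j.1 *: (j.2.1 - y)| + j.1 * (j.2.2 - c).
have [||||P [hP _ PF]] := @inf_sublinear R U _ D F (fun u => - `|u|).
- by exists (0, (p0, d0)); split=> //=; exact: conv_in.
- move=> [t [p d]] u [/= t0 /Mc cp]; rewrite /F /=.
  have := ler_normB (u + t *: (p - y)) u; rewrite addrAC subrr add0r normrZ ger0_norm //.
  have := ler_wpM2l t0 cp; rewrite !mulrDr; lra.
- move=> [t [p d]] [s [q e]] u v [/= t0 Mp] [/= s0 Mq].
  have [ts|ts] := eqVneq (t + s) 0.
    have [-> ->] : t = 0 /\ s = 0 by lra.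
    exists (0, (p, d)); rewrite /F //= !scale0r !addr0 !mul0r !addr0; exact: ler_normD.
  have tsp : 0 < t + s by rewrite lt0r ts addr_ge0.
  pose w := t / (t + s).
  have w1 : (t + s) * w = t by rewrite mulrC divfK.
  have w2 : (t + s) * (1 - w) = s by rewrite mulrBr mulr1 w1; lra.
  exists (t + s, (w *: p + (1 - w) *: q, w * d + (1 - w) * e)).
    split=> /=; first exact: ltW.
    apply: conv_mix => //; first by rewrite divr_ge0 // ltW.
    by rewrite ler_pdivrMr // mul1r; lra.
  rewrite /F /=.
  have -> : (t + s) *: (w *: p + (1 - w) *: q - y) = t *: (p - y) + s *: (q - y).
    by rewrite !scalerBr !scalerDr !scalerA w1 w2 scalerDl opprD addrACA.
  have -> : (t + s) * (w * d + (1 - w) * e - c) = t * (d - c) + s * (e - c).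
    have -> : (t + s) * (w * d + (1 - w) * e - c) =
      ((t + s) * w) * d + ((t + s) * (1 - w)) * e - (t + s) * c by lra.
    by rewrite w1 w2; lra.
  by rewrite addrACA [leRHS]addrACA lerD2r; exact: ler_normD.
- move=> [t [p d]] s u [/= t0 Mp] s0; exists (s * t, (p, d)).
    by split=> //=; rewrite mulr_ge0 // ltW.
  by rewrite /F /= -scalerA -scalerDr normrZ gtr0_norm //; lra.
have [g gl gP] := hahn_banach hP.
have gu u : g u <= `|u|.
  apply: le_trans (gP u) _; have := PF (0, (p0, d0)) u (conj (lexx 0) (conv_in Mp0)).
  by rewrite /F /= scale0r mul0r !addr0.
have gN u : g (- u) = - g u.
  by have := gl (-1) u (u - u); have := gl (-1) u u; rewrite !scaleN1r addNr subrr addr0; lra.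
exists g; split=> //.
  by move=> u; rewrite ler_norml gu -[u]opprK gN lerN2 normrN gu.
move=> p d Mp; have := PF (1, (p, d)) (- (p - y)) (conj ler01 (conv_in Mp)).
rewrite /F /= scale1r addNr normr0 add0r mul1r; have := gP (- (p - y)).
rewrite gN; have := gl (-1) y p; rewrite scaleN1r addrC; lra.
Qed.

(** * Constraints along a well-order *)

Section Constraints.
Context {R : realType} {K : Type} (le : rel K).
Hypothesis wo : wochoice.well_order le.
Let W : Type := (seq (R * K) * R)%type.
Variables (ok : set W -> Prop) (c : K -> set W).
Hypothesis ok1 : ok [set ([::], 1)].

Definition supported (a : K) (l : seq (R * K)) := all_in [set p | strict le p.2 a] l.

Definition constr (M : set W) (f : K -> R^o) (a : K) :=
  forall l d, M (l, d) -> `|f a - comb f l| <= d.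

(** Consistency is tested on the functions obeying the earlier constraints: for each of them the
    intervals of radius d around [comb f l] meet pairwise, hence have a common point, a value at
    [a]. Only [M b] with b before a is consulted, so [M] can be defined by recursion. *)
Definition admissible (a : K) (M : K -> set W) (N : set W) :=
  [/\ ok N, N !=set0, forall l d, N (l, d) -> supported a l &
    forall f, (forall b, strict le b a -> constr (M b) f b) ->
      forall l d l' d', N (l, d) -> N (l', d') -> `|comb f l - comb f l'| <= d + d'].

(** The candidate [c a] of the bookkeeping is adopted if it is admissible. Otherwise a default is
    used, the empty combination with radius 1, which only requires |x_a| <= 1. *)
Lemma constraints_exist : exists M : K -> set W, forall a,
  admissible a M (M a) /\ (admissible a M (c a) -> M a = c a).
Proof.
pose F a (M : K -> set W) := if pselect (admissible a M (c a)) then c a else [set ([::], 1)].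
have [M ME] := wo_rec wo set0 F; exists M => a.
have E N : admissible a (fun b => if pselect (strict le b a) then M b else set0) N <->
    admissible a M N.
  by split=> -[h1 h2 h3 h4]; split=> // f fM; apply: h4 => b ba; have := fM b ba; case: pselect.
rewrite ME /F; case: pselect => [/E h|nh] /=; first by split.
split; last by move=> /E.
split=> //; first by exists ([::], 1).
  by move=> l d [-> _].
by move=> f _ l d l' d' [-> ->] [-> ->]; rewrite subrr normr0.
Qed.

Variable M : K -> set W.
Hypothesis MP : forall a, admissible a M (M a).

Lemma eq_constr f g a : f a = g a -> (forall b, strict le b a -> f b = g b) ->
  constr (M a) f a -> constr (M a) g a.
Proof.
move=> e fg fM l d Ml; have [_ _ /(_ _ _ Ml) sl _] := MP a.
by rewrite -e -(eq_comb sl fg); exact: fM.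
Qed.

(** [r] is the infimum of the right end points of the allowed intervals. Its maximality is what
    makes the distances in [constrained_space] as large as the constraints permit. *)
Lemma constr_next a f : (forall b, strict le b a -> constr (M b) f b) ->
  exists r : R, (forall l d, M a (l, d) -> `|r - comb f l| <= d) /\
    forall s : R, (forall l d, M a (l, d) -> s <= comb f l + d) -> s <= r.
Proof.
move=> fM; have [_ [[l0 d0] M0] _ Mc] := MP a.
pose X : set R := [set comb f q.1 + q.2 | q in M a].
have X0 : X !=set0 by exists (comb f l0 + d0); exists (l0, d0).
have Xlb l d : M a (l, d) -> lbound X (comb f l - d).
  move=> Ml _ [[l' d'] Ml' <-] /=; have := Mc f fM _ _ _ _ Ml Ml'.
  by rewrite ler_norml => /andP[_]; rewrite lerBlDr => h; rewrite lerBlDr; lra.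
exists (inf X); split=> [l d Ml|s sM].
  rewrite ler_distl; apply/andP; split; first by apply: lb_le_inf => //; exact: Xlb.
  by apply: ge_inf; [exists (comb f l0 - d0); exact: Xlb|exists (l, d)].
by apply: lb_le_inf => // _ [[l d] Ml <-]; exact: sM.
Qed.

Lemma constr_extend (D : set K) f : (forall a b, D a -> le b a -> D b) ->
  (forall a, D a -> constr (M a) f a) ->
  exists2 g, (forall a, D a -> g a = f a) & forall a, constr (M a) g a.
Proof.
move=> Ddown fM.
have /choice[r rP] : forall ag : K * (K -> R^o), exists r : R^o,
    (forall b, strict le b ag.1 -> constr (M b) ag.2 b) ->
    forall l d, M ag.1 (l, d) -> `|r - comb ag.2 l| <= d.
  move=> [a g]; have [gM|] := pselect (forall b, strict le b a -> constr (M b) g b).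
    by have [r [rM _]] := constr_next gM; exists r.
  by exists 0.
pose F a g := if pselect (D a) then f a else r (a, g).
have [s sE] := wo_rec wo 0 F.
have sD a : D a -> s a = f a by rewrite sE /F; case: pselect.
exists s => // a; elim/(wo_ind wo) : a => a IH.
have [Da|nDa] := pselect (D a).
  apply: (@eq_constr f); last exact: fM.
    by rewrite sD.
  by move=> b [ba _]; rewrite sD //; exact: Ddown ba.
pose g b : R^o := if pselect (strict le b a) then s b else 0.
have gs b : strict le b a -> g b = s b by rewrite /g; case: pselect.
have sa : s a = r (a, g) by rewrite sE /F; case: pselect.
have gM b : strict le b a -> constr (M b) g b.
  move=> ba; apply: (@eq_constr s) (IH b ba); first by rewrite gs.
  by move=> b' b'b; rewrite gs //; exact: (strict_le_trans wo) b'b (strict_le ba).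
move=> l d Ml; have [_ _ /(_ _ _ Ml) sl _] := MP a.
by rewrite -(eq_comb sl gs) sa; exact: (rP (a, g)).
Qed.

Let P : set (K -> R^o) := [set f | forall a, constr (M a) f a].

Let P0 : P !=set0.
Proof.
by have [||f _ Pf] := @constr_extend set0 0 => //; exists f.
Qed.

Let Pb a : exists b, forall f, P f -> `|f a| <= b.
Proof.
elim/(wo_ind wo) : a => a IH; have [_ [[l d] Ml] sl _] := MP a.
have {sl} := sl l d Ml; have [b bP] : exists b, supported a l -> forall f, P f -> `|comb f l| <= b.
  elim: {Ml} l => [|p l [b bP]]; first by exists 0 => _ f _; rewrite /comb big_nil normr0.
  have [pa|npa] := pselect (strict le p.2 a); last by exists 0 => -[].
  have [b' b'P] := IH p.2 pa; exists (`|p.1| * b' + b) => -[_ sl] f Pf; rewrite comb_cons.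
  apply: le_trans (ler_normD _ _) _; apply: lerD; last exact: bP.
  by rewrite normrM; apply: ler_wpM2l => //; exact: b'P.
move=> /bP {}bP; exists (d + b) => f Pf; have := Pf a l d Ml; have := bP f Pf.
by have := ler_normD (f a - comb f l) (comb f l); rewrite subrK; lra.
Qed.

Definition points (U : completeNormedModType R) (x : K -> U) (N : set W) : set (U * R) :=
  [set (comb x q.1, q.2) | q in N].

(* The norm is the supremum over the functions satisfying all the constraints. A functional
   given by [conv_separation] satisfies them; changing its value at [a] to the largest one
   allowed by [M a] shows that [x a] is as far from each earlier vector as [M a] permits. *)
Lemma constrained_space : exists (U : completeNormedModType R) (x : K -> U),
  [/\ [set: U] `<=` cspan (range x),
   forall a, realizes (points x (M a)) (cspan (x @` [set b | strict le b a])) (x a) &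
   forall a N, ok N -> N !=set0 -> (forall l d, N (l, d) -> supported a l) ->
     consistent (points x N) -> admissible a M N].
Proof.
have [U [x [xP xT]]] := dual_space P0 Pb.
have {}xP l m d : `|comb x l - comb x m| <= d <-> forall f, P f -> `|comb f l - comb f m| <= d.
  have E (V : lmodType R) (v : K -> V) :
      comb v l - comb v m = comb v (l ++ [seq (- p.1, p.2) | p <- m]).
    rewrite comb_cat /comb big_map -sumrN; congr (_ + _); apply: eq_bigr => p _.
    by rewrite scaleNr.
  by rewrite E xP; split=> h f /h; rewrite E.
have x1 a l d : M a (l, d) -> `|x a - comb x l| <= d.
  by move=> Ml; rewrite -(comb1 x a); apply/xP => f /(_ a _ _ Ml); rewrite comb1.
exists U, x; split=> //.
- move=> a; split=> [_ _ [[l d] Ml [<- <-]]|y Ey e e0]; first exact: x1.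
  apply: contrapT => nr; pose c0 := `|x a - y| + e.
  have [| |g [gl g1 gM]] := @conv_separation R U (points x (M a)) y c0.
  + by have [_ [[l d] Ml] _ _] := MP a; exists (comb x l, d); exists (l, d).
  + move=> p d Mp; rewrite leNgt; apply/negP => h; apply: nr; by exists p, d.
  have gc l : g (comb x l) = comb (g \o x) l by apply: comb_linear.
  have gB u v : g (u - v) = g u - g v.
    by rewrite -scaleN1r addrC gl scaleN1r addrC.
  have gP b : constr (M b) (g \o x) b.
    by move=> l d Ml; rewrite -gc /= -gB; apply: le_trans (g1 _) _; exact: x1.
  have [r [r1 r2]] := constr_next (fun b (_ : strict le b a) => gP b).
  pose f b : R^o := if pselect (strict le b a) then g (x b) else r.
  have fx b : strict le b a -> f b = (g \o x) b by rewrite /f; case: pselect.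
  have fa : f a = r by rewrite /f; case: pselect => // -[].
  have [||h hf hP] := @constr_extend [set b | le b a] f.
  + by move=> b b' /= ba b'b; exact: (wo_trans wo) ba.
  + move=> b /= ba; have [->|ne] := pselect (b = a).
      move=> l d Ml; have [_ _ /(_ _ _ Ml) sl _] := MP a.
      by rewrite fa (eq_comb sl fx); exact: r1.
    have sba : strict le b a by split.
    apply: (@eq_constr (g \o x)) (gP b); first by rewrite fx.
    by move=> b' b'b; rewrite fx //; exact: (le_strict_trans wo) b'b.1 sba.
  have e4 : 0 < e / 4 by lra.
  have [_ /lspan_comb[m sm ->] ym] := cspan_approx e4 Ey.
  have hx b : strict le b a -> h b = (g \o x) b by move=> ba; rewrite hf ?fx //; exact: ba.1.
  have hm : comb h m = g (comb x m) by rewrite gc; exact: eq_comb sm hx.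
  have ha : h a = r by rewrite hf ?fa //; exact: (wo_refl wo).
  have := (xP [:: (1, a)] m `|x a - comb x m|).1; rewrite !comb1 => /(_ (lexx _) h hP).
  rewrite comb1 ha hm => hle.
  have h1 := ler_distD y (x a) (comb x m).
  have h2 := le_trans (ler_norm _) hle.
  (* The separation inequality says that c0 + g y lies below every right end point, hence below the
     largest allowed value. But [h] obeys all constraints, so r - g y exceeds |x a - y| by at most e
     / 2, while c0 exceeds it by e. *)
  have h3 : c0 + g y <= r.
    apply: r2 => l d Ml; rewrite -gc.
    have Mld : points x (M a) (comb x l, d) by exists (l, d).
    by have := gM _ _ Mld; lra.
  have h4 := g1 (y - comb x m); rewrite gB ler_norml in h4; have /andP[h5 _] := h4.
  move: h3; rewrite /c0; lra.
- move=> a N okN N0 sN cN; split=> // f fM l d l' d' Nl Nl'.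
  (* Extending [f] past [a] to a function that obeys all constraints brings it among those defining
     the norm of [U], so consistency in [U] bounds its values. *)
  have [|h hf hP] := @constr_extend [set b | strict le b a] f _ fM.
    by move=> b b' /= ba b'b; exact: (le_strict_trans wo) b'b ba.
  rewrite -(eq_comb (sN _ _ Nl) hf) -(eq_comb (sN _ _ Nl') hf).
  by apply: (xP l l' (d + d')).1 => //; apply: cN; [exists (l, d)|exists (l', d')].
Qed.

End Constraints.

(** Up to approximation s = t z + p with p in the span of the centres. A combination q nearly
    attaining the distance from z to (x - p) / t gives the interpolating vector t q + p. *)
Lemma realizes_Ind {R : realType} {U : completeNormedModType R} (M : set (U * R)) X z :
  subsp X -> fst @` M `<=` X -> realizes M X z -> Ind (cspan (fst @` M `|` [set z])) X.
Proof.
move=> hX MX [z1 z2] s x Ss Xx e e0; set S := cspan _ in Ss *.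
have e4 : 0 < e / 4 by lra.
have [s1 /lspan_setU1[t [p [Mp s1E]]] ss1] := cspan_approx e4 Ss.
have hS : subsp S := cspan_subsp _.
have Xp : X p := lspan_le hX MX Mp.
have MS : lspan (fst @` M) `<=` S.
  by move=> q; move=> /lspan_cspan; apply: cspanS => ? ?; left.
suff [r [Sr Xr rP]] : exists r, [/\ S r, X r & `|s1 - r| + `|r - x| < `|s1 - x| + e / 4].
  exists r; split=> //; have := ler_distD s1 s r; have := ler_distD s s1 x.
  by rewrite (distrC s1 s); lra.
have [t0|t0] := eqVneq t 0.
  exists p; split=> //; first exact: MS.
  by rewrite s1E t0 scale0r add0r subrr normr0 add0r ltrDl.
have tp : 0 < `|t| by rewrite normr_gt0.
pose y := t^-1 *: (x - p).
have ty : t *: y = x - p by rewrite scalerA divff // scale1r.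
have Xy : X y by apply: subspZ => //; exact: subspB.
have et : 0 < e / 4 / `|t| by apply: divr_gt0.
have [q [d [Mq qP]]] := z2 y Xy _ et.
have Mq' := conv_lspan Mq; have zq := conv_bound z1 Mq.
have Xq : X q := lspan_le hX MX Mq'.
exists (t *: q + p); split; [by apply: hS.2; exact: MS|exact: hX.2|].
have -> : s1 - (t *: q + p) = t *: (z - q).
  by rewrite s1E scalerBr opprD addrACA subrr addr0.
have -> : t *: q + p - x = t *: (q - y).
  by rewrite scalerBr ty opprB addrA.
have -> : s1 - x = t *: (z - y).
  by rewrite s1E scalerBr ty opprB addrA.
rewrite !normrZ.
have h1 := ler_wpM2l (ltW tp) zq; have : `|t| * (d + `|q - y|) < `|t| * (`|z - y| + e / 4 / `|t|).
  by rewrite ltr_pM2l.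
rewrite !mulrDr [`|t| * (e / 4 / `|t|)]mulrC divfK ?gt_eqF //; lra.
Qed.

Section OptionOrder.
Context {K : Type} (le : rel K).
Hypothesis wo : wochoice.well_order le.

(** A greatest element [None] is added to kappa: the tower is indexed by the ordinals up to and
    including its length. *)
Definition le_option (a b : option K) : bool :=
  match a, b with Some a', Some b' => le a' b' | _, None => true | None, Some _ => false end.

Lemma well_order_option : wochoice.well_order le_option.
Proof.
move=> A [a0 Aa0].
have anti a b : le_option a b -> le_option b a -> a = b.
  by case: a b => [a|] [b|] //= ab ba; rewrite (wo_anti wo ab ba).
suff [z [Az zA]] : exists z, z \in A /\ forall y, y \in A -> le_option z y.
  exists z; split; first by split.
  by move=> z' [Az' z'A]; apply: anti; [exact: zA|exact: z'A].
have [ex|nex] := pselect (exists a, Some a \in A).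
  have [z Az zmin] := wo_least wo (A := [set a | Some a \in A]) ex.
  by exists (Some z); split=> // -[y|] Ay //=; exact: zmin.
case: a0 Aa0 => [a Aa|AN]; first by case: nex; exists a.
by exists None; split=> // -[a Aa|//]; case: nex; exists a.
Qed.

Lemma strict_some a b : strict le_option (Some a) (Some b) <-> strict le a b.
Proof. by split=> -[ab ne]; split=> // e; apply: ne; [rewrite e|case: e]. Qed.

End OptionOrder.

(** * The generated space has the three properties *)

Section Existence.
Context {R : realType} (kappa tau : Type) (le : rel kappa).
Hypothesis ctau : ~ countable [set: tau].
Hypothesis tau_kappa : [set: tau] #<= [set: kappa].
Hypothesis le_init : initial_order le.
Hypothesis le_cofinal : forall C : set kappa, cofinal le C -> [set: kappa] #<= C.
Hypothesis kappa_regular : regular_card kappa.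
Let W : Type := (seq (R * kappa) * R)%type.
Variables (U : completeNormedModType R) (x : kappa -> U) (M : kappa -> set W).

Let E a := cspan (x @` [set b | strict le b a]).

Hypothesis xT : [set: U] `<=` cspan (range x).
Hypothesis xM : forall a, realizes (points x (M a)) (E a) (x a).
Hypothesis Msmall : forall a, M a #< [set: tau].
Hypothesis Msupp : forall a l d, M a (l, d) -> supported le a l.
Hypothesis Mrich : forall a0 N, N #< [set: tau] -> N !=set0 ->
  (forall l d, N (l, d) -> supported le a0 l) -> consistent (points x N) ->
  exists a, le a0 a /\ M a = N.

Let wo := le_init.1.
Let smP := lt_class_small ctau.
Let kcP := lt_class_small (uncountable_kappa ctau tau_kappa).

Let bound (C : set kappa) := @bounded_set kappa le C wo le_cofinal.

Let E_mono a b : le a b -> E a `<=` E b.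
Proof.
move=> ab; apply: cspanS => _ [c ca <-]; exists c => //.
exact: (strict_le_trans wo) ca ab.
Qed.

Let max a b : exists c, le a c /\ le b c.
Proof.
by have [ab|ba] := wo_total wo a b; [exists b|exists a]; split=> //; exact: (wo_refl wo).
Qed.

Let supported_mono a b (l : seq (R * kappa)) : le a b -> supported le a l -> supported le b l.
Proof. by move=> ab; apply: all_in_sub => p pa; exact: (strict_le_trans wo) pa ab. Qed.

Let supported_ex (l : seq (R * kappa)) : exists a, supported le a l.
Proof.
elim: l => [|p l [a la]].
  by have [a _] := infinite_setN0 kappa_regular.1; exists a.
have [b bP] := bound (small1 kcP p.2).
have [c [ac bc]] := max a b; exists c; split; last exact: supported_mono la.
by apply: (strict_le_trans wo) bc; exact: bP.
Qed.

Let bounded_family (T : Type) (D : set T) (P : T -> kappa -> Prop) : D #< [set: kappa] ->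
  (forall t a b, le a b -> P t a -> P t b) -> (forall t, D t -> exists a, P t a) ->
  exists a, forall t, D t -> P t a.
Proof.
move=> Dk Pmono Pex.
have /choice[f fP] : forall t, exists a, D t -> P t a.
  move=> t; have [/Pex[a Pa]|nD] := pselect (D t); first by exists a.
  by have [a _] := infinite_setN0 kappa_regular.1; exists a.
have [a aP] := bound (small_image kcP f Dk).
exists a => t Dt; apply: (Pmono t (f t)); last exact: fP.
by apply: (strict_le (aP _ _)); exists t.
Qed.

(** A vector is the limit of a sequence of combinations, and countably many indices are bounded
    because kappa is regular and uncountable. *)
Let E_point u : exists a, E a u.
Proof.
have p0 n : 0 < 2^-1 ^+ n :> R by apply: exprn_gt0; lra.
have [|||a aP] := @bounded_family nat setT (fun n a =>
    exists2 y, lspan (x @` [set b | strict le b a]) y & `|u - y| < 2^-1 ^+ n).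
- exact: (small_nat kcP).
- move=> n a b ab [y ya uy]; exists y => //; apply: lspanS_sub ya => _ [c ca <-].
  by exists c => //; exact: (strict_le_trans wo) ca ab.
- move=> n _; have [y /lspan_comb[l _ ->] uy] := cspan_approx (p0 n) (xT I : cspan (range x) u).
  by have [a la] := supported_ex l; exists a; exists (comb x l) => //; apply/lspan_comb; exists l.
exists a; apply/closureNP => e e0; have [n ne] := half_pow_small e0.
by have [y ya uy] := aP n I; exists y => //; exact: lt_trans ne.
Qed.

Let E_small (B : set U) : B #< [set: kappa] -> exists a, B `<=` E a.
Proof.
move=> Bk; have [||a aP] := @bounded_family U B (fun u a => E a u) Bk.
- by move=> u a b ab; exact: E_mono.
- by move=> u _; exact: E_point.
- by exists a.
Qed.

(** Centres in [U] need not be combinations of the [x b]. Each pair (p, d) is therefore replaced by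
    pairs with centre a combination within 2^-n of p and radius d + 2^-n, for all n. These are again
    small and consistent, so they occur as some [M a] beyond the base, and [x a] realizes the
    original data as well. *)
Lemma generated_realizing : realizing (U := U) (lt_class tau) (lt_class kappa).
Proof.
move=> X Q kX tQ [q0 Qq0] cQ.
have p0 n : 0 < 2^-1 ^+ n :> R by apply: exprn_gt0; lra.
have /choice[l lP] : forall un : U * nat, exists l, `|un.1 - comb x l| < 2^-1 ^+ un.2.
  move=> [u n]; have [y /lspan_comb[l _ ->] uy] := cspan_approx (p0 n) (xT I : cspan (range x) u).
  by exists l.
pose N : set W := [set (l (q.1.1, q.2), q.1.2 + 2^-1 ^+ q.2) | q in Q `*` [set: nat]].
have tN : N #< [set: tau].
  by apply: (small_image smP); apply: (small_X smP) => //; exact: (small_nat smP).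
have cN : consistent (points x N).
  move=> _ _ _ _ [_ [[[p d] n] [/= Qp _] <-] [<- <-]] [_ [[[q e] m] [/= Qq _] <-] [<- <-]] /=.
  have := cQ _ _ _ _ Qp Qq; have := lP (p, n); have := lP (q, m) => /=.
  have := ler_distD p (comb x (l (p, n))) (comb x (l (q, m))).
  have := ler_distD q p (comb x (l (q, m))); rewrite (distrC _ p); lra.
have [|||a1 a1P] := @bounded_family _ N (fun w a => supported le a w.1).
- exact: card_lt_le_trans tau_kappa.
- by move=> w a b ab; exact: supported_mono.
- by move=> w _; exact: supported_ex.
have [a2 a2P] : exists a, X `|` fst @` Q `<=` E a.
  apply: E_small; apply: (smallU kcP) => //; apply: (small_image kcP).
  exact: card_lt_le_trans tau_kappa.
have [a0 [a10 a20]] := max a1 a2.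
have [|||a [a0a Ma]] := @Mrich a0 N tN.
- by exists (l (q0.1, 0%N), q0.2 + 2^-1 ^+ 0), (q0, 0%N).
- by move=> m d Nm; apply: supported_mono a10 _; exact: (a1P (m, d)).
- exact: cN.
have [z1 z2] := xM a; rewrite Ma in z1 z2.
exists (x a); split.
- move=> p d Qp; apply/ler_addgt0Pr => e e0; have e2 : 0 < e / 2 by lra.
  have [n ne] := half_pow_small e2.
  have := z1 (comb x (l (p, n))) (d + 2^-1 ^+ n).
  have Nl : points x N (comb x (l (p, n)), d + 2^-1 ^+ n).
    by exists (l (p, n), d + 2^-1 ^+ n) => //; exists ((p, d), n).
  move=> /(_ Nl); have := lP (p, n) => /=.
  have := ler_distD (comb x (l (p, n))) (x a) p; rewrite (distrC (comb x _) p); lra.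
- move=> y Qy e e0; have Ey : E a y.
    by apply: (E_mono a0a); apply: (E_mono a20); move: Qy; apply: cspan_mono.
  have [p' [d' [Np pd]]] := z2 y Ey e e0.
  (* The enlargement of the radius pays for the displacement of the centre, and this is stable under
     convex combinations. *)
  have [p [d [Qp pdd]]] : exists p d, conv Q p d /\ d + `|p - p'| <= d'.
    elim: Np {pd} => [_ _ [_ [[[p d] n] [/= Qp _] <-] [<- <-]]|t p1 p2 d1 d2 t0 t1 _
        [q1 [e1 [Q1 h1]]] _ [q2 [e2 [Q2 h2]]]].
      exists p, d; split; first exact: conv_in.
      by rewrite lerD2l; exact: ltW (lP (p, n)).
    exists (t *: q1 + (1 - t) *: q2), (t * e1 + (1 - t) * e2); split; first exact: conv_mix.
    have := @mix_dist R U t p1 p2 q1 q2 (d1 - e1) (d2 - e2) t0 t1.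
    by rewrite !lerBrDl => /(_ h1 h2); rewrite !mulrBr; lra.
  exists p, d; split=> //; have := ler_distD p' p y; lra.
Qed.

Lemma generated_filtered : tightly_filtered tau U.
Proof.
pose E' b := cspan (x @` [set a | strict (le_option le) (Some a) b]).
have woo := well_order_option wo.
have sub A : is_subspace (cspan A : set U).
  by apply/is_subspaceE; split; [exact: cspan_closed|exact: cspan_subsp].
have E'mono a b : le_option le a b -> E' a `<=` E' b.
  move=> ab; apply: cspanS => _ [c ca <-]; exists c => //.
  exact: (strict_le_trans woo) ca ab.
have E'some a : E' (Some a) = E a.
  have sE : [set b | strict (le_option le) (Some b) (Some a)] = [set b | strict le b a].
    by apply/seteqP; split=> b /strict_some.
  by rewrite /E' sE.
exists (option kappa), (le_option le), None, E'; split; first by split; [exact: woo|case|move=> a; exact: sub].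
split.
- by move=> a b ab; apply: E'mono; exact: strict_le ab.
- move=> a za; apply/seteqP; split; last by move=> _ ->; exact: (cspan_subsp _).1.
  have -> : E' a = cspan set0.
    rewrite /E'; congr cspan; apply/seteqP; split=> // v [b ba _].
    by have := (not_le woo a (Some b)).2 ba (za _).
  move=> v v0; apply/eqP; rewrite -normr_le0; apply/ler_addgt0Pr => e e0; rewrite add0r.
  have [w w0 vw] := cspan_approx e0 v0; move: vw.
  suff -> : w = 0 by rewrite subr0 => /ltW.
  by elim: w0 => // ? ? ? [].
- apply/seteqP; split=> // u _; have : cspan (range x) u by exact: xT.
  by apply: cspanS => _ [b _ <-]; exists b.
- move=> [c|] b; last by case: b => [b|] [[]].
  move=> cb.
  have bE : [set a | strict (le_option le) (Some a) b] = [set a | strict le a c] `|` [set c].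
    apply/seteqP; split=> a.
      move=> /(succ_le woo cb) /= ac; have [->|ne] := pselect (a = c); first by right.
      by left; split.
    move=> [/strict_some ac|->]; last exact: cb.1.
    exact: (strict_le_trans woo) ac (strict_le cb.1).
  have E'bE : E' b = cspan (x @` ([set a | strict le a c] `|` [set c])) by rewrite /E' bE.
  rewrite E'some; pose P := points x (M c).
  have PE : fst @` P `<=` lspan (x @` [set a | strict le a c]).
    by move=> _ [_ [[l d] Ml <-] <-] /=; apply/lspan_comb; exists l => //; exact: Msupp Ml.
  have PE' : fst @` P `<=` E c by move=> p /PE/lspan_cspan.
  have EcE' : E c `<=` E' b by rewrite -E'some; apply: E'mono; exact: (strict_le cb.1).
  have xcE' : E' b (x c) by apply: cspan_sub; exists c => //; exact: cb.1.
  (* The push-out factor of the step that adjoins [x c]: the centres of the constraints on [x c],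
     together with [x c]. *)
  pose D := fst @` P `|` [set x c].
  have SE' : cspan D `<=` E' b by apply: cspan_mono => p [/PE'/EcE'//|->].
  exists (cspan D).
    apply: Ind_pushout; [exact: sub|exact: sub|exact: sub|exact: SE'|exact: EcE'| |]; last first.
      exact: (realizes_Ind (cspan_subsp _) PE' (xM c)).
    apply/seteqP; split; last first.
      rewrite [X in _ `<=` X]((closure_id _).1 (@cspan_closed _ _ _)); apply: closure_subset.
      by move=> _ [s Ss [y Ey <-]]; apply: (subspD (cspan_subsp _)); [exact: SE'|exact: EcE'].
    rewrite E'bE image_setU image_set1; apply: closure_subset => v /lspan_setU1[t [y [yE ->]]].
    exists (t *: x c); first by apply: (subspZ _ (cspan_subsp _)); apply: cspan_sub; right.
    by exists y => //; exact: lspan_cspan.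
  apply/dens_ltP; exists (qspan D); split.
  + by move=> v /qspan_lspan; exact: lspan_cspan.
  + by rewrite cspan_qspan.
  + apply: (small_qspan smP); apply: (smallU smP); last exact: (small1 smP).
    by apply: (small_image smP); apply: (small_image smP); exact: Msmall.
- move=> b [nz bs]; apply/seteqP; split.
    apply: cspan_le; first exact: closed_closure.
      apply: subsp_closure; split.
        apply: contrapT => n0; apply: nz => a; apply: contrapT => /(not_le woo) ab.
        by apply: n0; exists a => //; exact: (cspan_subsp _).1.
      move=> t v w [i ib vi] [j jb wj]; have [ij|ji] := wo_total woo i j.
        by exists j => //; apply: (cspan_subsp _).2 => //; exact: E'mono vi.
      by exists i => //; apply: (cspan_subsp _).2 => //; exact: E'mono wj.
    move=> _ [c cb <-]; apply: subset_closure.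
    have [d [cd db]] := strict_succ woo cb.
    have [e|ne] := pselect (d = b); first by case: (bs (Some c)); rewrite -e.
    exists d; first by split.
    by apply: cspan_sub; exists c => //; exact: cd.1.
  rewrite [X in _ `<=` X]((closure_id _).1 (@cspan_closed _ _ _)); apply: closure_subset.
  by move=> v [a ab]; exact: (E'mono _ _ (strict_le ab)).
Qed.

(** A dense set smaller than kappa would lie in one [E a0], making it the whole space. But beyond
    [a0] some [x a] is subject only to the constraint |x_a| <= 1, and realizing it puts [x a] at
    distance at least 1 from [E a]. *)
Lemma generated_dens : has_dens [set: U] kappa.
Proof.
have kle := le_class_small kappa_regular.1.
have big (D : set U) : dense_in [set: U] D -> [set: kappa] #<= D.
  move=> [_ TD]; apply: contrapT => /card_ltNle Dk.
  have [a0 Da0] := E_small Dk.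
  have EaT : [set: U] `<=` E a0.
    by apply: (subset_trans TD); rewrite [X in _ `<=` X]((closure_id _).1 (@cspan_closed _ _ _));
      exact: closure_subset.
  pose N : set W := [set ([::], 1)].
  have [||||a [a0a Ma]] := @Mrich a0 N.
  - exact: (small1 smP).
  - by exists ([::], 1).
  - by move=> l d [-> _].
  - move=> _ _ _ _ [_ -> [<- <-]] [_ -> [<- <-]]; rewrite subrr normr0 /=; lra.
  have [_] := xM a; rewrite Ma => /(_ (x a) (E_mono a0a (EaT _ I)) 1 ltr01)[p [d [Np]]].
  have : 1 <= d.
    elim: Np => [_ _ [_ -> [_ <-]] //|t p1 p2 d1 d2 t0 t1 _ h1 _ h2].
    have h3 := ler_wpM2l t0 h1; have t1' : 0 <= 1 - t by lra.
    by have h4 := ler_wpM2l t1' h2; lra.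
  by rewrite subrr normr0; have := normr_ge0 (p - x a); lra.
split=> //; exists (qspan (range x)).
  by split=> // u _; rewrite cspan_qspan; exact: xT.
apply/card_eqPle; split; last by apply: big; split=> // u _; rewrite cspan_qspan; exact: xT.
by apply: (small_qspan kle); exact: (small_image kle).
Qed.

Lemma generated_X_kappa_tau : is_X_kappa_tau kappa tau U.
Proof.
split; [exact: generated_dens|exact: generated_filtered|].
exact: realizing_extension generated_realizing.
Qed.

End Existence.

(** Dedekind cuts, coded as functions from the rationals to two distinct elements of [K]. *)
Lemma card_real_le (R : realType) (K : Type) : infinite_set [set: K] ->
  [set: rat -> K] #<= [set: K] -> [set: R] #<= [set: K].
Proof.
move=> /infiniteP nK; apply: card_le_trans.
have [f [_ finj]] := card_le_fun nK (ex_intro _ 0%N I).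
pose cut (x : R) (q : rat) := f (ratr q < x).
have cut_le x y : cut x = cut y -> ~ x < y.
  move=> xy /rat_in_itvoo[q]; rewrite in_itv /= => /andP[xq qy].
  have := finj _ _ I I (congr1 (@^~ q) xy); by rewrite qy ltNge (ltW xq).
apply: (@card_le_inj _ _ _ _ cut) => // x y _ _ xy.
by have [/(cut_le _ _ xy)|/(cut_le _ _ (esym xy))|] := ltgtP x y.
Qed.

Lemma X_kappa_tau_exists (R : realType) (kappa tau : Type) : regular_card kappa ->
  ~ countable [set: tau] -> weak_power_eq kappa tau kappa ->
  exists U : completeNormedModType R, is_X_kappa_tau kappa tau U.
Proof.
move=> kreg ctau ktau; have [kinf [le le_init le_cof]] := kreg.
have tk := weak_power_le kinf ktau; have kP := le_class_small kinf.
have smP := lt_class_small ctau.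
have Rk : [set: R] #<= [set: kappa].
  apply: card_real_le => //; apply: ktau.1; exists rat => //.
  exact: (small_countable smP).
pose W : Type := (seq (R * kappa) * R)%type.
have Wk : [set: W] #<= [set: kappa].
  rewrite -setXTT; apply: (small_X kP) => //.
  suff -> : [set: seq (R * kappa)] = [set s | all_in setT s].
    by apply: (small_seq kP); rewrite -setXTT; exact: (small_X kP).
  by apply/seteqP; split=> // s _; elim: s.
have [c cP] := bookkeeping le_init kinf tk ktau ([::], 0) Wk.
have wo := le_init.1; pose ok (N : set W) : Prop := N #< [set: tau].
have ok1 : ok [set ([::], 1)] by exact: (small1 smP).
have [M MP] := constraints_exist wo c ok1.
have [U [x [xT xM xc]]] := constrained_space wo (fun a => (MP a).1).
exists U; apply: (@generated_X_kappa_tau _ _ _ le _ _ _ _ _ U x M) => //.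
- by move=> a; have [[]] := MP a.
- by move=> a l d; have [[_ _ h _] _] := MP a; exact: h.
- move=> a0 N tN N0 Ns Nc; have [a [a0a ca]] := cP N tN a0.
  exists a; split=> //; rewrite -ca; apply: (MP a).2; rewrite ca; apply: xc => // l d Nl.
  by apply: all_in_sub (Ns l d Nl) => p pa; exact: (strict_le_trans wo) pa a0a.
Qed.

Theorem theorem35 (R : realType) (kappa tau : Type)
    (kappa_regular : regular_card kappa)
    (tau_uncountable : ~ countable [set: tau])
    (kappa_tau : weak_power_eq kappa tau kappa) :
  (exists U : completeNormedModType R, is_X_kappa_tau kappa tau U) /\
  (forall U U' : completeNormedModType R,
    is_X_kappa_tau kappa tau U -> is_X_kappa_tau kappa tau U' ->
    isometric U U').
Proof.
split; first exact: X_kappa_tau_exists.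
have tk := weak_power_le kappa_regular.1 kappa_tau.
exact: X_kappa_tau_unique.
Qed.
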